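(* Let $\Delta\subseteq\mathbb{R}^2$ be a finite simplicial complex homeomorphic to a disk, and let $\mathbf r=\{r_\tau : \tau\in\Delta_1^\circ\}$ and $\mathbf s=\{s_\gamma : \gamma\in\Delta_0\}$ be families of non-negative integers. Then for all sufficiently large $d$ $$\dim \mathcal S_d^{\mathbf r,\mathbf s}(\Delta)= \binom{d+2}{2}+\sum_{\tau\in\Delta_1^\circ}\dim J(\tau)_d-\sum_{\gamma\in\Delta_0^\circ}\dim J(\gamma)_d .$$
   Context: $\Delta_i$ is the set of $i$-dimensional faces of $\Delta$ and $\Delta_i^\circ$ the subset of interior ones (those not contained in the boundary of $\Delta$). All dimensions are over $\mathbb R$, and a subscript $d$ on a graded object denotes its degree $d$ part. $S=\mathbb{R}[x,y,z]$ with the standard grading. $\mathcal S_d^{\mathbf r,\mathbf s}(\Delta)$ is the real vector space of continuous functions $f$ on $\Delta$ such that: on each triangle $\sigma\in\Delta_2$, $f|_\sigma$ is a polynomial of total degree at most $d$; for each interior edge $\tau$, $f$ is $C^{r_\tau}$ on the union of the two triangles containing $\tau$; and for each vertex $\gamma\in\Delta_0$, the polynomials $f|_\sigma$, for all triangles $\sigma$ containing $\gamma$, have the same partial derivatives at $\gamma$ up to order $s_\gamma$. Embed $\mathbb R^2$ in $\mathbb R^3$ as the plane $z=1$. For a face $\beta$ of $\Delta$, $\hat\beta\subset\mathbb R^3$ is the convex hull of the origin and the image of $\beta$. For an edge $\tau$, $\ell_\tau\in S$ is a nonzero linear form vanishing on $\hat\tau$. For a vertex $\gamma$, $\hat{\mathfrak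 m}_\gamma\subset S$ is the ideal of polynomials vanishing on the line through $\hat\gamma$. For an interior edge $\tau=[\gamma,\gamma']$, $$J(\tau)=\langle \ell_\tau^{r_\tau+1}\rangle\cap\hat{\mathfrak m}_\gamma^{s_\gamma+1}\cap\hat{\mathfrak m}_{\gamma'}^{s_{\gamma'}+1},$$ and for a vertex $\gamma$, $J(\gamma)=\sum_{\tau\in\Delta_1^\circ,\ \tau\ni\gamma}J(\tau)$. *)

(* Defs.v *)
From HB Require Import structures.
From mathcomp Require Import all_boot all_order all_algebra finmap.
From mathcomp Require Import all_classical all_reals all_analysis.
(* The notations of [mpoly] clash with those of mathcomp-analysis; its
   canonical structures are needed. *)
From mathcomp Require Import -(notations) mpoly.

Set Implicit Arguments.
Unset Strict Implicit.
Unset Printing Implicit Defensive.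

Import Order.TTheory GRing.Theory Num.Theory.
Import numFieldNormedType.Exports.

Local Open Scope classical_set_scope.
Local Open Scope ring_scope.

(* [A] is a linear subspace of [V] of finite dimension [n]. *)
Definition has_dim (R : realType) (V : lmodType R) (A : set V) (n : nat) :=
  exists b : 'I_n -> V,
    (forall c : 'I_n -> R, \sum_i c i *: b i = 0 -> forall i, c i = 0) /\
    A = [set v | exists c : 'I_n -> R, v = \sum_i c i *: b i].

Definition homeomorphic (X Y : topologicalType) :=
  exists (f : X -> Y) (g : Y -> X),
    [/\ continuous f, continuous g, cancel f g & cancel g f].

Section Simplices.
Context {R : realType} {n : nat}.
Implicit Types A : {fset 'rV[R]_n}.

Definition conv A : set 'rV[R]_n :=
  [set x | exists c : 'rV[R]_n -> R,
    [/\ forall a, 0 <= c a, \sum_(a <- A) c a = 1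
      & x = \sum_(a <- A) c a *: a]].

Definition affinely_independent A :=
  forall c : 'rV[R]_n -> R,
    \sum_(a <- A) c a = 0 -> \sum_(a <- A) c a *: a = 0 ->
    forall a, a \in A -> c a = 0.

End Simplices.

Section PlaneComplexes.
Context {R : realType}.
Local Notation point := 'rV[R]_2.
(* A simplex is represented by the finite set of its vertices. *)
Local Notation simplex := {fset point}.
Implicit Types (K : {fset simplex}) (A B : simplex).

(* Since [conv fset0 = set0], the last clause also covers simplices without
   common vertices. *)
Definition simplicial_complex K :=
  [/\ fset0 \notin K,
      forall A, A \in K -> affinely_independent A,
      forall A B, A \in K -> (B `<=` A)%fset -> B != fset0 -> B \in K
    & forall A B, A \in K -> B \in K ->
        conv A `&` conv B = conv (A `&` B)%fset].

Definition support K : set point := \bigcup_(A in [set` K]) conv A.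

Definition unit_disk : set point := [set x | \sum_i x 0 i ^+ 2 <= 1].

Definition disk_complex K := homeomorphic (support K) unit_disk.

Definition boundary K : set point := closure (support K) `\` interior (support K).

Definition interior_face K A := ~ (conv A `<=` boundary K).

Definition triangles K : {fset simplex} := [fset A in K | #|` A| == 3]%fset.

Definition edges K : {fset simplex} := [fset A in K | #|` A| == 2]%fset.

Definition vertices K : {fset point} :=
  [fset x in fcover K | [fset x]%fset \in K]%fset.

Definition interior_edges K : {fset simplex} :=
  [fset A in edges K | `[< interior_face K A >]]%fset.

Definition interior_vertices K : {fset point} :=
  [fset x in vertices K | `[< interior_face K [fset x]%fset >]]%fset.

End PlaneComplexes.

Section Splines.
Context {R : realType}.
Local Notation point := 'rV[R]_2.
Local Notation simplex := {fset point}.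
Local Notation poly2 := (mpoly.mpoly 2 R).

Definition peval (n : nat) (p : mpoly.mpoly n R) (x : 'rV[R]_n) : R :=
  mpoly.meval (fun i => x 0 i) p.

(* [F] is of class C^k on the open set [U]. *)
Fixpoint class_C (k : nat) (U : set point) (F : point -> R) : Prop :=
  (forall x, U x -> {for x, continuous F}) /\
  match k with
  | 0 => True
  | k'.+1 => forall i : 'I_2,
      (forall x, U x -> derivable F x (delta_mx 0 i)) /\
      class_C k' U ('D_(delta_mx 0 i) F)
  end.

(* A function on a set is of class C^k on a subset [A], not necessarily open,
   when it agrees on [A] with a function of class C^k on a neighbourhood
   of [A]. *)
Definition class_C_on (X : set point) (k : nat) (A : set point) (f : X -> R) :=
  exists (U : set point) (F : point -> R),
    [/\ open U, A `<=` U, class_C k U F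
      & forall x : X, A (val x) -> f x = F (val x)].

Context (K : {fset simplex}) (r : simplex -> nat) (s : point -> nat).

(* [P sigma] is the polynomial which f equals on [sigma]; it is unique, as a
   triangle has nonempty interior. *)
Definition spline_space (d : nat) : set (support K -> R^o) :=
  [set f | continuous f /\
    exists P : simplex -> poly2,
    [/\ forall sigma, sigma \in triangles K ->
          (mpoly.msize (P sigma) <= d.+1)%N /\
          (forall x : support K, conv sigma (val x) ->
             f x = peval (P sigma) (val x)),
        forall tau, tau \in interior_edges K ->
          class_C_on (r tau)
            (\bigcup_(sigma in [set A | A \in triangles K /\
                                        (tau `<=` A)%fset]) conv sigma) f
      & forall gamma, gamma \in vertices K ->
        forall sigma1 sigma2,
          sigma1 \in triangles K -> gamma \in sigma1 ->
          sigma2 \in triangles K -> gamma \in sigma2 ->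
        forall m : mpoly.multinom 2, (mpoly.mdeg m <= s gamma)%N ->
          peval (mpoly.mderivm m (P sigma1)) gamma =
          peval (mpoly.mderivm m (P sigma2)) gamma]].

End Splines.

Section Ideals.
Context {R : realType}.
Local Notation S := (mpoly.mpoly 3 R).
Implicit Types I G : set S.

Definition ideal_gen G : set S :=
  [set p | exists (k : nat) (a g : 'I_k -> S),
    (forall i, G (g i)) /\ p = \sum_i a i * g i].

Definition ideal_pow I (k : nat) : set S :=
  ideal_gen [set p | exists g : 'I_k -> S,
    (forall i, I (g i)) /\ p = \prod_i g i].

Definition degree_part I (d : nat) : set S :=
  [set p | I p /\ p \is mpoly.ishomog1 d (@mpoly.mdeg 3)].

Local Notation point := 'rV[R]_2.
Local Notation simplex := {fset point}.

Definition embed (x : point) : 'rV[R]_3 := row_mx x (const_mx 1 : 'rV[R]_1).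

Definition hat (A : simplex) : set 'rV[R]_3 :=
  conv (0 |` [fset embed x | x in A])%fset.

Definition vanishing_linear_form (A : simplex) (l : S) :=
  [/\ l != 0, l \is mpoly.ishomog1 1 (@mpoly.mdeg 3)
    & forall v, hat A v -> peval l v = 0].

(* The segment [hat [fset x]] spans the line of multiples of [embed x]. *)
Definition vertex_ideal (x : point) : set S :=
  [set p | forall t : R, peval p (t *: embed x) = 0].

Context (K : {fset simplex}) (r : simplex -> nat) (s : point -> nat).
Context (ell : simplex -> S).

Definition J_edge (tau : simplex) : set S :=
  ideal_gen [set ell tau ^+ (r tau).+1] `&`
  \bigcap_(gamma in [set` tau]) ideal_pow (vertex_ideal gamma) (s gamma).+1.

Definition J_vertex (gamma : point) : set S :=
  [set p | exists q : simplex -> S,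
    (forall tau, tau \in interior_edges K -> gamma \in tau ->
       J_edge tau (q tau)) /\
    p = \sum_(tau <- interior_edges K | gamma \in tau) q tau].

End Ideals.

(* Main.v *)
(* Homogenizing, a spline of degree at most d is a family P of forms of degree d
   indexed by the triangles whose difference across every interior edge t lies in
   J(t): smoothness across an edge amounts to divisibility by a power of its
   linear form, and equality of derivatives at a vertex g to membership in the
   power of the ideal of g, which propagates from triangle to triangle because the
   star of g is connected through its interior edges. With W the forms of degree d,
   the signed incidences give maps

     W^triangles --D--> W^(interior edges) --B--> W^(interior vertices)

   where ker D is the constants, im D = ker B, and, for large d, B maps the sum of
   the J(t)_d onto the sum of the J(g)_d; the dimension of the preimage by D of the
   J(t)_d follows. Exactness at the middle term is local at every vertex, by
   counting edges and triangles of the star, and local solutions glue because the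
   disk has no monodromy. For surjectivity, products of powers of the edge forms
   annihilate the cokernel whenever the remaining edge lines have a common zero; by
   induction on the number of edges involved, a power of every linear form
   annihilates it, and J(t) is generated in bounded degree. *)

From HB Require Import structures.
From Pilot Require Import Defs.
From mathcomp Require Import all_boot all_order all_algebra finmap.
From mathcomp Require Import all_classical all_reals all_analysis.
From mathcomp Require Import -(notations) mpoly.
From mathcomp Require Import zify ring lra.
(* mathcomp-analysis has its own [conv]. *)
Import Pilot.Defs.

Set Implicit Arguments.
Unset Strict Implicit.
Unset Printing Implicit Defensive.

Import Order.TTheory GRing.Theory Num.Theory.
Import numFieldNormedType.Exports.

Local Open Scope classical_set_scope.
Local Open Scope ring_scope.

(** The maps D and B are scalar matrices, so exactness is proved once over the field and carried to
    coefficients in W by a basis. The count is then rank-nullity applied twice. The bound on the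
    degree comes from coordinates in which the zero plane of an edge form is a coordinate plane and
    the lines over the endpoints are axes: there J(t) is a monomial ideal cut out by three
    inequalities between exponents, and each of its monomials of large degree is a high power of a
    variable times a monomial of J(t).

    The obstacle is that only a homeomorphism with the disk is given: neither purity, nor the shape
    of stars, nor a combinatorial form of simple connectedness. Two facts replace them. A small
    piece of the disk stays connected when a point is removed, so no point separates the support
    locally; this gives purity and connected stars. And a cocycle for nearby points of the disk is a
    coboundary there, with a Lebesgue number translating nearness into common vertices. *)

Section LinearAlgebra.

(** A subspace of maximal dimension inside [A] exhausts it: adjoining a vector of [A] outside it
    would give a larger one. *)
Lemma set_is_vspace (F : fieldType) (V : vectType F) (A : set V) :
  A 0 -> (forall c u v, A u -> A v -> A (c *: u + v)) ->
  exists U : {vspace V}, forall v, (v \in U) <-> A v.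
Proof.
move=> A0 Alin.
pose P n := `[< exists U : {vspace V}, \dim U = n /\ forall v, v \in U -> A v >].
have P0 : exists n, P n.
  exists 0%N; apply/asboolP; exists 0%VS; split; first exact: dimv0.
  by move=> v; rewrite memv0 => /eqP->.
have Pb n : P n -> (n <= \dim {: V})%N.
  by move=> /asboolP[U [<- _]]; rewrite dimvS ?subvf.
case: (ex_maxnP P0 Pb) => n /asboolP[U [dU UA]] nmax.
exists U => v; split=> [|Av]; first exact: UA.
apply/negPn/negP => vU.
have : P (\dim (U + <[v]>)%VS).
  apply/asboolP; exists (U + <[v]>)%VS; split=> // w /memv_addP[u uU [x /vlineP[c ->] ->]].
  by rewrite addrC; apply: Alin => //; exact: UA.
move=> /nmax; rewrite -dU => le.
have /eqP UE : U == (U + <[v]>)%VS by rewrite eqEdim addvSl.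
by move/negP: vU; apply; rewrite UE memvE addvSr.
Qed.

(** [V] need not be finite-dimensional (all polynomials, all functions on the support), so
    dimensions are computed in a finite-dimensional model [W] and carried over by a map injective on
    [U]. *)
Lemma has_dim_image (R : realType) (W : vectType R) (V : lmodType R)
    (phi : {linear W -> V}) (U : {vspace W}) (A : set V) :
  (forall u, u \in U -> phi u = 0 -> u = 0) ->
  (forall v, A v <-> exists2 u, u \in U & v = phi u) ->
  has_dim A (\dim U).
Proof.
move=> phi_inj AE.
have bU := vbasisP U; have bfree := basis_free bU.
exists (fun i => phi (vbasis U)`_i); split.
  move=> c c0; apply/(freeP _).
    exact: bfree.
  apply: phi_inj.
    by apply: memv_suml => i _; rewrite memvZ // vbasis_mem // mem_nth // size_tuple.
  by rewrite linear_sum -[RHS]c0; apply: eq_bigr => i _; rewrite linearZ.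
apply/seteqP; split=> v /=.
  move=> /AE[u uU ->]; exists (fun i => coord (vbasis U) i u).
  rewrite {1}(coord_vbasis uU) linear_sum; apply: eq_bigr => i _.
  by rewrite linearZ.
move=> [c ->]; apply/AE; exists (\sum_i c i *: (vbasis U)`_i).
  by apply: memv_suml => i _; rewrite memvZ // vbasis_mem // mem_nth // size_tuple.
by rewrite linear_sum; apply: eq_bigr => i _; rewrite linearZ.
Qed.

Lemma vspace_ffun (F : fieldType) (W : vectType F) (I : finType)
    (J : I -> {vspace W}) :
  exists U : {vspace {ffun I -> W}},
    (forall q : {ffun I -> W}, (q \in U) = [forall i, q i \in J i]) /\
    \dim U = (\sum_i \dim (J i))%N.
Proof.
(* [g i] is the inclusion of the i-th summand; the space sought is the direct sum of the images of
   the [J i]. *)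
pose g i (w : W) : {ffun I -> W} := [ffun j => if j == i then w else 0].
have g_lin i : linear (g i).
  move=> c u v; apply/ffunP => j; rewrite !ffunE; case: eqP => //.
  by rewrite scaler0 addr0.
pose gL i : {linear W -> {ffun I -> W}} :=
  HB.pack (g i) (GRing.isLinear.Build F W {ffun I -> W} *:%R (g i) (g_lin i)).
pose G i : 'Hom(W, {ffun I -> W}) := linfun (gL i).
have GE i w : G i w = g i w by rewrite lfunE.
have qE (q : {ffun I -> W}) : q = \sum_i G i (q i).
  apply/ffunP => j; rewrite sum_ffunE (bigD1 j) //= GE ffunE eqxx big1 ?addr0 //.
  by move=> i ij; rewrite GE ffunE eq_sym (negbTE ij).
exists (\sum_i (G i @: J i))%VS; split.
  move=> q; apply/idP/forallP.
    move=> /memv_sumP[v vJ ->] i; rewrite sum_ffunE memv_suml // => k _.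
    have /memv_imgP[w wJ ->] := vJ k isT; rewrite GE ffunE.
    by case: eqP => [->|_] //; exact: mem0v.
  move=> qJ; rewrite [q]qE; apply/memv_sumP.
  by exists (fun i => G i (q i)) => // i _; exact: memv_img.
have /directvP/= -> : directv (\sum_i (G i @: J i))%VS.
  apply/directv_sum_independent => u uJ u0 i _.
  have /memv_imgP[w wJ uE] := uJ i isT; rewrite uE.
  suff -> : w = 0 by rewrite linear0.
  have := congr1 (fun q : {ffun I -> W} => q i) u0; rewrite sum_ffunE (bigD1 i) //=.
  rewrite uE GE !ffunE eqxx big1 ?addr0 // => k ki.
  have /memv_imgP[w' _ ->] := uJ k isT; rewrite GE ffunE eq_sym (negbTE ki) //.
apply: eq_bigr => i _; apply: limg_dim_eq; apply/eqP.
rewrite -subv0; apply/subvP => w; rewrite memv_cap => /andP[_]; rewrite memv_ker GE memv0.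
move=> /eqP/(congr1 (fun q : {ffun I -> W} => q i)); rewrite !ffunE eqxx => ->.
by rewrite eqxx.
Qed.

(** Rank-nullity twice: [f] on the preimage of [J] has kernel [lker f] and, by exactness, image
    [J :&: lker g], which is the kernel of [g] on [J]. *)
Lemma dim_preim_exact (F : fieldType) (C2 C1 C0 : vectType F)
    (f : 'Hom(C2, C1)) (g : 'Hom(C1, C0)) (J : {vspace C1}) :
  limg f = lker g ->
  (\dim (f @^-1: J) + \dim (g @: J) = \dim (lker f) + \dim J)%N.
Proof.
move=> exact_fg.
rewrite -(limg_ker_dim f (f @^-1: J)).
have -> : ((f @^-1: J) :&: lker f = lker f)%VS.
  apply/capv_idPr/subvP => u; rewrite memv_ker -memv_preim => /eqP->.
  exact: mem0v.
have -> : (f @: (f @^-1: J) = J :&: lker g)%VS.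
  by rewrite -exact_fg -lpreim_cap_limg lpreimK ?capvSr.
by rewrite -addnA limg_ker_dim.
Qed.

End LinearAlgebra.

Local Notation Xv i := (mpolyX _ (mnm1 i)).

(** * Polynomials and ideals *)

Section PolynomialFunctions.
Context {R : realType}.

Lemma mpoly_alg_ind n (P : mpoly n R -> Prop) :
  (forall c, P (mpolyC n c)) -> (forall i, P (Xv i)) ->
  (forall p q, P p -> P q -> P (p + q)) ->
  (forall p q, P p -> P q -> P (p * q)) -> forall p, P p.
Proof.
move=> PC PX PD PM p; rewrite [p]mpolyE.
have PX' m : P (mpolyX R m).
  rewrite mpolyXE_id; elim/big_ind: _ => [||i _]; first by rewrite -mpolyC1.
  - by [].
  elim: (m i) => [|k IH]; first by rewrite expr0 -mpolyC1.
  by rewrite exprS; exact: PM.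
elim/big_ind: _ => [||m _]; first by rewrite -(mpolyC0 n).
- by [].
by rewrite -mul_mpolyC; exact: PM.
Qed.

Lemma pevalD n (p q : mpoly n R) x : peval (p + q) x = peval p x + peval q x.
Proof. exact: mevalD. Qed.
Lemma pevalB n (p q : mpoly n R) x : peval (p - q) x = peval p x - peval q x.
Proof. exact: mevalB. Qed.
Lemma pevalM n (p q : mpoly n R) x : peval (p * q) x = peval p x * peval q x.
Proof. exact: mevalM. Qed.
Lemma pevalZ n c (p : mpoly n R) x : peval (c *: p) x = c * peval p x.
Proof. exact: mevalZ. Qed.
Lemma pevalC n c x : peval (mpolyC n c : mpoly n R) x = c.
Proof. exact: mevalC. Qed.
Lemma pevalX n i x : peval (Xv i : mpoly n R) x = x 0 i.
Proof. exact: mevalXU. Qed.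
Lemma peval_sum n I (r : seq I) P (F : I -> mpoly n R) x :
  peval (\sum_(i <- r | P i) F i) x = \sum_(i <- r | P i) peval (F i) x.
Proof. exact: (raddf_sum (meval _)). Qed.
Lemma pevalXn n (p : mpoly n R) k x : peval (p ^+ k) x = peval p x ^+ k.
Proof. exact: (rmorphXn (meval _)). Qed.

Lemma peval_mono n (m : multinom n) x :
  peval (mpolyX R m) x = \prod_i x 0 i ^+ m i.
Proof. exact: mevalX. Qed.

Lemma pevalE n (p : mpoly n R) x :
  peval p x = \sum_(m <- msupp p) mcoeff m p * \prod_i x 0 i ^+ m i.
Proof. exact: mevalE. Qed.

Lemma peval_comp n k (p : mpoly n R) (h : n.-tuple (mpoly k R)) x :
  peval (comp_mpoly h p) x = peval p (\row_i peval (tnth h i) x).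
Proof. by rewrite /peval comp_mpoly_meval; apply: meval_eq => i; rewrite mxE. Qed.

Lemma peval_is_derive n (p : mpoly n R) (x : 'rV[R]_n) (i : 'I_n) :
  is_derive x (delta_mx 0 i : 'rV[R]_n) (peval p : 'rV[R]_n -> R)
    (peval (mderiv i p) x).
Proof.
elim/mpoly_alg_ind: p => [c|j|p q IHp IHq|p q IHp IHq].
- rewrite mderivC -(mpolyC0 n) pevalC.
  have -> : (peval (mpolyC n c) : 'rV[R]_n -> R) = cst c.
    by apply/funext => y; rewrite pevalC.
  exact: is_derive_cst.
- have -> : (peval (Xv j) : 'rV[R]_n -> R) = (fun y => y 0 j).
    by apply/funext => y; rewrite pevalX.
  rewrite mderivX pevalZ mnm1E.
  have key : \forall t \near (0:R)^', t^-1 *: ((t *: delta_mx 0 i + x : 'rV[R]_n) 0 j - x 0 j)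
      = (j == i)%:R * peval (mpolyX R (mnm_sub (mnm1 j) (mnm1 i))) x.
    near=> t; rewrite !mxE eqxx /= addrK.
    case: (eqVneq j i) => [->|ij]; last by rewrite mulr0 scaler0 mul0r.
    rewrite mulr1 /GRing.scale /= mulVf; last by near: t; exact: nbhs_dnbhs_neq.
    rewrite mul1r.
    have -> : mnm_sub (mnm1 i) (mnm1 i) = mnm0 by apply/mnmP => k; rewrite mnmBE mnm0E subnn.
    by rewrite mpolyX0 -(mpolyC1 n) pevalC.
  apply: DeriveDef; first exact: is_cvg_near_cst key.
  exact: lim_near_cst key.
- rewrite mderivD pevalD.
  have -> : (peval (p + q) : 'rV[R]_n -> R) = peval p + peval q.
    by apply/funext => y; rewrite pevalD.
  exact: is_deriveD.
- rewrite mderivM pevalD !pevalM.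
  have -> : (peval (p * q) : 'rV[R]_n -> R) = peval p * peval q.
    by apply/funext => y; rewrite pevalM.
  apply: is_derive_eq.
  rewrite /GRing.scale /=; ring.
Unshelve. all: by end_near.
Qed.

Lemma peval_continuous n (p : mpoly n R) : continuous (peval p : 'rV[R]_n -> R).
Proof.
elim/mpoly_alg_ind: p => [c|j|p q IHp IHq|p q IHp IHq] x.
- have -> : (peval (mpolyC n c) : 'rV[R]_n -> R) = cst c.
    by apply/funext => y; rewrite pevalC.
  exact: cst_continuous.
- have -> : (peval (Xv j) : 'rV[R]_n -> R) = (fun y => y 0 j).
    by apply/funext => y; rewrite pevalX.
  exact: coord_continuous.
- have -> : (peval (p + q) : 'rV[R]_n -> R) = peval p + peval q.
    by apply/funext => y; rewrite pevalD.
  by apply: continuousD; [exact: IHp|exact: IHq].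
- have -> : (peval (p * q) : 'rV[R]_n -> R) = peval p * peval q.
    by apply/funext => y; rewrite pevalM.
  by apply: continuousM; [exact: IHp|exact: IHq].
Qed.

Lemma mcoeff0_mderivm n (p : mpoly n R) m :
  mcoeff mnm0 (mderivm m p) = mcoeff m p * (\prod_i (m i)`!)%:R.
Proof.
rewrite mcoeff_mderivm addm0 mulr_natr; congr (_ *+ _).
by apply: eq_bigr => i _; rewrite ffactnn.
Qed.

Lemma peval0 n (p : mpoly n R) : peval p 0 = mcoeff mnm0 p.
Proof.
rewrite pevalE.
have T0 m' : m' != mnm0 -> \prod_i (0 : 'rV[R]_n) 0 i ^+ m' i = 0 :> R.
  move=> m'0; have [i mi] : exists i, m' i != 0%N.
    apply/existsP; apply: contraNT m'0; rewrite negb_exists => /forallP h.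
    by apply/eqP/mnmP => i; rewrite mnm0E; have := h i; rewrite negbK => /eqP.
  by rewrite (bigD1 i) //= mxE expr0n (negbTE mi) mul0r.
have [h|h] := boolP (mnm0 \in msupp p).
  rewrite (bigD1_seq mnm0) ?msupp_uniq //= [X in _ + X]big1 ?addr0; last first.
    by move=> m' /T0->; rewrite mulr0.
  by rewrite big1 ?mulr1 // => i _; rewrite mnm0E expr0.
rewrite (memN_msupp_eq0 h) big_seq big1 // => m' m'p; rewrite T0 ?mulr0 //.
by apply: contraNneq h => <-.
Qed.

(** All derivatives vanish as well, and their values at 0 are the coefficients up to factorials,
    which are nonzero in [R]. *)
Lemma peval_eq0 n (p : mpoly n R) : (forall x, peval p x = 0) -> p = 0.
Proof.
move=> p0.
have d0 (q : mpoly n R) i : (forall x, peval q x = 0) ->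
    forall x, peval (mderiv i q) x = 0.
  move=> q0 x; have [_ <-] := peval_is_derive q x i.
  have -> : (peval q : 'rV[R]_n -> R) = cst 0 by apply/funext => y; exact: q0.
  exact: derive_cst.
have dm0 m x : peval (mderivm m p) x = 0.
  rewrite mderivm_foldr.
  elim: {m}(flatten _) x => [|i s IH] x /=; first exact: p0.
  by apply: d0.
apply/mpolyP => m; rewrite mcoeff0.
have /eqP := dm0 m 0; rewrite peval0.
rewrite mcoeff0_mderivm mulf_eq0 pnatr_eq0 => /orP[/eqP//|].
by rewrite -leqn0 leqNgt prodn_gt0 // => i; rewrite fact_gt0.
Qed.

Lemma peval_inj n (p q : mpoly n R) : (forall x, peval p x = peval q x) -> p = q.
Proof.
move=> pq; apply/eqP; rewrite -subr_eq0; apply/eqP/peval_eq0 => x.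
by rewrite pevalB pq subrr.
Qed.

Definition line_restr n (p : mpoly n R) (x v : 'rV[R]_n) : {poly R} :=
  mmap (polyC : R -> {poly R}) (fun i => (x 0 i)%:P + (v 0 i) *: 'X) p.

Lemma horner_line_restr n (p : mpoly n R) x v t :
  (line_restr p x v).[t] = peval p (x + t *: v).
Proof.
elim/mpoly_alg_ind: p => [c|j|p q IHp IHq|p q IHp IHq].
- by rewrite /line_restr mmapC hornerC pevalC.
- by rewrite /line_restr mmapX mmap1U pevalX !hornerE !mxE mulrC.
- by rewrite /line_restr mmapD hornerD IHp IHq pevalD.
- by rewrite /line_restr rmorphM hornerM IHp IHq pevalM.
Qed.

Lemma poly_eq0_near (q : {poly R}) e : 0 < e ->
  (forall t, 0 < t -> t <= e -> q.[t] = 0) -> q = 0.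
Proof.
move=> e0 q0; apply/eqP/negPn/negP => qN0.
(* A nonzero [q] has fewer than [size q] roots, so the [size q] distinct points [e / k.+1] are
   enough. *)
pose s := [seq e / k.+1%:R | k <- iota 0 (size q)].
have us : uniq s.
  rewrite map_inj_uniq ?iota_uniq // => i j /(mulfI (lt0r_neq0 e0))/invr_inj/eqP.
  by rewrite eqr_nat eqSS => /eqP.
have rs : all (root q) s.
  apply/allP => _ /mapP[k _ ->]; apply/rootP/q0; first by rewrite divr_gt0 ?ltr0Sn.
  by rewrite ler_pdivrMr ?ltr0Sn // ler_peMr ?ler1n // ltW.
by have := max_poly_roots qN0 rs us; rewrite size_map size_iota ltnn.
Qed.

(** The radius may depend on the direction: the restriction of [p] to each line through [x] has
    infinitely many zeros, hence vanishes on the whole line. *)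
Lemma peval_eq0_near n (p : mpoly n R) (x : 'rV[R]_n) :
  (forall v, exists2 e, 0 < e & forall t, 0 < t -> t <= e -> peval p (x + t *: v) = 0) ->
  p = 0.
Proof.
move=> h; apply: peval_eq0 => y; have [e e0 he] := h (y - x).
have : (line_restr p x (y - x)).[1] = 0.
  rewrite (@poly_eq0_near (line_restr p x (y - x)) e) ?horner0 // => t t0 te.
  by rewrite horner_line_restr he.
by rewrite horner_line_restr scale1r addrC subrK.
Qed.

End PolynomialFunctions.

(** * Linear changes of coordinates *)

Section LinearSubstitution.
Context {R : realType} {n : nat}.
Implicit Types (M N : 'M[R]_n) (p q : mpoly n R).

(** Pullback along [x |-> x *m M]. Row [i] of [M] is the image of the i-th coordinate vector, so a
    point is put on a coordinate axis by taking it as a row. *)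
Definition lsubst M p : mpoly n R :=
  comp_mpoly (mktuple (fun i => \sum_j M j i *: Xv j)) p.

Lemma peval_lsubst M p x : peval (lsubst M p) x = peval p (x *m M).
Proof.
rewrite peval_comp; congr peval; apply/rowP => i; rewrite !mxE tnth_mktuple peval_sum.
by apply: eq_bigr => j _; rewrite pevalZ pevalX mulrC.
Qed.

Lemma lsubst_comp M N p : lsubst M (lsubst N p) = lsubst (M *m N) p.
Proof. by apply: peval_inj => x; rewrite !peval_lsubst mulmxA. Qed.

Lemma lsubst1 p : lsubst 1%:M p = p.
Proof. by apply: peval_inj => x; rewrite peval_lsubst mulmx1. Qed.

Lemma lsubstK M p : M \in unitmx -> lsubst (invmx M) (lsubst M p) = p.
Proof. by move=> uM; rewrite lsubst_comp mulVmx // lsubst1. Qed.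

Lemma lsubstVK M p : M \in unitmx -> lsubst M (lsubst (invmx M) p) = p.
Proof. by move=> uM; rewrite lsubst_comp mulmxV // lsubst1. Qed.

Lemma lsubstD M p q : lsubst M (p + q) = lsubst M p + lsubst M q.
Proof. exact: comp_mpolyD. Qed.
Lemma lsubstM M p q : lsubst M (p * q) = lsubst M p * lsubst M q.
Proof. exact: rmorphM. Qed.
Lemma lsubstZ M c p : lsubst M (c *: p) = c *: lsubst M p.
Proof. exact: comp_mpolyZ. Qed.
Lemma lsubst0 M : lsubst M 0 = 0. Proof. exact: comp_mpoly0. Qed.
Lemma lsubstXn M p k : lsubst M (p ^+ k) = lsubst M p ^+ k.
Proof. exact: rmorphXn. Qed.
Lemma lsubst_sum M I (r : seq I) P (F : I -> mpoly n R) :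
  lsubst M (\sum_(i <- r | P i) F i) = \sum_(i <- r | P i) lsubst M (F i).
Proof. exact: raddf_sum. Qed.
Lemma lsubst_prod M I (r : seq I) P (F : I -> mpoly n R) :
  lsubst M (\prod_(i <- r | P i) F i) = \prod_(i <- r | P i) lsubst M (F i).
Proof. exact: rmorph_prod. Qed.
Lemma lsubstX M i : lsubst M (Xv i) = \sum_j M j i *: Xv j.
Proof.
by apply: peval_inj => x; rewrite peval_lsubst pevalX mxE peval_sum;
  apply: eq_bigr => j _; rewrite pevalZ pevalX mulrC.
Qed.

Definition hom d : qualifier 0 (mpoly n R) := ishomog1 d (@mdeg n).

Lemma homP d p : reflect (forall m, mcoeff m p != 0 -> mdeg m = d) (p \is hom d).
Proof.
apply: (iffP (dhomogP _ _ _)) => h m; first by rewrite -mcoeff_msupp => /h.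
by rewrite mcoeff_msupp => /h.
Qed.

Lemma hom_lsubst M d p : p \is hom d -> lsubst M p \is hom d.
Proof.
move=> hp; rewrite [p]mpolyE lsubst_sum big_seq; apply: rpred_sum => m mp.
rewrite lsubstZ; apply: dhomogZ.
have -> : d = (\sum_i m i)%N.
  by rewrite -mdegE; move/homP: hp => -> //; rewrite -mcoeff_msupp.
rewrite mpolyXE_id lsubst_prod.
elim/big_ind2: _ => [|a1 n1 a2 n2 h1 h2|i _].
- exact: dhomog1.
- exact: dhomogM.
rewrite lsubstXn lsubstX.
have /(dhomogMn (m i)) : (\sum_j M j i *: Xv j : mpoly n R) \is hom 1.
  by apply: rpred_sum => j _; apply: dhomogZ; rewrite dhomogX; apply/eqP/mdeg1.
by rewrite mul1n.
Qed.

Lemma pihomog_lsubst M d p :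
  pihomog (@mdeg n) d (lsubst M p) = lsubst M (pihomog (@mdeg n) d p).
Proof.
rewrite [p]mpolyE lsubst_sum !linear_sum /= lsubst_sum; apply: eq_bigr => m _.
rewrite lsubstZ !linearZ /= lsubstZ; congr (_ *: _); rewrite pihomogX.
have hX : lsubst M (mpolyX R m) \is hom (mdeg m) by apply: hom_lsubst; rewrite dhomogX.
case: eqP => [<-|/eqP md]; first by rewrite pihomog_dE.
by rewrite (pihomog_ne0 md hX) lsubst0.
Qed.

Lemma mcoeff_pihomog d p m :
  mcoeff m (pihomog (@mdeg n) d p) = if mdeg m == d then mcoeff m p else 0.
Proof.
rewrite pihomogE raddf_sum /=.
transitivity (\sum_(i <- msupp p | mdeg i == d) (i == m)%:R * mcoeff m p).
  apply: eq_bigr => i _; rewrite mcoeffZ mcoeffX; case: eqP => [->|_]; first by rewrite mulrC.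
  by rewrite mulr0 mul0r.
rewrite -mulr_suml.
have [mp|mp] := boolP (m \in msupp p); last first.
  by rewrite (memN_msupp_eq0 mp) mulr0 if_same.
rewrite big_mkcond (bigD1_seq m) ?msupp_uniq //= eqxx big1 ?addr0; last first.
  by move=> i /negbTE->; rewrite if_same.
by case: ifP; rewrite ?mul1r ?mul0r.
Qed.

Lemma peval_hom d p (t : R) x : p \is hom d -> peval p (t *: x) = t ^+ d * peval p x.
Proof.
move=> /dhomogP hp; rewrite !pevalE mulr_sumr big_seq [RHS]big_seq.
apply: eq_bigr => m /hp md0; rewrite mulrCA; congr (_ * _).
have md : mdeg m = d by exact: md0.
rewrite -[X in t ^+ X]md mdegE -prodrXr -big_split /=; apply: eq_bigr => i _.
by rewrite mxE exprMn.
Qed.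

End LinearSubstitution.

(** * Ideals that become monomial after a change of coordinates *)

Section WeightIdeals.
Context {R : realType}.
Local Notation S := (mpoly 3 R).
Implicit Types (p q : S) (I G : set S) (A : pred 'I_3) (M : 'M[R]_3).

Definition is_ideal I :=
  [/\ I 0, forall p q, I p -> I q -> I (p + q) & forall a p, I p -> I (a * p)].

Lemma is_ideal_sum I (T : Type) (s : seq T) (P : pred T) (F : T -> S) :
  is_ideal I -> (forall i, P i -> I (F i)) -> I (\sum_(i <- s | P i) F i).
Proof. by move=> [I0 ID _] IF; elim/big_ind: _. Qed.

Lemma is_ideal_seq_sum I (T : eqType) (s : seq T) (F : T -> S) :
  is_ideal I -> (forall i, i \in s -> I (F i)) -> I (\sum_(i <- s) F i).
Proof. by move=> [I0 ID _] IF; rewrite big_seq; elim/big_ind: _. Qed.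

Lemma is_idealZ I c p : is_ideal I -> I p -> I (c *: p).
Proof. by move=> [_ _ IM] Ip; rewrite -mul_mpolyC; exact: IM. Qed.

Lemma ideal_gen_ideal G : is_ideal (ideal_gen G).
Proof.
split.
- by exists 0%N, (fun=> 0), (fun=> 0); split; [case|rewrite big_ord0].
- move=> p q [k [a [g [Gg ->]]]] [l [b [h [Gh ->]]]].
  exists (k + l)%N, (fun i => match fintype.split i with inl j => a j | inr j => b j end),
    (fun i => match fintype.split i with inl j => g j | inr j => h j end); split.
    by move=> i; case: fintype.split.
  rewrite big_split_ord /=; congr (_ + _); apply: eq_bigr => i _.
    by rewrite (unsplitK (inl i)).
  by rewrite (unsplitK (inr i)).
- move=> c p [k [a [g [Gg ->]]]]; exists k, (fun i => c * a i), g; split=> //.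
  by rewrite mulr_sumr; apply: eq_bigr => i _; rewrite mulrA.
Qed.

Lemma ideal_gen_min G I p :
  is_ideal I -> (forall q, G q -> I q) -> ideal_gen G p -> I p.
Proof.
move=> idI GI [k [a [g [Gg ->]]]]; have [_ _ IM] := idI.
by apply: is_ideal_sum => // i _; apply/IM/GI.
Qed.

Lemma ideal_gen_mem G p : G p -> ideal_gen G p.
Proof.
by move=> Gp; exists 1%N, (fun=> 1), (fun=> p); split; rewrite ?big_ord1 ?mul1r.
Qed.

Lemma ideal_powS I k p q : I p -> ideal_pow I k q -> ideal_pow I k.+1 (p * q).
Proof.
move=> Ip [l [a [g [Gg ->]]]]; rewrite mulr_sumr.
have [I0 ID IM] := ideal_gen_ideal [set p | exists g : 'I_k.+1 -> S,
    (forall i, I (g i)) /\ p = \prod_i g i].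
apply: is_ideal_sum => // i _; rewrite mulrCA; apply/IM/ideal_gen_mem.
have [h [Ih ->]] := Gg i.
exists (fun j => oapp h p (unlift ord0 j)); split.
  by move=> j; case: unliftP => /=.
rewrite big_ord_recl unlift_none; congr (_ * _); apply: eq_bigr => j _.
by rewrite liftK.
Qed.

Lemma ideal_pow0 I p : ideal_pow I 0 p.
Proof.
have [_ _ IM] := ideal_gen_ideal [set p | exists g : 'I_0 -> S,
    (forall i, I (g i)) /\ p = \prod_i g i].
rewrite -[p]mulr1; apply: IM; apply: ideal_gen_mem; exists (fun=> 0); split; first by case.
by rewrite big_ord0.
Qed.

Definition wt A (m : multinom 3) := (\sum_(i | A i) m i)%N.

(** Membership in the [k]-th power of the ideal generated by the variables in [A], read off the
    exponents. *)
Definition in_wt A k : set S := [set p | forall m, mcoeff m p != 0 -> (k <= wt A m)%N].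

Lemma wtD A m1 m2 : wt A (mnm_add m1 m2) = (wt A m1 + wt A m2)%N.
Proof. by rewrite /wt -big_split; apply: eq_bigr => i _; rewrite mnmDE. Qed.

Lemma wt1 A i : wt A (mnm1 i) = A i :> nat.
Proof.
rewrite /wt; case Ai: (A i).
  by rewrite (bigD1 i) //= mnm1E eqxx big1 // => j /andP[_ /negbTE]; rewrite mnm1E eq_sym => ->.
by rewrite big1 // => j Aj; rewrite mnm1E; case: eqP => // ij; rewrite ij Aj in Ai.
Qed.

Lemma in_wtM A k l p q : in_wt A k p -> in_wt A l q -> in_wt A (k + l) (p * q).
Proof.
move=> hp hq m; rewrite -mcoeff_msupp => /msuppM_le /allpairsP[[m1 m2] /= [h1 h2 ->]].
rewrite wtD leq_add //; [apply: hp|apply: hq]; by rewrite -mcoeff_msupp.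
Qed.

Lemma in_wt_ideal A k : is_ideal (in_wt A k).
Proof.
split=> [m|p q hp hq m|a p hp]; first by rewrite mcoeff0 eqxx.
  rewrite mcoeffD; have [p0|/hp//] := eqVneq (mcoeff m p) 0.
  by rewrite p0 add0r; exact: hq.
by rewrite -[k]add0n; apply: in_wtM.
Qed.

Lemma in_wt_prod A k (h : 'I_k -> S) :
  (forall i, in_wt A 1 (h i)) -> in_wt A k (\prod_i h i).
Proof.
elim: k h => [|k IH] h hh; first by [].
by rewrite big_ord_recl; apply: (@in_wtM A 1 k) => //; exact: IH.
Qed.

Lemma mnm_split (m : multinom 3) i : (0 < m i)%N ->
  m = mnm_add (mnm1 i) (mnm_sub m (mnm1 i)).
Proof.
move=> mi; rewrite addmC submK //; apply/mnm_lepP => j; rewrite mnm1E.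
by case: eqP => // <-.
Qed.

Lemma wt_gt0 A m : (0 < wt A m)%N -> exists2 i, A i & (0 < m i)%N.
Proof.
rewrite lt0n /wt sum_nat_eq0 => /forallPn[i]; rewrite negb_imply => /andP[Ai mi].
by exists i => //; rewrite lt0n.
Qed.

Lemma mono_decomp I A k m : (forall i, A i -> I (Xv i)) -> (k <= wt A m)%N ->
  ideal_pow I k (mpolyX R m).
Proof.
move=> IX; elim: k m => [|k IH] m km; first exact: ideal_pow0.
have [i Ai mi] := wt_gt0 (leq_ltn_trans (leq0n _) km).
rewrite (mnm_split mi) mpolyXD; apply: ideal_powS; first exact: IX.
by apply: IH; move: km; rewrite {1}(mnm_split mi) wtD wt1 Ai add1n.
Qed.

Definition mpart (B : pred (multinom 3)) p : S :=
  \sum_(m <- msupp p | B m) mcoeff m p *: mpolyX R m.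

Lemma mcoeff_mpart B p m : mcoeff m (mpart B p) = if B m then mcoeff m p else 0.
Proof.
rewrite /mpart raddf_sum /=.
transitivity (\sum_(i <- msupp p | B i) (i == m)%:R * mcoeff m p).
  apply: eq_bigr => i _; rewrite mcoeffZ mcoeffX; case: eqP => [->|_]; first by rewrite mulrC.
  by rewrite mulr0 mul0r.
rewrite -mulr_suml.
have [mp|mp] := boolP (m \in msupp p); last first.
  by rewrite (memN_msupp_eq0 mp) mulr0 if_same.
rewrite big_mkcond (bigD1_seq m) ?msupp_uniq //= eqxx big1 ?addr0; last first.
  by move=> i /negbTE->; rewrite if_same.
by case: ifP; rewrite ?mul1r ?mul0r.
Qed.

Lemma delta_lsubst M i0 t : (t *: delta_mx 0 i0 : 'rV[R]_3) *m M = t *: row i0 M.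
Proof. by rewrite -scalemxAl -rowE. Qed.

Lemma mono_axis i0 (t : R) m : (0 < wt (predC1 i0) m)%N ->
  \prod_i (t *: delta_mx 0 i0 : 'rV[R]_3) 0 i ^+ m i = 0.
Proof.
move=> /wt_gt0[i /= ii0 mi]; rewrite (bigD1 i) //= !mxE (negbTE ii0) andbF mulr0.
by rewrite expr0n eqn0Ngt mi mul0r.
Qed.

(** The matrix puts the line of [x] on the axis [i0]; a polynomial vanishes there exactly when, in
    the new coordinates, it contains no pure power of that variable, the constant included. *)
Lemma vertex_idealP M i0 (x : 'rV[R]_2) p : row i0 M = embed x ->
  vertex_ideal x p <-> in_wt (predC1 i0) 1 (lsubst M p).
Proof.
move=> Mx; set q := lsubst M p.
have qE t : peval p (t *: embed x) = peval q (t *: delta_mx 0 i0).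
  by rewrite peval_lsubst delta_lsubst Mx.
split=> [px|qw t]; last first.
  rewrite qE pevalE big_seq big1 // => m; rewrite mcoeff_msupp => /qw m1.
  by rewrite mono_axis ?mulr0.
(* The monomials of weight 0 are powers of the variable [i0], so this part of [q] at [y] equals [q]
   at the projection of [y] to the axis. *)
have q0 : mpart (fun m => wt (predC1 i0) m == 0%N) q = 0.
  apply: peval_eq0 => y; rewrite -[RHS](px (y 0 i0)) qE [RHS]pevalE /mpart peval_sum.
  rewrite [in LHS]big_mkcond; apply: eq_bigr => m _; case: eqP => m0.
    rewrite pevalZ peval_mono; congr (_ * _); apply: eq_bigr => i _; rewrite !mxE /=.
    have [->|ii0] := eqVneq i i0; first by rewrite mulr1.
    have -> : m i = 0%N.
      by move/eqP: m0; rewrite sum_nat_eq0 => /forallP/(_ i); rewrite /= ii0 => /eqP.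
    by rewrite !expr0.
  by rewrite mono_axis ?mulr0 // lt0n; apply/eqP.
move=> m; apply: contraNT; rewrite -ltnNge ltnS leqn0 => m0.
by have := mcoeff_mpart (fun m => wt (predC1 i0) m == 0%N) q m; rewrite q0 m0 mcoeff0 => <-.
Qed.

Lemma ideal_lsubst M I : is_ideal I -> is_ideal [set p | I (lsubst M p)].
Proof.
move=> [I0 ID IM]; split=> [|p q Ip Iq|a p Ip] /=; first by rewrite lsubst0.
  by rewrite lsubstD; exact: ID.
by rewrite lsubstM; exact: IM.
Qed.

Lemma mono_expand I M p : M \in unitmx -> is_ideal I ->
  (forall m, mcoeff m (lsubst M p) != 0 -> I (lsubst (invmx M) (mpolyX R m))) -> I p.
Proof.
move=> uM idI h; rewrite -(lsubstK p uM) [lsubst M p]mpolyE lsubst_sum.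
apply: is_ideal_seq_sum => // m mp; rewrite lsubstZ; apply: is_idealZ => //.
by apply: h; rewrite -mcoeff_msupp.
Qed.

(** Both inclusions are tested on generators: products of elements of weight 1 in one direction,
    monomials in the other. Intersections of such ideals thereby become conjunctions of
    inequalities. *)
Lemma ideal_pow_vertexP M i0 (x : 'rV[R]_2) k p : M \in unitmx -> row i0 M = embed x ->
  ideal_pow (vertex_ideal x) k p <-> in_wt (predC1 i0) k (lsubst M p).
Proof.
move=> uM Mx; split.
  apply: (@ideal_gen_min _ [set p | in_wt (predC1 i0) k (lsubst M p)]).
    by apply: ideal_lsubst; exact: in_wt_ideal.
  move=> _ [g [gx ->]] /=; rewrite lsubst_prod; apply: in_wt_prod => i.
  exact/(vertex_idealP _ Mx).
move=> pw; apply: (mono_expand uM); first exact: ideal_gen_ideal.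
move=> m /pw km.
have := @mono_decomp [set q | vertex_ideal x (lsubst (invmx M) q)] (predC1 i0) k m _ km.
have XI i : predC1 i0 i -> vertex_ideal x (lsubst (invmx M) (Xv i)).
  move=> ii0; apply/(vertex_idealP _ Mx); rewrite lsubstVK // => m'.
  rewrite mcoeffX; case: (eqVneq (mnm1 i) m') => [<- _|_]; last by rewrite eqxx.
  by rewrite wt1 ii0.
move=> /(_ XI); apply: (@ideal_gen_min _ [set q | ideal_pow (vertex_ideal x) k (lsubst (invmx M) q)]).
  by apply: ideal_lsubst; exact: ideal_gen_ideal.
move=> _ [g [gx ->]] /=; rewrite lsubst_prod; apply: ideal_gen_mem.
by exists (fun i => lsubst (invmx M) (g i)).
Qed.

Lemma principalP M i0 l c k p : M \in unitmx -> c != 0 -> lsubst M l = c *: Xv i0 ->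
  ideal_gen [set l ^+ k] p <-> in_wt (pred1 i0) k (lsubst M p).
Proof.
move=> uM c0 Ml; split.
  apply: (@ideal_gen_min _ [set p | in_wt (pred1 i0) k (lsubst M p)]).
    by apply: ideal_lsubst; exact: in_wt_ideal.
  move=> _ -> /=; rewrite lsubstXn Ml.
  have -> : (c *: Xv i0 : S) ^+ k = \prod_(i < k) (c *: Xv i0) by rewrite prodr_const card_ord.
  apply: in_wt_prod => _; apply: (@is_idealZ (in_wt (pred1 i0) 1)); first exact: in_wt_ideal.
  move=> m; rewrite mcoeffX; case: (eqVneq (mnm1 i0) m) => [<- _|_]; last by rewrite eqxx.
  by rewrite wt1 /= eqxx.
move=> pw; apply: (mono_expand uM); first exact: ideal_gen_ideal.
move=> m /pw km.
have := @mono_decomp [set Xv i0] (pred1 i0) k m _ km.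
have XI i : pred1 i0 i -> [set Xv i0 : S] (Xv i) by move=> /eqP->.
move=> /(_ XI); apply: (@ideal_gen_min _ [set q | ideal_gen [set l ^+ k] (lsubst (invmx M) q)]).
  by apply: ideal_lsubst; exact: ideal_gen_ideal.
move=> _ [g [gx ->]] /=.
have -> : \prod_i g i = (Xv i0 : S) ^+ k.
  by rewrite (eq_bigr (fun=> Xv i0)) ?prodr_const ?card_ord // => i _; exact: gx.
have -> : Xv i0 = c^-1 *: lsubst M l by rewrite Ml scalerA mulVf // scale1r.
rewrite exprZn lsubstZ -lsubstXn lsubstK //; apply: (@is_idealZ (ideal_gen _)); first exact: ideal_gen_ideal.
exact: ideal_gen_mem.
Qed.

End WeightIdeals.

(** * The plane z = 1 and linear forms on space *)

Section Coordinates.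
Context {R : realType}.
Local Notation S := (mpoly 3 R).
Local Notation point := 'rV[R]_2.

Definition o0 : 'I_3 := @Ordinal 3 0 isT.
Definition o1 : 'I_3 := @Ordinal 3 1 isT.
Definition o2 : 'I_3 := @Ordinal 3 2 isT.
Definition i0 : 'I_2 := @Ordinal 2 0 isT.
Definition i1 : 'I_2 := @Ordinal 2 1 isT.

Lemma ord3P (P : 'I_3 -> Prop) : P o0 -> P o1 -> P o2 -> forall i, P i.
Proof.
move=> P0 P1 P2 [[|[|[|//]]] h].
- by rewrite (_ : Ordinal h = o0) //; apply: val_inj.
- by rewrite (_ : Ordinal h = o1) //; apply: val_inj.
- by rewrite (_ : Ordinal h = o2) //; apply: val_inj.
Qed.

Lemma ord2P (P : 'I_2 -> Prop) : P i0 -> P i1 -> forall i, P i.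
Proof.
move=> P0 P1 [[|[|//]] h].
- by rewrite (_ : Ordinal h = i0) //; apply: val_inj.
- by rewrite (_ : Ordinal h = i1) //; apply: val_inj.
Qed.

Lemma big3 (T : Type) (x : T) (op : Monoid.law x) (F : 'I_3 -> T) :
  \big[op/x]_i F i = op (op (F o0) (F o1)) (F o2).
Proof.
rewrite !big_ord_recr big_ord0 /= Monoid.mul1m.
by congr (op (op (F _) (F _)) (F _)); apply: val_inj.
Qed.

Lemma big2 (T : Type) (x : T) (op : Monoid.law x) (F : 'I_2 -> T) :
  \big[op/x]_i F i = op (F i0) (F i1).
Proof.
rewrite !big_ord_recr big_ord0 /= Monoid.mul1m.
by congr (op (F _) (F _)); apply: val_inj.
Qed.

Lemma rvD n (u v : 'rV[R]_n) i : (u + v) 0 i = u 0 i + v 0 i. Proof. by rewrite mxE. Qed.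
Lemma rvN n (u : 'rV[R]_n) i : (- u) 0 i = - u 0 i. Proof. by rewrite mxE. Qed.
Lemma rvZ n c (u : 'rV[R]_n) i : (c *: u) 0 i = c * u 0 i. Proof. by rewrite mxE. Qed.
Lemma rv0 n i : (0 : 'rV[R]_n) 0 i = 0. Proof. by rewrite mxE. Qed.
Definition rvE := (rvD, rvN, rvZ, rv0).

Lemma embed_o0 (x : point) : embed x 0 o0 = x 0 i0.
Proof.
rewrite /embed; have -> : o0 = lshift 1 i0 by apply: val_inj.
exact: (row_mxEl x (const_mx 1 : 'rV[R]_1) 0 i0).
Qed.
Lemma embed_o1 (x : point) : embed x 0 o1 = x 0 i1.
Proof.
rewrite /embed; have -> : o1 = lshift 1 i1 by apply: val_inj.
exact: (row_mxEl x (const_mx 1 : 'rV[R]_1) 0 i1).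
Qed.
Lemma embed_o2 (x : point) : embed x 0 o2 = 1.
Proof.
rewrite /embed; have -> : o2 = rshift 2 (ord0 : 'I_1) by apply: val_inj.
by rewrite [LHS](row_mxEr x (const_mx 1 : 'rV[R]_1) 0 ord0) mxE.
Qed.

Definition embedE := (embed_o0, embed_o1, embed_o2).

Lemma row3P (u v : 'rV[R]_3) : u 0 o0 = v 0 o0 -> u 0 o1 = v 0 o1 -> u 0 o2 = v 0 o2 -> u = v.
Proof. by move=> h0 h1 h2; apply/rowP; apply: ord3P. Qed.

Lemma row2P (u v : 'rV[R]_2) : u 0 i0 = v 0 i0 -> u 0 i1 = v 0 i1 -> u = v.
Proof. by move=> h0 h1; apply/rowP; apply: ord2P. Qed.

Definition rows3 (u v w : 'rV[R]_3) : 'M[R]_3 :=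
  \matrix_(i, j) (if i == o0 then u else if i == o1 then v else w) 0 j.

Lemma row_rows3 u v w :
  [/\ row o0 (rows3 u v w) = u, row o1 (rows3 u v w) = v & row o2 (rows3 u v w) = w].
Proof. by split; apply/rowP => j; rewrite !mxE. Qed.

Lemma mul_rows3 x u v w :
  x *m rows3 u v w = x 0 o0 *: u + x 0 o1 *: v + x 0 o2 *: w.
Proof.
have [h0 h1 h2] := row_rows3 u v w.
by rewrite mulmx_sum_row big3 /= h0 h1 h2.
Qed.

Lemma rows3_unit u v w :
  (forall x y z, x *: u + y *: v + z *: w = 0 -> [/\ x = 0, y = 0 & z = 0]) ->
  rows3 u v w \in unitmx.
Proof.
move=> h; rewrite -row_free_unit; apply: inj_row_free => x.
by rewrite mul_rows3 => /h[x0 x1 x2]; apply: row3P; rewrite mxE.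
Qed.

Lemma wt_pred1 (m : multinom 3) : wt (pred1 o0) m = m o0.
Proof. by rewrite /wt big_pred1_eq. Qed.
Lemma wt_predC2 (m : multinom 3) : wt (predC1 o2) m = (m o0 + m o1)%N.
Proof. by rewrite /wt big_mkcond big3 /= addn0. Qed.
Lemma wt_predC1 (m : multinom 3) : wt (predC1 o1) m = (m o0 + m o2)%N.
Proof. by rewrite /wt big_mkcond big3 /= addn0. Qed.
Lemma mdeg3 (m : multinom 3) : mdeg m = (m o0 + m o1 + m o2)%N.
Proof. by rewrite mdegE big3. Qed.
Lemma mdeg2 (m : multinom 2) : mdeg m = (m i0 + m i1)%N.
Proof. by rewrite mdegE big2. Qed.

Lemma lin_formE (l : S) : l \is hom 1 -> l = \sum_i mcoeff (mnm1 i) l *: Xv i.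
Proof.
move=> /homP hl; apply/mpolyP => m; rewrite raddf_sum /=.
have [mp|m1] := eqVneq (mdeg m) 1%N; last first.
  have -> : mcoeff m l = 0 by apply/eqP; apply: contraNT m1 => /hl ->.
  rewrite big1 // => i _; rewrite mcoeffZ mcoeffX; case: eqP => [mi|_]; last by rewrite mulr0.
  by rewrite -mi mdeg1 in m1.
have /mdeg1P[i /eqP->] : mdeg m == 1%N by apply/eqP.
rewrite (bigD1 i) //= big1 ?addr0 => [|j ji]; rewrite mcoeffZ mcoeffX ?eqxx ?mulr1 //.
by rewrite eq_mnm1 (negbTE ji) mulr0.
Qed.

Lemma peval_lin (l : S) x : l \is hom 1 -> peval l x = \sum_i mcoeff (mnm1 i) l * x 0 i.
Proof.
move=> /lin_formE {1}->; rewrite peval_sum; apply: eq_bigr => i _.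
by rewrite pevalZ pevalX.
Qed.

Lemma peval_linD (l : S) x y : l \is hom 1 -> peval l (x + y) = peval l x + peval l y.
Proof.
move=> hl; rewrite !peval_lin // -big_split; apply: eq_bigr => i _.
by rewrite mxE mulrDr.
Qed.

Lemma peval_linZ (l : S) c x : l \is hom 1 -> peval l (c *: x) = c * peval l x.
Proof. by move=> hl; rewrite (peval_hom _ _ hl) expr1. Qed.

End Coordinates.

(** * The ideal of an edge in adapted coordinates *)

Section EdgeIdeal.
Context {R : realType}.
Local Notation S := (mpoly 3 R).
Local Notation point := 'rV[R]_2.
Context (r : {fset point} -> nat) (s : point -> nat) (ell : {fset point} -> S).
Context (a b : point) (ab : a != b).
Local Notation tau := [fset a; b]%fset.
Local Notation l := (ell tau).
Hypotheses (l0 : l != 0) (l1 : l \is hom 1).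
Hypotheses (la : peval l (embed a) = 0) (lb : peval l (embed b) = 0).

Lemma exists_transversal : exists v, peval l v != 0.
Proof.
apply: contrapT => h; move/eqP: l0; apply; apply: peval_eq0 => x.
by apply/eqP; apply: contrapT => /negP hx; apply: h; exists x.
Qed.

Lemma embed_indep (x y : R) : x *: embed b + y *: embed a = 0 -> x = 0 /\ y = 0.
Proof.
move=> h; have h0 := congr1 (fun u : 'rV[R]_3 => u 0 o0) h.
have h1 := congr1 (fun u : 'rV[R]_3 => u 0 o1) h.
have h2 := congr1 (fun u : 'rV[R]_3 => u 0 o2) h.
rewrite /= !rvE !embedE in h0 h1 h2.
have yx : y = - x by lra.
suff x0 : x = 0 by rewrite yx x0 oppr0.
apply/eqP; apply: contraNT ab => x0; apply/eqP/row2P; apply/(mulfI x0).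
  by move: h0; rewrite yx => h0; lra.
by move: h1; rewrite yx => h1; lra.
Qed.

Lemma adapted_unit v : peval l v != 0 -> rows3 v (embed b) (embed a) \in unitmx.
Proof.
move=> lv; apply: rows3_unit => x y z h.
have : peval l (x *: v + y *: embed b + z *: embed a) = 0.
  by rewrite h peval_lin // big1 // => i _; rewrite mxE mulr0.
rewrite !peval_linD // !peval_linZ // la lb !mulr0 !addr0 => /eqP.
rewrite mulf_eq0 (negbTE lv) orbF => /eqP x0; move: h.
by rewrite x0 scale0r add0r => /embed_indep[-> ->].
Qed.

Lemma lsubst_adapted v : lsubst (rows3 v (embed b) (embed a)) l = peval l v *: Xv o0.
Proof.
apply: peval_inj => x; rewrite peval_lsubst mul_rows3 pevalZ pevalX.
by rewrite !peval_linD // !peval_linZ // la lb !mulr0 !addr0 mulrC.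
Qed.

(** In the coordinates with rows [v], [embed b], [embed a], the form of the edge is a multiple of
    the first variable, the line over [a] is the third axis and that over [b] the second; hence the
    pairs of exponents. *)
Definition good_mono (m : multinom 3) :=
  [&& r tau < m o0, s a < m o0 + m o1 & s b < m o0 + m o2]%N.

Lemma J_edgeP v p : peval l v != 0 ->
  J_edge r s ell tau p <->
  (forall m, mcoeff m (lsubst (rows3 v (embed b) (embed a)) p) != 0 -> good_mono m).
Proof.
move=> lv; have uM := adapted_unit lv; have [_ M1 M2] := row_rows3 v (embed b) (embed a).
have PP := principalP (r tau).+1 p uM lv (lsubst_adapted v).
have Pa := ideal_pow_vertexP (s a).+1 p uM M2.
have Pb := ideal_pow_vertexP (s b).+1 p uM M1.
split.
  move=> [/PP hr hs] m mp; apply/and3P; split.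
  - by rewrite -wt_pred1; exact: hr.
  - by rewrite -wt_predC2; apply: (iffLR Pa) => //; apply: hs; rewrite /= !inE eqxx.
  - by rewrite -wt_predC1; apply: (iffLR Pb) => //; apply: hs; rewrite /= !inE eqxx orbT.
move=> h; split.
  by apply/PP => m /h/and3P[]; rewrite wt_pred1.
move=> x /=; rewrite !inE => /orP[] /eqP->.
  by apply/Pa => m /h/and3P[]; rewrite wt_predC2.
by apply/Pb => m /h/and3P[]; rewrite wt_predC1.
Qed.

Lemma J_edge_ideal : is_ideal (J_edge r s ell tau).
Proof.
have [l_0 lD lM] := ideal_gen_ideal [set l ^+ (r tau).+1].
have idp x : is_ideal (ideal_pow (vertex_ideal x : set S) (s x).+1) := ideal_gen_ideal _.
split=> [|p q [p1 p2] [q1 q2]|c p [p1 p2]].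
- by split=> [|x _]; [exact: l_0|have [? _ _] := idp x].
- split=> [|x xt]; first exact: lD.
  by have [_ h _] := idp x; apply: h; [exact: p2|exact: q2].
- split=> [|x xt]; first exact: lM.
  by have [_ _ h] := idp x; apply: h; exact: p2.
Qed.

Lemma J_edge_pihomog d p : J_edge r s ell tau p -> J_edge r s ell tau (pihomog (@mdeg 3) d p).
Proof.
have [v lv] := exists_transversal.
move=> /(J_edgeP p lv) h; apply/(J_edgeP _ lv) => m.
by rewrite -pihomog_lsubst mcoeff_pihomog; case: ifP => _; rewrite ?eqxx //; exact: h.
Qed.

Lemma J_edge_exp k : (r tau < k)%N -> (s a < k)%N -> (s b < k)%N ->
  J_edge r s ell tau (l ^+ k).
Proof.
have [v lv] := exists_transversal.
move=> rk ak bk; apply/(J_edgeP _ lv) => m.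
rewrite lsubstXn lsubst_adapted exprZn mcoeffZ mpolyXn mcoeffX.
case: (eqVneq (mnm_muln (mnm1 o0) k) m) => [<- _|_]; last by rewrite mulr0 eqxx.
by rewrite /good_mono !mulmnE !mnm1E /= mul1n !mul0n !addn0 rk ak bk.
Qed.

(** The three forms are the coordinate functions of the adapted basis. A monomial of the ideal of
    large degree has a large exponent, and the [D]-th power of that variable splits off without
    leaving the ideal. *)
Lemma J_edge_fg : exists L : 'I_3 -> S, (forall i, L i \is hom 1) /\
  forall D, exists d0, forall d p, (d0 <= d)%N -> J_edge r s ell tau p -> p \is hom d ->
    exists2 q : 'I_3 -> S, forall i, J_edge r s ell tau (q i) & p = \sum_i L i ^+ D * q i.
Proof.
have [v lv] := exists_transversal; have uM := adapted_unit lv.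
set M := rows3 _ _ _ in uM.
exists (fun i => lsubst (invmx M) (Xv i)); split.
  by move=> i; apply: hom_lsubst; rewrite dhomogX; apply/eqP/mdeg1.
(* The sum of three thresholds [r tau + s a + s b + 3 + D], [s a + 1 + D] and [s b + 1 + D], one for
   each exponent, so that some exponent reaches its own. *)
move=> D; exists (r tau + 2 * s a + 2 * s b + 5 + 3 * D)%N => d p dd Jp hp.
pose E := [set p | exists2 q : 'I_3 -> S, forall i, J_edge r s ell tau (q i) &
  p = \sum_i lsubst (invmx M) (Xv i) ^+ D * q i].
have [J0 JD JM] := J_edge_ideal.
have idE : is_ideal E.
  split.
  - by exists (fun=> 0) => //; rewrite big1 // => i _; rewrite mulr0.
  - move=> _ _ [q1 h1 ->] [q2 h2 ->]; exists (fun i => q1 i + q2 i) => [i|]; first exact: JD.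
    by rewrite -big_split; apply: eq_bigr => i _; rewrite mulrDr.
  - move=> c _ [q hq ->]; exists (fun i => c * q i) => [i|]; first exact: JM.
    by rewrite mulr_sumr; apply: eq_bigr => i _; rewrite mulrCA.
apply: (mono_expand uM idE) => m mp.
have gm := iffLR (J_edgeP p lv) Jp m mp.
have md : mdeg m = d by move/(hom_lsubst M)/homP: hp; apply.
have mono_J m' : good_mono m' -> J_edge r s ell tau (lsubst (invmx M) (mpolyX R m')).
  move=> gm'; apply/(J_edgeP _ lv) => m''; rewrite lsubstVK // mcoeffX.
  by case: (eqVneq m' m'') => [<-//|_]; rewrite eqxx.
suff [i iD gi] : exists2 i, (D <= m i)%N & good_mono (mnm_sub m (mnm_muln (mnm1 i) D)).
  exists (fun j => if j == i then
      lsubst (invmx M) (mpolyX R (mnm_sub m (mnm_muln (mnm1 i) D))) else 0).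
    by move=> j; case: eqP => // _; exact: mono_J.
  rewrite (bigD1 i) //= eqxx big1 ?addr0; last by move=> j /negbTE->; rewrite mulr0.
  rewrite -lsubstXn mpolyXn -lsubstM -mpolyXD addmC submK //.
  apply/mnm_lepP => j; rewrite mulmnE mnm1E.
  by case: eqP => [<-|_]; rewrite ?mul1n ?mul0n.
move: gm md; rewrite mdeg3 => /and3P[g0 g1 g2] md.
(* A large first exponent meets all three inequalities alone. The second and third exponents each
   enter just one of them, which a large value guarantees even after division by the [D]-th
   power. *)
have [h0|h0] := leqP (r tau + s a + s b + 3 + D) (m o0).
  exists o0; first by lia.
  rewrite /good_mono !mnmBE !mulmnE !mnm1E /= ?mul0n ?mul1n ?subn0; lia.
have [h1|h1] := leqP (s a + 1 + D) (m o1).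
  exists o1; first by lia.
  rewrite /good_mono !mnmBE !mulmnE !mnm1E /= ?mul0n ?mul1n ?subn0; lia.
exists o2; first by lia.
rewrite /good_mono !mnmBE !mulmnE !mnm1E /= ?mul0n ?mul1n ?subn0; lia.
Qed.

End EdgeIdeal.

(** * Homogenization and Taylor coefficients *)

Section Homogenization.
Context {R : realType}.
Local Notation S := (mpoly 3 R).
Local Notation point := 'rV[R]_2.

Definition dehom (p : S) : mpoly 2 R :=
  comp_mpoly (mktuple (fun i : 'I_3 => if i == o0 then Xv i0 else if i == o1 then Xv i1 else 1)) p.

Lemma peval_dehom p x : peval (dehom p) x = peval p (embed x).
Proof.
rewrite peval_comp; congr peval; apply: row3P; rewrite mxE tnth_mktuple /= embedE ?pevalX //.
by rewrite -(mpolyC1 2) pevalC.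
Qed.

(** The subtraction is truncated: the result has degree [d] only when [mdeg m <= d]. *)
Definition mnm_hom d (m : multinom 2) : multinom 3 :=
  Multinom (mktuple (fun i : 'I_3 => if i == o0 then m i0 else if i == o1 then m i1 else d - mdeg m)%N).

Lemma mnm_homE d m :
  [/\ mnm_hom d m o0 = m i0, mnm_hom d m o1 = m i1 & mnm_hom d m o2 = d - mdeg m]%N.
Proof. by split; rewrite /mnm_hom multinomE tnth_mktuple. Qed.

Definition homogenize d (P : mpoly 2 R) : S :=
  \sum_(m <- msupp P) mcoeff m P *: mpolyX R (mnm_hom d m).

Lemma homogenizeK d P : dehom (homogenize d P) = P.
Proof.
apply: peval_inj => x; rewrite peval_dehom /homogenize peval_sum pevalE.
apply: eq_bigr => m _; rewrite pevalZ peval_mono big3 big2 /= !embedE.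
by have [-> -> ->] := mnm_homE d m; rewrite expr1n mulr1.
Qed.

Lemma mdeg_mnm_hom d m : (mdeg m <= d)%N -> mdeg (mnm_hom d m) = d.
Proof. by move=> md; rewrite mdeg3; have [-> -> ->] := mnm_homE d m; rewrite -mdeg2 subnKC. Qed.

Lemma homogenize_hom d P : (msize P <= d.+1)%N -> homogenize d P \is hom d.
Proof.
move=> Pd; rewrite /homogenize big_seq; apply: rpred_sum => m mP.
apply: dhomogZ; rewrite dhomogX; apply/eqP/mdeg_mnm_hom.
by rewrite -ltnS; apply: leq_trans Pd; exact: msize_mdeg_lt.
Qed.

Lemma msize_dehom d p : p \is hom d -> (msize (dehom p) <= d.+1)%N.
Proof.
move=> /homP hp; rewrite [p]mpolyE /dehom raddf_sum /= big_seq.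
apply: (leq_trans (mmeasure_sum _ _ _ _)); apply/bigmax_leqP_seq => m mp _.
rewrite comp_mpolyZ; apply: (leq_trans (mmeasureZ_le _ _ _)).
rewrite comp_mpolyX big3 !tnth_mktuple /= expr1n mulr1 !mpolyXn -mpolyXD mmeasureX /=.
rewrite ltnS mdegD !mdegMn !mdeg1 !mul1n -(hp m) -?mcoeff_msupp // mdeg3.
exact: leq_addr.
Qed.

(** Every vector close to the third basis vector is a positive multiple of some [embed x], so a form
    that vanishes on the plane vanishes near that vector. *)
Lemma dehom_inj d p : p \is hom d -> dehom p = 0 -> p = 0.
Proof.
move=> hp p0; pose e2 : 'rV[R]_3 := delta_mx 0 o2.
(* This radius keeps the last coordinate [1 + t * v 0 o2] positive. *)
apply: (@peval_eq0_near _ _ _ e2) => v; exists (1 + `|v 0 o2|)^-1.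
  by rewrite invr_gt0 ltr_pwDl.
move=> t t0 te; pose z := 1 + t * v 0 o2.
have z0 : 0 < z.
  have : `|t * v 0 o2| < 1.
    rewrite normrM (gtr0_norm t0); apply: le_lt_trans (_ : (1 + `|v 0 o2|)^-1 * `|v 0 o2| < 1).
      by rewrite ler_wpM2r.
    by rewrite mulrC ltr_pdivrMr ?ltr_pwDl // mul1r ltrDr.
  by rewrite ltr_norml => /andP[h _]; rewrite /z; lra.
pose x : point := \row_i (if i == i0 then t * v 0 o0 / z else t * v 0 o1 / z).
have -> : e2 + t *: v = z *: embed x.
  apply: row3P; rewrite !rvE !embedE !mxE /= ?mulr0n ?mulr1n ?add0r ?mulr1 //.
    by rewrite mulrCA divff ?mulr1 ?gt_eqF.
  by rewrite mulrCA divff ?mulr1 ?gt_eqF.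
by rewrite (peval_hom _ _ hp) -peval_dehom p0 -(mpolyC0 2) pevalC mulr0.
Qed.

Lemma dehomB p q : dehom (p - q) = dehom p - dehom q.
Proof. exact: comp_mpolyB. Qed.

Lemma dehomK d p : p \is hom d -> homogenize d (dehom p) = p.
Proof.
move=> hp; apply/eqP; rewrite -subr_eq0; apply/eqP/(@dehom_inj d).
  by apply: rpredB => //; apply/homogenize_hom/msize_dehom.
by rewrite dehomB homogenizeK subrr.
Qed.

Lemma mcoeff_dehom d p m : p \is hom d -> (mdeg m <= d)%N ->
  mcoeff (mnm_hom d m) p = mcoeff m (dehom p).
Proof.
move=> hp md; rewrite -{1}(dehomK hp) /homogenize raddf_sum /=.
transitivity (\sum_(i <- msupp (dehom p)) (i == m)%:R * mcoeff m (dehom p)).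
  apply: eq_bigr => i _; rewrite mcoeffZ mcoeffX.
  have [->|im] := eqVneq i m; first by rewrite eqxx mulr1 mul1r.
  case: eqP => [him|_]; last by rewrite mulr0 mul0r.
  exfalso; move/eqP: im; apply; apply/mnmP; apply: ord2P.
    by have [<- _ _] := mnm_homE d i; have [<- _ _] := mnm_homE d m; rewrite him.
  by have [_ <- _] := mnm_homE d i; have [_ <- _] := mnm_homE d m; rewrite him.
rewrite -mulr_suml.
have [mp|mp] := boolP (m \in msupp (dehom p)); last by rewrite (memN_msupp_eq0 mp) mulr0.
by rewrite (bigD1_seq m) ?msupp_uniq //= eqxx big1 ?addr0 ?mul1r // => i /negbTE->.
Qed.

Definition translate (x : point) (P : mpoly 2 R) : mpoly 2 R :=
  comp_mpoly (mktuple (fun i => Xv i + mpolyC 2 (x 0 i))) P.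

Lemma peval_translate x P y : peval (translate x P) y = peval P (y + x).
Proof.
rewrite peval_comp; congr peval; apply/rowP => i.
by rewrite mxE tnth_mktuple pevalD pevalX pevalC mxE.
Qed.

Lemma mderiv_translate x P i : mderiv i (translate x P) = translate x (mderiv i P).
Proof.
have tX j : translate x (Xv j) = Xv j + mpolyC 2 (x 0 j).
  by rewrite /translate comp_mpolyXU -tnth_nth tnth_mktuple.
elim/(@mpoly_alg_ind R 2): P => [c|j|p q IHp IHq|p q IHp IHq].
- by rewrite /translate comp_mpolyC !mderivC comp_mpoly0.
- rewrite tX mderivD mderivC addr0 !mderivX mnm1E.
  case: (eqVneq j i) => [->|_]; last by rewrite !scale0r /translate comp_mpoly0.
  have -> : mnm_sub (mnm1 i) (mnm1 i) = mnm0 :> multinom 2.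
    by apply/mnmP => k; rewrite mnmBE mnm0E subnn.
  by rewrite !scale1r mpolyX0 /translate comp_mpoly1.
- have tD u v : translate x (u + v) = translate x u + translate x v by exact: comp_mpolyD.
  by rewrite tD !mderivD tD IHp IHq.
- have tD u v : translate x (u + v) = translate x u + translate x v by exact: comp_mpolyD.
  have tM u v : translate x (u * v) = translate x u * translate x v by exact: rmorphM.
  by rewrite tM !mderivM tD !tM IHp IHq.
Qed.

Lemma mderivm_translate x P m : mderivm m (translate x P) = translate x (mderivm m P).
Proof.
rewrite !mderivm_foldr; elim: (flatten _) => [//|i w IH] /=.
by rewrite IH mderiv_translate.
Qed.

(** After a translation of [x] to the origin, a derivative at [x] is a coefficient times a product
    of factorials, and its order is the weight of the monomial in the first two variables. *)
Lemma vertex_smoothP d k p x : p \is hom d ->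
  (forall m, (mdeg m <= k)%N -> peval (mderivm m (dehom p)) x = 0) <->
  ideal_pow (vertex_ideal x) k.+1 p.
Proof.
(* In these coordinates the line over [x] is the third axis, and dehomogenizing [q] gives the
   dehomogenization of [p] translated by [x]. *)
move=> hp; pose M := rows3 (delta_mx 0 o0) (delta_mx 0 o1) (embed x).
have uM : M \in unitmx.
  apply: rows3_unit => u v w h.
  have h0 := congr1 (fun y : 'rV[R]_3 => y 0 o0) h.
  have h1 := congr1 (fun y : 'rV[R]_3 => y 0 o1) h.
  have h2 := congr1 (fun y : 'rV[R]_3 => y 0 o2) h.
  rewrite /= !rvE !embedE ![delta_mx _ _ _ _]mxE /= in h0 h1 h2.
  have w0 : w = 0 by lra.
  by rewrite w0 in h0 h1; split; lra.
have [_ _ M2] := row_rows3 (delta_mx 0 o0) (delta_mx 0 o1) (embed x).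
have PP := ideal_pow_vertexP k.+1 p uM M2; rewrite -/M in PP.
set q := lsubst M p in PP.
have hq : q \is hom d by exact: hom_lsubst.
have qE : dehom q = translate x (dehom p).
  apply: peval_inj => y; rewrite peval_translate !peval_dehom peval_lsubst mul_rows3.
  congr peval; apply: row3P; rewrite !rvE !embedE ![delta_mx _ _ _ _]mxE /= ?rvE; lra.
have dE m : peval (mderivm m (dehom p)) x = mcoeff m (dehom q) * (\prod_i (m i)`!)%:R.
  by rewrite -mcoeff0_mderivm qE mderivm_translate -peval0 peval_translate add0r.
have f0 (m : multinom 2) : (\prod_i (m i)`!)%:R != 0 :> R.
  by rewrite pnatr_eq0 -lt0n prodn_gt0 // => i; rewrite fact_gt0.
split=> [h|/PP h m mk].
  apply/PP => m' m'q; have md : mdeg m' = d by move/homP: hq; apply.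
  pose m : multinom 2 := Multinom (mktuple (fun i => if i == i0 then m' o0 else m' o1)).
  have m_0 : m i0 = m' o0 by rewrite /m multinomE tnth_mktuple.
  have m_1 : m i1 = m' o1 by rewrite /m multinomE tnth_mktuple.
  have mdd : (mdeg m <= d)%N by rewrite mdeg2 m_0 m_1 -md mdeg3 leq_addr.
  have mE : m' = mnm_hom d m.
    have [e0 e1 e2] := mnm_homE d m; apply/mnmP; apply: ord3P; rewrite ?e0 ?e1 ?e2 //.
    by rewrite mdeg2 m_0 m_1 -md mdeg3 addKn.
  rewrite wt_predC2 ltnNge; apply: contraNN m'q => mk.
  rewrite mE mcoeff_dehom //; have := h m; rewrite mdeg2 m_0 m_1 mk => /(_ isT)/eqP.
  by rewrite dE mulf_eq0 (negbTE (f0 m)) orbF.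
apply/eqP; rewrite dE mulf_eq0 (negbTE (f0 m)) orbF.
have [md|md] := leqP (mdeg m) d.
  rewrite -(mcoeff_dehom hq md); apply: contraLR mk => /h.
  have [e0 e1 _] := mnm_homE d m.
  by rewrite wt_predC2 e0 e1 -mdeg2 -ltnNge.
by rewrite mcoeff_eq0; apply: msize_mdeg_ge; apply: leq_trans (msize_dehom hq) md.
Qed.



End Homogenization.

(** * Forms vanishing to high order along a segment *)

Section LineVanishing.
Context {R : realType}.
Local Notation S := (mpoly 3 R).
Local Notation point := 'rV[R]_2.

Let pt (y z : R) : 'rV[R]_3 := y *: delta_mx 0 o1 + z *: delta_mx 0 o2.
Let e : 'rV[R]_3 := delta_mx 0 o0.

Let mono_restr (m : multinom 3) y z :
  line_restr (mpolyX R m) (pt y z) e = (y ^+ m o1 * z ^+ m o2) *: 'X^(m o0).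
Proof.
rewrite /line_restr mmapX /mmap1 big3 /= /pt /e !rvE ![delta_mx _ _ _ _]mxE /=.
rewrite !mulr0 !mulr1 !addr0 !add0r !scale0r !addr0 scale1r.
by rewrite -mul_polyC polyCM !polyC_exp; ring.
Qed.

Let restr_sum (q : S) y z :
  line_restr q (pt y z) e = \sum_(m <- msupp q) mcoeff m q *: ((y ^+ m o1 * z ^+ m o2) *: 'X^(m o0)).
Proof.
rewrite {1}[q]mpolyE /line_restr raddf_sum /=; apply: eq_bigr => m _.
by rewrite mmapZ mul_polyC -mono_restr.
Qed.

Let restr_dvd (q : S) k y z :
  (forall m, mcoeff m q != 0 -> (k <= m o0)%N \/ (y = 0 /\ (0 < m o1)%N)) ->
  exists g, line_restr q (pt y z) e = 'X^k * g.
Proof.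
move=> h; rewrite restr_sum big_seq.
elim/big_ind: _ => [|_ _ [g ->] [g' ->]|m].
- by exists 0; rewrite mulr0.
- by exists (g + g'); rewrite mulrDr.
rewrite mcoeff_msupp => /h[km|[-> m1]].
  exists ((mcoeff m q * (y ^+ m o1 * z ^+ m o2)) *: 'X^(m o0 - k)).
  by rewrite scalerA -[RHS]scalerAr -exprD subnKC.
by exists 0; rewrite expr0n (gtn_eqF m1) mul0r scale0r scaler0 mulr0.
Qed.

Let restr_small (q : S) k y z :
  (forall m, mcoeff m q != 0 -> (m o0 < k)%N) -> (size (line_restr q (pt y z) e) <= k)%N.
Proof.
move=> h; rewrite restr_sum big_seq; apply: (leq_trans (size_sum _ _ _)).
apply/bigmax_leqP_seq => m _; rewrite mcoeff_msupp => /h mk.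
rewrite scalerA; apply: (leq_trans (size_scale_leq _ _)).
by rewrite size_polyXn.
Qed.

Lemma line_restr_ext (q q' : S) x x' v v' :
  (forall t, peval q (x + t *: v) = peval q' (x' + t *: v')) -> line_restr q x v = line_restr q' x' v'.
Proof.
move=> h; apply/eqP; rewrite -subr_eq0; apply/eqP.
apply: (@poly_eq0_near _ _ 1) => // t _ _.
by rewrite hornerD hornerN !horner_line_restr h subrr.
Qed.

(** [p] vanishes to order [k] on a transversal line through each point over the open segment. On
    such a line the terms of degree less than [k] in the edge form are a multiple of ['X^k] of
    smaller degree, hence zero, and there are enough such lines to kill these terms identically. *)
Lemma segment_principal (a b : point) (l p : S) k : a != b ->
  l != 0 -> l \is hom 1 -> peval l (embed a) = 0 -> peval l (embed b) = 0 ->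
  (forall t : R, 0 < t -> t < 1 ->
     ideal_pow (vertex_ideal ((1 - t) *: a + t *: b)) k p) ->
  ideal_gen [set l ^+ k] p.
Proof.
move=> ab l0 l1 la lb hp.
have [v lv] := @exists_transversal _ (fun=> l) a b l0.
have uM := @adapted_unit _ (fun=> l) a b ab l1 la lb v lv.
apply/(principalP _ _ uM lv (@lsubst_adapted _ (fun=> l) a b l1 la lb v)).
set M := rows3 _ _ _ in uM *; set q := lsubst M p.
(* In adapted coordinates [pt y z] stands for [y *: embed b + z *: embed a], a positive multiple of
   the lift of the point of parameter [t = y / (y + z)]. *)
have dvd_q y z : 0 < y -> 0 < z -> exists g, line_restr q (pt y z) e = 'X^k * g.
  move=> y0 z0; pose t := y / (y + z); have yz : y + z != 0 by rewrite gt_eqF ?addr_gt0.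
  have t0 : 0 < t by rewrite divr_gt0 ?addr_gt0.
  have t1 : 1 - t = z / (y + z) by rewrite /t -{1}(divff yz) -mulrBl addrC addKr.
  have t1' : t < 1 by rewrite -subr_gt0 t1 divr_gt0 ?addr_gt0.
  pose x : point := (1 - t) *: a + t *: b.
  have xE : embed x = (1 - t) *: embed a + t *: embed b.
    by apply: row3P; rewrite !rvE !embedE ?rvE //; lra.
  pose N := rows3 v (embed b) (embed x).
  have uN : N \in unitmx.
    apply: rows3_unit => u w c; rewrite xE scalerDr !scalerA => h.
    have h' : (\row_(i < 3) (if i == o0 then u else if i == o1 then w + c * t else c * (1 - t))) *m M = 0.
      rewrite mul_rows3 !mxE /= -[RHS]h; apply: row3P; rewrite !rvE; ring.
    have h2 : \row_(i < 3) (if i == o0 then u else if i == o1 then w + c * t else c * (1 - t)) = 0 :> 'rV[R]_3.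
      by rewrite -(mulmxK uM (\row_i _)) h' mul0mx.
    have e0 := congr1 (fun u : 'rV[R]_3 => u 0 o0) h2.
    have e1 := congr1 (fun u : 'rV[R]_3 => u 0 o1) h2.
    have e2 := congr1 (fun u : 'rV[R]_3 => u 0 o2) h2.
    rewrite /= !mxE /= in e0 e1 e2.
    have c0 : c = 0 by move/eqP: e2; rewrite mulf_eq0 (gt_eqF (_ : 0 < 1 - t)) ?subr_gt0 // orbF => /eqP.
    by split=> //; move: e1; rewrite c0 mul0r addr0.
  have [_ _ N2] := row_rows3 v (embed b) (embed x).
  have /(ideal_pow_vertexP _ _ uN N2) hq := hp t t0 t1'.
  have -> : line_restr q (pt y z) e = line_restr (lsubst N p) (pt 0 (y + z)) e.
    apply: line_restr_ext => c; rewrite !peval_lsubst !mul_rows3; congr peval.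
    rewrite /pt /e !rvE ![delta_mx _ _ _ _]mxE /= xE t1 /t.
    by apply: row3P; rewrite !rvE; field.
  apply: restr_dvd => m /hq; rewrite wt_predC2.
  have [->|m1] := posnP (m o1); first by rewrite addn0; left.
  by right.
have lo0 : mpart (fun m => m o0 < k)%N q = 0.
  apply: (@peval_eq0_near _ _ _ (pt 1 1)) => w.
  (* Within this radius both coordinates of the base point stay positive, as [dvd_q] requires. *)
  exists (1 + `|w 0 o1| + `|w 0 o2|)^-1; first by rewrite invr_gt0 -addrA ltr_pwDl // addr_ge0.
  move=> c c0 cE.
  have bnd i : (i == o1) || (i == o2) -> 0 < 1 + c * w 0 i.
    move=> hi; have : `|c * w 0 i| < 1.
      rewrite normrM (gtr0_norm c0); apply: (@le_lt_trans _ _ ((1 + `|w 0 o1| + `|w 0 o2|)^-1 * `|w 0 i|)).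
        by rewrite ler_wpM2r.
      rewrite mulrC ltr_pdivrMr ?mul1r; last by rewrite -addrA ltr_pwDl // addr_ge0.
      by case/orP: hi => /eqP->; have := normr_ge0 (w 0 o1); have := normr_ge0 (w 0 o2); lra.
    by rewrite ltr_norml => /andP[h _]; lra.
  have -> : pt 1 1 + c *: w = pt (1 + c * w 0 o1) (1 + c * w 0 o2) + (c * w 0 o0) *: e.
    by apply: row3P; rewrite /pt /e !rvE ![delta_mx _ _ _ _]mxE /=; lra.
  have [g hg] := dvd_q _ _ (bnd o1 isT) (bnd o2 isT).
  rewrite -horner_line_restr.
  set lo := mpart _ q; set y := 1 + _ in hg *; set z := 1 + _ in hg *.
  have [g' hg'] : exists g, line_restr (q - lo) (pt y z) e = 'X^k * g.
    apply: restr_dvd => m; rewrite mcoeffB mcoeff_mpart; case: ltnP => km; first by rewrite subrr eqxx.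
    by left.
  have lo_dvd : line_restr lo (pt y z) e = 'X^k * (g - g').
    rewrite mulrBr -hg -hg' /line_restr raddfB /=; ring.
  have lo_small : (size (line_restr lo (pt y z) e) <= k)%N.
    by apply: restr_small => m; rewrite mcoeff_mpart; case: ltnP; rewrite ?eqxx.
  suff -> : line_restr lo (pt y z) e = 0 by rewrite horner0.
  rewrite lo_dvd; have [->|gg] := eqVneq (g - g') 0; first by rewrite mulr0.
  move: lo_small; rewrite lo_dvd mulrC size_Mmonic ?monicXn // size_polyXn addnS /=.
  by rewrite -{2}[k]add0n leq_add2r leqn0 size_poly_eq0 (negbTE gg).
move=> m mq; rewrite wt_pred1 leqNgt; apply: contraNN mq => mk.
by have := mcoeff_mpart (fun m => m o0 < k)%N q m; rewrite mk lo0 mcoeff0 => <-.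
Qed.

End LineVanishing.

(** * Polynomial pieces glued smoothly along a line *)

Section SmoothGluing.
Context {R : realType}.
Local Notation point := 'rV[R]_2.

Lemma eq_on_closure (f g : point -> R) (O : set point) x :
  {for x, continuous f} -> {for x, continuous g} ->
  (forall y, O y -> f y = g y) -> closure O x -> f x = g x.
Proof.
move=> cf cg fg clO; apply/eqP; rewrite -subr_eq0; apply/negPn/negP => fx.
have cfg : (f - g) @ x --> f x - g x.
  exact: (cvgB cf cg).
have nx : nbhs x [set y | (f - g) y != 0].
  exact: (@cvgr_neq0 R R^o _ (nbhs x) _ _ _ cfg fx).
have [y [Oy /=]] := clO _ nx.
by rewrite fctE fg // subrr eqxx.
Qed.

Lemma mderivm_split (m : multinom 2) (P : mpoly 2 R) k : mdeg m = k.+1 ->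
  exists i m', mdeg m' = k /\ forall P : mpoly 2 R, mderivm m P = mderivm m' (mderiv i P).
Proof.
move=> mk; have [i mi] : exists i, (0 < m i)%N.
  apply: contrapT => h; have : mdeg m = 0%N; last by rewrite mk.
  rewrite mdegE big1 // => i _; case: (posnP (m i)) => // mi.
  by case: h; exists i.
have mE : m = mnm_add (mnm1 i) (mnm_sub m (mnm1 i)).
  rewrite addmC submK //; apply/mnm_lepP => j; rewrite mnm1E.
  by case: eqP => // <-.
exists i, (mnm_sub m (mnm1 i)); split.
  by move: mk; rewrite {1}mE mdegD mdeg1 add1n => -[].
by move=> Q; rewrite {1}mE mderivmDm mderivmU1m.
Qed.

Lemma peval_derive (P : mpoly 2 R) i :
  'D_(delta_mx 0 i) (peval P : point -> R) = peval (mderiv i P).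
Proof. by apply/funext => x; have [_ ->] := peval_is_derive P x i. Qed.

(** Each derivative of [F] up to order [k] is continuous at [x] and agrees with that of [P1] on [O1]
    and of [P2] on [O2], so both take its value at the common limit point. *)
Lemma class_C_agree k (U O1 O2 : set point) (F : point -> R) (P1 P2 : mpoly 2 R) x :
  class_C k U F -> open O1 -> open O2 ->
  (forall y, O1 y -> F y = peval P1 y) -> (forall y, O2 y -> F y = peval P2 y) ->
  U x -> closure O1 x -> closure O2 x ->
  forall m, (mdeg m <= k)%N -> peval (mderivm m P1) x = peval (mderivm m P2) x.
Proof.
move=> CF oO1 oO2 + + Ux c1 c2.
have F0 (G : point -> R) Q1 Q2 : {for x, continuous G} ->
    (forall y, O1 y -> G y = peval Q1 y) -> (forall y, O2 y -> G y = peval Q2 y) ->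
    peval Q1 x = peval Q2 x.
  move=> cG G1 G2.
  rewrite -(eq_on_closure cG (@peval_continuous _ _ Q1 x) G1 c1).
  exact: (eq_on_closure cG (@peval_continuous _ _ Q2 x) G2 c2).
elim: k F P1 P2 CF => [|k IH] F P1 P2 /= [cF CF] FP1 FP2 m mk.
  have -> : m = mnm0 by apply/eqP; rewrite -mdeg_eq0 -leqn0.
  by rewrite !mderivm0m; apply: (F0 F) => //; exact: cF.
case md: (mdeg m) mk => [|l] lk.
  have -> : m = mnm0 by apply/eqP; rewrite -mdeg_eq0 md.
  by rewrite !mderivm0m; apply: (F0 F) => //; exact: cF.
have [i [m' [m'l mE]]] := mderivm_split P1 md; rewrite !mE.
have [_ CDF] := CF i.
have DO (O : set point) Q : open O -> (forall y, O y -> F y = peval Q y) ->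
    forall y, O y -> 'D_(delta_mx 0 i) F y = peval (mderiv i Q) y.
  move=> oO FQ y Oy; rewrite -peval_derive; apply: near_eq_derive.
  by near do apply: FQ; exact: open_nbhs_nbhs.
apply: IH CDF _ _ _ _; [exact: DO FP1|exact: DO FP2|by rewrite m'l].
Unshelve. all: by end_near.
Qed.

(** [A] where [L] is negative and [A + L ^+ k * B] where it is positive: two pieces with prescribed
    difference as one function on the plane. *)
Definition trunc_glue (A L B : mpoly 2 R) k : point -> R :=
  fun x => peval A x + Num.max (peval L x) 0 ^+ k * peval B x.

Lemma continuous_maxpow (L B : mpoly 2 R) k :
  continuous (fun x : point => Num.max (peval L x) 0 ^+ k * peval B x : R).
Proof.
move=> x; suff c1 : {for x, continuous (fun x : point => Num.max (peval L x) 0 ^+ k)}.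
  exact: (cvgM c1 (@peval_continuous _ _ B x)).
have cm : {for x, continuous (fun x : point => Num.max (peval L x) 0)}.
  apply: (@continuous_max _ _ _ (cst 0)); [exact: peval_continuous|exact: cst_continuous].
elim: k => [|k IH]; first exact: cst_continuous.
have -> : (fun y : point => Num.max (peval L y) 0 ^+ k.+1) =
    (fun y => Num.max (peval L y) 0 * Num.max (peval L y) 0 ^+ k).
  by apply/funext => y; rewrite exprS.
exact: (cvgM cm IH).
Qed.

(** Continuity of [G] suffices because [f] vanishes at the point: the difference quotient of the
    product is that of [f] times a value of [G]. *)
Lemma is_derive_mul0 (f G : point -> R) x v df :
  is_derive x v f df -> f x = 0 -> {for x, continuous G} ->
  is_derive x v (fun y => f y * G y) (df * G x).
Proof.
move=> [fd <-] fx cG.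
have cGv : (fun h : R => G (h *: v + x)) @ 0^' --> G x.
  have cx : (fun h : R => h *: v + x) @ 0^' --> x.
    have h0 : (fun h : R => h *: v + x) @ nbhs (0 : R) --> 0 *: v + x.
      by apply: cvgD; [exact: scalel_continuous|exact: cvg_cst].
    rewrite scale0r add0r in h0; exact: cvg_within_filter h0.
  exact: (cvg_comp _ _ cx cG).
have lim1 : (fun h : R => h^-1 *: ((fun y => f y * G y) (h *: v + x) - f x * G x)) @ 0^' --> 'D_v f x * G x.
  have -> : (fun h : R => h^-1 *: ((fun y => f y * G y) (h *: v + x) - f x * G x)) =
    (fun h : R => h^-1 *: (f (h *: v + x) - f x)) * (fun h => G (h *: v + x)).
    by apply/funext => h; rewrite fctE fx mul0r !subr0 /GRing.scale /= mulrA.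
  exact: cvgM.
by apply: DeriveDef; [apply/cvg_ex; exists ('D_v f x * G x)|exact: cvg_lim lim1].
Qed.

(** Derivation keeps the shape and lowers the exponent by one, which drives the induction on
    smoothness. On the line [L = 0] one factor [L] is split off the truncated power and only
    continuity of the rest is used. *)
Lemma trunc_glue_is_derive A L B k x i :
  is_derive x (delta_mx 0 i) (trunc_glue A L B k.+2)
    (trunc_glue (mderiv i A) L (k.+2%:R *: (mderiv i L * B) + L * mderiv i B) k.+1 x).
Proof.
have [L0|L0|L0] := ltgtP (peval L x) 0.
- apply: (@near_eq_is_derive _ _ _ (peval A)).
    have : \forall y \near x, peval L y < 0 by exact: (cvgr_lt _ (@peval_continuous _ _ L x) _ L0).
    by apply: filterS => y Ly; rewrite /trunc_glue max_r ?ltW // exprS !mul0r addr0.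
  rewrite /trunc_glue max_r ?ltW // exprS !mul0r addr0.
  exact: peval_is_derive.
- apply: (@near_eq_is_derive _ _ _ (peval (A + L ^+ k.+2 * B))).
    have : \forall y \near x, 0 < peval L y by exact: (cvgr_gt _ (@peval_continuous _ _ L x) _ L0).
    by apply: filterS => y Ly; rewrite /trunc_glue max_l ?ltW // pevalD pevalM pevalXn.
  have dX j : mderiv i (L ^+ j.+1) = j.+1%:R *: (L ^+ j * mderiv i L).
    elim: j => [|j IH]; first by rewrite expr1 expr0 mul1r scale1r.
    rewrite exprS mderivM IH -!mul_mpolyC !mpolyC_nat exprS; ring.
  apply: is_derive_eq; first exact: peval_is_derive.
  rewrite /trunc_glue max_l ?ltW // mderivD mderivM dX.
  rewrite !(pevalD, pevalM, pevalZ, pevalXn) !exprS; ring.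
- have H := is_derive_mul0 (peval_is_derive L x i) L0 (@continuous_maxpow L B k.+1 x).
  have fE : (fun y => peval L y * (Num.max (peval L y) 0 ^+ k.+1 * peval B y)) =
      (fun y => Num.max (peval L y) 0 ^+ k.+2 * peval B y).
    apply/funext => y; rewrite [in RHS]exprS; case: (leP (peval L y) 0) => h; last by rewrite mulrA.
    by rewrite exprS !mul0r mulr0.
  rewrite fE in H; have HA := peval_is_derive A x i.
  have -> : trunc_glue A L B k.+2 =
    (peval A : point -> R) + (fun y => Num.max (peval L y) 0 ^+ k.+2 * peval B y) by [].
  apply: is_derive_eq.
  by rewrite /trunc_glue L0 maxxx exprS !mul0r mulr0.
Qed.

Lemma trunc_glue_class_C k A L B : class_C k setT (trunc_glue A L B k.+1).
Proof.
have cG j C B' x : {for x, continuous (trunc_glue C L B' j)}.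
  exact: (cvgD (@peval_continuous _ _ C x) (@continuous_maxpow L B' j x)).
elim: k A B => [|k IH] A B /=; first by split=> // x _; exact: cG.
split=> [x _|i]; first exact: cG.
split=> [x _|]; first by have [] := trunc_glue_is_derive A L B k x i.
rewrite (_ : 'D_(delta_mx 0 i) _ = trunc_glue (mderiv i A) L (k.+2%:R *: (mderiv i L * B) + L * mderiv i B) k.+1) //.
by apply/funext => x; have [_ ->] := trunc_glue_is_derive A L B k x i.
Qed.

End SmoothGluing.

(** * Triangulations of the plane *)

Section FiniteSets.

Lemma fset2_split (T : choiceType) (A : {fset T}) a : #|` A| = 2 -> a \in A ->
  exists2 b, a != b & A = [fset a; b]%fset.
Proof.
move=> A2 aA; have := cardfsD1 a A; rewrite A2 aA => -[] /esym/eqP/cardfs1P[b bE].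
have : b \in (A `\ a)%fset by rewrite bE inE.
rewrite !inE => /andP[ba bA]; exists b; first by rewrite eq_sym.
by rewrite -bE fsetD1K.
Qed.

Lemma fset3_split (T : choiceType) (A : {fset T}) a : #|` A| = 3 -> a \in A ->
  exists b c, [/\ a != b, a != c, b != c & A = [fset a; b; c]%fset].
Proof.
move=> A3 aA; have := cardfsD1 a A; rewrite A3 aA => -[] /esym; rewrite add0n => A2.
have [b bA] : exists b, b \in (A `\ a)%fset.
  by apply/fset0Pn; rewrite -cardfs_gt0 A2.
have [c bc cE] := fset2_split A2 bA.
have : c \in (A `\ a)%fset by rewrite cE !inE eqxx orbT.
move: bA; rewrite !inE => /andP[ba bA] /andP[ca cA].
exists b, c; split=> //; rewrite 1?eq_sym //.
by rewrite -fsetUA -cE fsetD1K.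
Qed.

Lemma fset3_edge (T : choiceType) (A : {fset T}) a b : #|` A| = 3 ->
  a != b -> ([fset a; b] `<=` A)%fset ->
  exists2 c, (a != c) && (b != c) & A = [fset a; b; c]%fset.
Proof.
move=> A3 ab /fsubsetP sA.
have aA : a \in A by apply: sA; rewrite !inE eqxx.
have bA : b \in A by apply: sA; rewrite !inE eqxx orbT.
have [c [d [ac ad cd AE]]] := fset3_split A3 aA.
move: bA; rewrite AE !inE (eq_sym b) (negbTE ab) /= => /orP[] /eqP bE.
  by exists d; rewrite bE ?ad.
by exists c; rewrite bE ?ac 1?eq_sym // fsetUAC.
Qed.

Lemma sum_fset2 (T : choiceType) (V : nmodType) (F : T -> V) a b : a != b ->
  \sum_(x <- [fset a; b]%fset) F x = F a + F b.
Proof.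
move=> ab; rewrite (perm_big [:: a; b]) /= ?big_cons ?big_nil ?addr0 //.
apply: uniq_perm; rewrite ?fset_uniq //= ?inE ?ab // => x.
by rewrite !inE.
Qed.

Lemma sum_fset3 (T : choiceType) (V : nmodType) (F : T -> V) a b c :
  a != b -> a != c -> b != c ->
  \sum_(x <- [fset a; b; c]%fset) F x = F a + F b + F c.
Proof.
move=> ab ac bc; rewrite (perm_big [:: a; b; c]) /= ?big_cons ?big_nil ?addr0 ?addrA //.
apply: uniq_perm; rewrite ?fset_uniq //= ?inE ?negb_or ?ab ?ac ?bc // => x.
by rewrite !inE orbA.
Qed.

End FiniteSets.

(** * Convex hulls, relative interiors and carriers *)

Section ConvexHulls.
Context {R : realType} {n : nat}.
Local Notation vec := 'rV[R]_n.
Implicit Types (A B : {fset vec}).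

Definition open_conv A : set vec := [set x | exists c : vec -> R,
  [/\ forall a, 0 <= c a, forall a, a \in A -> 0 < c a, \sum_(a <- A) c a = 1
    & x = \sum_(a <- A) c a *: a]].

Lemma open_conv_sub A : open_conv A `<=` conv A.
Proof. by move=> x [c [c0 _ c1 cx]]; exists c. Qed.

Lemma conv_sub A B : (B `<=` A)%fset -> conv B `<=` conv A.
Proof.
move=> BA x [c [c0 c1 ->]].
have F0 (V : nmodType) (F : vec -> V) :
    \sum_(a <- A) (if a \in B then F a else 0) = \sum_(a <- B) F a.
  rewrite -(big_fset_incl _ BA) /=; last by move=> a _ /negbTE->.
  by rewrite big_seq [RHS]big_seq; apply: eq_bigr => a ->.
exists (fun a => if a \in B then c a else 0); split.
- by move=> a; case: ifP.
- by rewrite F0.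
- rewrite -F0; apply: eq_bigr => a _.
  by case: ifP; rewrite ?scale0r.
Qed.

Lemma conv_vertex A a : a \in A -> conv A a.
Proof.
move=> aA; apply: (@conv_sub A [fset a]%fset); first by rewrite fsub1set.
by exists (fun=> 1); split=> //; rewrite big_seq_fset1 ?scale1r.
Qed.

(** The carrier consists of the vertices with positive coefficient. *)
Lemma conv_carrier A x : conv A x -> exists B, [/\ (B `<=` A)%fset, B != fset0 & open_conv B x].
Proof.
move=> [c [c0 c1 cx]]; pose B := [fset a in A | 0 < c a]%fset.
have BA : (B `<=` A)%fset by apply/fsubsetP => a; rewrite !inE => /andP[].
have cB a : a \in A -> a \notin B -> c a = 0.
  rewrite !inE /= => -> /=; rewrite -leNgt => h; apply/eqP; rewrite eq_le h; exact: c0.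
have sB : \sum_(a <- B) c a = 1 by rewrite (big_fset_incl _ BA) // => a aA /cB->.
exists B; split=> //.
  by apply/eqP => B0; move: sB; rewrite B0 big_seq_fset0 => /esym/eqP; rewrite oner_eq0.
exists c; split=> //; first by move=> a; rewrite !inE => /andP[].
by rewrite cx (big_fset_incl _ BA) // => a aA /cB-> //; rewrite scale0r.
Qed.

Lemma bary_uniq A (c d : vec -> R) : affinely_independent A ->
  \sum_(a <- A) c a = \sum_(a <- A) d a -> \sum_(a <- A) c a *: a = \sum_(a <- A) d a *: a ->
  forall a, a \in A -> c a = d a.
Proof.
move=> iA s1 s2 a aA; apply/eqP; rewrite -subr_eq0; apply/eqP.
apply: (iA (fun a => c a - d a)) => //.
  by rewrite big_split /= sumrN s1 subrr.
rewrite (eq_bigr (fun a => c a *: a - d a *: a)); last by move=> i _; rewrite scalerBl.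
by rewrite big_split /= sumrN s2 subrr.
Qed.

(** [x] also has barycentric coordinates supported on the common vertices. By uniqueness in [B] they
    are the given ones, and these are positive on all of [B]. *)
Lemma carrier_subset A B x : affinely_independent B ->
  conv A `&` conv B `<=` conv (A `&` B)%fset -> open_conv B x -> conv A x -> (B `<=` A)%fset.
Proof.
move=> iB AB [c [c0 cp c1 cx]] Ax.
have Bx : conv B x by exists c.
have [d [d0 d1 dx]] := AB x (conj Ax Bx).
have IB : (A `&` B `<=` B)%fset by exact: fsubsetIr.
have F0 (V : nmodType) (F : vec -> V) :
    \sum_(a <- B) (if a \in A then F a else 0) = \sum_(a <- (A `&` B)%fset) F a.
  rewrite -(big_fset_incl _ IB) /=; last by move=> a aB; rewrite !inE aB andbT => /negbTE->.
  by rewrite big_seq [RHS]big_seq; apply: eq_bigr => a; rewrite inE => /andP[->].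
apply/fsubsetP => b bB; have := cp b bB.
rewrite (@bary_uniq B c (fun a => if a \in A then d a else 0) iB) //.
- by case: ifP; rewrite ?ltxx.
- by rewrite F0 c1 d1.
- rewrite -cx dx -F0; apply: eq_bigr => a _.
  by case: ifP; rewrite ?scale0r.
Qed.

Lemma conv_convex A x y t : conv A x -> conv A y -> 0 <= t -> t <= 1 ->
  conv A ((1 - t) *: x + t *: y).
Proof.
move=> [c [c0 c1 ->]] [d [d0 d1 ->]] t0 t1.
have t1' : 0 <= 1 - t by rewrite subr_ge0.
exists (fun a => (1 - t) * c a + t * d a); split.
- by move=> a; rewrite addr_ge0 // mulr_ge0.
- by rewrite big_split /= -!mulr_sumr c1 d1 !mulr1 subrK.
- rewrite !scaler_sumr -big_split /=; apply: eq_bigr => a _.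
  by rewrite [in RHS]scalerDl !scalerA.
Qed.

Lemma sum_continuous (T : topologicalType) (V : normedModType R) (I : Type) (s : seq I)
    (f : I -> T -> V) :
  (forall i, continuous (f i)) -> continuous (fun v => \sum_(i <- s) f i v).
Proof.
move=> cf; elim: s => [|i s IH] x.
  rewrite (_ : (fun v => _) = cst 0); first exact: cst_continuous.
  by apply/funext => v; rewrite big_nil.
rewrite (_ : (fun v => _) = (fun v => f i v + \sum_(j <- s) f j v)).
  by apply: cvgD; [exact: cf|exact: IH].
by apply/funext => v; rewrite big_cons.
Qed.

(** The hull is the continuous image of the standard simplex, a closed part of a cube. *)
Lemma conv_compact A : compact (conv A).
Proof.
pose m := size (enum_fset A).
pose Q : set 'rV[R]_m := [set v | forall i, `[0%R, 1%R]%classic (v ord0 i)].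
pose D : set 'rV[R]_m := Q `&` [set v | \sum_i v ord0 i = 1].
have cD : compact D.
  apply: compact_closedI; first exact: (@rV_compact R m (fun=> `[0%R, 1%R]%classic) (fun=> @segment_compact R 0 1)).
  apply: (@closed_comp _ _ (fun v : 'rV[R]_m => \sum_i v ord0 i) [set 1]); last exact: closed_eq.
  move=> v _; apply: (@sum_continuous _ R^o _ _ (fun i (v : 'rV[R]_m) => v ord0 i : R^o)).
  by move=> i; exact: coord_continuous.
pose f (v : 'rV[R]_m) : vec := \sum_(i < m) v ord0 i *: nth 0 (enum_fset A) i.
have cf : continuous f.
  apply: sum_continuous => i v.
  have h := @coord_continuous R 1 m ord0 i v.
  exact: (cvg_comp _ _ h (@scalel_continuous _ _ (nth 0 (enum_fset A) i) _)).
have sE (V : nmodType) (F : vec -> V) : \sum_(a <- A) F a = \sum_(i < m) F (nth 0 (enum_fset A) i).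
  by rewrite (big_nth 0) big_mkord.
have -> : conv A = f @` D.
  apply/seteqP; split=> x /=.
    move=> [c [c0 c1 ->]]; exists (\row_i c (nth 0 (enum_fset A) i)).
      have s1 : \sum_(i < m) c (nth 0 (enum_fset A) i) = 1 by rewrite -sE.
      split=> [i|] /=; last by rewrite -[RHS]s1; apply: eq_bigr => i _; rewrite mxE.
      rewrite mxE /= in_itv /= c0 -s1 (bigD1 i) //= lerDl sumr_ge0 //.
    by rewrite /f sE; apply: eq_bigr => i _; rewrite mxE.
  move=> [v [v01 /= v1] <-].
  pose c a := if insub (index a (enum_fset A)) is Some i then v ord0 i else 0.
  have cE (i : 'I_m) : c (nth 0 (enum_fset A) i) = v ord0 i.
    by rewrite /c index_uniq ?fset_uniq // valK.
  exists c; split.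
  - by move=> a; rewrite /c; case: insubP => // i _ _; have := v01 i; rewrite /= in_itv /= => /andP[].
  - by rewrite sE -[RHS]v1; apply: eq_bigr => i _; rewrite cE.
  - by rewrite sE; apply: eq_bigr => i _; rewrite cE.
by apply: continuous_compact => //; exact: continuous_subspaceT.
Qed.

Lemma conv_closed A : closed (conv A).
Proof. by apply: compact_closed; [exact: norm_hausdorff|exact: conv_compact]. Qed.

End ConvexHulls.

(** * Signed areas and barycentric coordinates in the plane *)

Section PlaneTriangles.
Context {R : realType}.
Local Notation point := 'rV[R]_2.
Implicit Types a b c d x y : point.

(** Twice the signed area of the triangle [a], [b], [x]; its sign tells on which side of the line
    [ab] the point [x] lies. *)
Definition det a b x : R :=
  (b 0 i0 - a 0 i0) * (x 0 i1 - a 0 i1) - (b 0 i1 - a 0 i1) * (x 0 i0 - a 0 i0).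

Lemma det_continuous a b : continuous (det a b).
Proof.
move=> x.
have c (i : 'I_2) : (fun y : point => y 0 i - a 0 i) @ x --> x 0 i - a 0 i.
  have h := @coord_continuous R 1 2 0 i x.
  exact: (cvgB h (cvg_cst (a 0 i))).
exact: (cvgB (cvgM (cvg_cst (b 0 i0 - a 0 i0)) (c i1)) (cvgM (cvg_cst (b 0 i1 - a 0 i1)) (c i0))).
Qed.

Lemma det_affine a b x y t : det a b ((1 - t) *: x + t *: y) = (1 - t) * det a b x + t * det a b y.
Proof. by rewrite /det !rvE; ring. Qed.

Lemma detC a b x : det b a x = - det a b x. Proof. by rewrite /det; ring. Qed.
Lemma det_cyc a b x : det b x a = det a b x. Proof. by rewrite /det; ring. Qed.
Lemma det_rot a b c : det b c a = det a b c /\ det c a b = det a b c.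
Proof. by split; rewrite /det; ring. Qed.
Lemma det_l a b : det a b a = 0. Proof. by rewrite /det; ring. Qed.
Lemma det_r a b : det a b b = 0. Proof. by rewrite /det; ring. Qed.

Lemma det_neq a b c : det a b c != 0 -> [/\ a != b, a != c & b != c].
Proof.
move=> d; split; apply: contraNneq d => ->; apply/eqP; rewrite /det; ring.
Qed.

Definition bary a b c x : R := det b c x / det b c a.

Lemma bary_continuous a b c : continuous (bary a b c).
Proof. move=> x; have h := @det_continuous b c x; exact: (cvgM h (cvg_cst (det b c a)^-1)). Qed.

Lemma bary_sum a b c x : det a b c != 0 -> bary a b c x + bary b c a x + bary c a b x = 1.
Proof.
move=> d; rewrite /bary; have [-> ->] := det_rot a b c.
by rewrite -!mulrDl; apply: (mulIf d); rewrite mulfVK // mul1r /det; ring.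
Qed.

Lemma bary_comb a b c x : det a b c != 0 ->
  x = bary a b c x *: a + bary b c a x *: b + bary c a b x *: c.
Proof.
move=> d; rewrite /bary; have [-> ->] := det_rot a b c.
by apply: row2P; rewrite !rvE -[LHS](mulfK d); set i := (det a b c)^-1; rewrite /det; ring.
Qed.

Lemma bary_of_comb a b c u v w : det a b c != 0 -> u + v + w = 1 ->
  [/\ bary a b c (u *: a + v *: b + w *: c) = u,
      bary b c a (u *: a + v *: b + w *: c) = v
    & bary c a b (u *: a + v *: b + w *: c) = w].
Proof.
move=> d s; have -> : u = 1 - v - w by rewrite -s; ring.
rewrite /bary; have [-> ->] := det_rot a b c.
by split; apply: (mulIf d); rewrite mulfVK // /det !rvE; ring.
Qed.

Lemma conv2P a b x : a != b ->
  conv [fset a; b]%fset x <-> exists2 t, 0 <= t <= 1 & x = (1 - t) *: a + t *: b.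
Proof.
move=> ab; split=> [[c [c0]]|[t /andP[t0 t1] ->]].
  rewrite !sum_fset2 // => s ->; exists (c b); last by rewrite -s addrK.
  by rewrite c0 -s lerDr c0.
apply: conv_convex => //; apply: conv_vertex; rewrite !inE eqxx ?orbT //.
Qed.

Lemma open_conv2P a b x : a != b ->
  open_conv [fset a; b]%fset x <-> exists2 t, 0 < t < 1 & x = (1 - t) *: a + t *: b.
Proof.
move=> ab; split=> [[c [c0 cp]]|[t /andP[t0 t1] ->]].
  rewrite !sum_fset2 // => s ->; exists (c b); last by rewrite -s addrK.
  by rewrite -s ltrDr !cp // !inE eqxx ?orbT.
exists (fun x => if x == a then 1 - t else if x == b then t else 0).
rewrite !sum_fset2 // eqxx eq_sym (negbTE ab) eqxx subrK; split=> // [y|y].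
  by do !case: ifP => _ //; lra.
by rewrite !inE => /orP[] /eqP->; rewrite ?eqxx 1?eq_sym ?(negbTE ab); lra.
Qed.

Lemma tri_convP a b c x : det a b c != 0 ->
  conv [fset a; b; c]%fset x <-> [/\ 0 <= bary a b c x, 0 <= bary b c a x & 0 <= bary c a b x].
Proof.
move=> d; have [ab ac bc] := det_neq d; split=> [[l [l0]]|[h1 h2 h3]].
  by rewrite !sum_fset3 // => s ->; have [-> -> ->] := bary_of_comb d s.
exists (fun y => if y == a then bary a b c x else if y == b then bary b c a x else
  if y == c then bary c a b x else 0).
rewrite !sum_fset3 // !eqxx (eq_sym b a) (eq_sym c a) (eq_sym c b) (negbTE ab) (negbTE ac) (negbTE bc).
split=> [y||]; last exact: bary_comb; last exact: bary_sum.
by do !case: ifP => _ //.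
Qed.

Lemma tri_open_convP a b c x : det a b c != 0 ->
  open_conv [fset a; b; c]%fset x <-> [/\ 0 < bary a b c x, 0 < bary b c a x & 0 < bary c a b x].
Proof.
move=> d; have [ab ac bc] := det_neq d; split=> [[l [l0 lp]]|[h1 h2 h3]].
  rewrite !sum_fset3 // => s ->; have [-> -> ->] := bary_of_comb d s.
  by rewrite !lp // !inE eqxx ?orbT.
exists (fun y => if y == a then bary a b c x else if y == b then bary b c a x else
  if y == c then bary c a b x else 0).
rewrite !sum_fset3 // !eqxx (eq_sym b a) (eq_sym c a) (eq_sym c b) (negbTE ab) (negbTE ac) (negbTE bc).
split=> [y|y||]; last exact: bary_comb; last exact: bary_sum.
  by do !case: ifP => _ //; exact: ltW.
rewrite !inE -orbA => /or3P[] /eqP->; rewrite ?eqxx //.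
  by rewrite eq_sym (negbTE ab).
by rewrite eq_sym (negbTE ac) eq_sym (negbTE bc).
Qed.

Lemma affinely_independent_det a b c : a != b -> a != c -> b != c ->
  affinely_independent [fset a; b; c]%fset -> det a b c != 0.
Proof.
move=> ab ac bc iA; apply/eqP => d0.
have key u v : u *: (b - a) + v *: (c - a) = 0 -> u = 0 /\ v = 0.
  move=> h; pose f y := if y == a then - (u + v) else if y == b then u else v.
  have fa : f a = - (u + v) by rewrite /f eqxx.
  have fb : f b = u by rewrite /f eq_sym (negbTE ab) eqxx.
  have fc : f c = v by rewrite /f eq_sym (negbTE ac) eq_sym (negbTE bc).
  have := iA f; rewrite !sum_fset3 // fa fb fc.
  have -> : - (u + v) + u + v = 0 by ring.
  have -> : - (u + v) *: a + u *: b + v *: c = 0.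
    by rewrite -[RHS]h; apply: row2P; rewrite !rvE; ring.
  move=> /(_ erefl erefl) h0; rewrite -fb -fc.
  by rewrite !h0 // !inE eqxx ?orbT.
(* When the determinant vanishes, the coordinates of [c - a] and [b - a] themselves are the
   coefficients of two linear relations between these vectors; independence then makes [b - a]
   vanish. *)
have r0 : (b 0 i0 - a 0 i0) = 0 /\ (b 0 i1 - a 0 i1) = 0.
  have h0 := key (c 0 i0 - a 0 i0) (- (b 0 i0 - a 0 i0)).
  have h1 := key (c 0 i1 - a 0 i1) (- (b 0 i1 - a 0 i1)).
  move: d0; rewrite /det => d0.
  have [_ e0] : c 0 i0 - a 0 i0 = 0 /\ - (b 0 i0 - a 0 i0) = 0.
    by apply: h0; apply: row2P; rewrite !rvE; lra.
  have [_ e1] : c 0 i1 - a 0 i1 = 0 /\ - (b 0 i1 - a 0 i1) = 0.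
    by apply: h1; apply: row2P; rewrite !rvE; lra.
  by split; lra.
by move/eqP: ab; apply; apply: row2P; lra.
Qed.

(** Affinely independent points of the plane have linearly independent lifts to three-dimensional
    space. *)
Lemma affinely_independent_card (A : {fset point}) : affinely_independent A -> (#|` A| <= 3)%N.
Proof.
move=> iA; rewrite leqNgt; apply/negP => A4.
pose M : 'M[R]_(#|` A|, 3) := \matrix_(i, j) embed (nth 0 (enum_fset A) i) 0 j.
have : ~~ row_free M by rewrite /row_free neq_ltn (leq_ltn_trans (rank_leq_col _) A4).
move/negP; apply; apply: inj_row_free => u uM.
pose c x := if insub (index x (enum_fset A)) is Some i then u 0 i else 0.
have cE (i : 'I_#|` A|) : c (nth 0 (enum_fset A) i) = u 0 i.
  by rewrite /c index_uniq ?fset_uniq // valK.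
have sE (V : nmodType) (F : point -> V) :
    \sum_(a <- A) F a = \sum_(i < #|` A|) F (nth 0 (enum_fset A) i).
  by rewrite (big_nth 0) big_mkord.
have uME j : \sum_(i < #|` A|) u 0 i * embed (nth 0 (enum_fset A) i) 0 j = 0.
  have : (u *m M) 0 j = 0 by rewrite uM rv0.
  rewrite mxE => e; rewrite -[RHS]e; apply: eq_bigr => i _.
  by rewrite [M _ _]mxE.
have c0 : forall a, a \in A -> c a = 0.
  apply: iA.
    by rewrite sE -[RHS](uME o2); apply: eq_bigr => i _; rewrite cE embedE mulr1.
  rewrite sE; apply: row2P; rewrite summxE rv0.
    by rewrite -[RHS](uME o0); apply: eq_bigr => i _; rewrite cE embedE rvE.
  by rewrite -[RHS](uME o1); apply: eq_bigr => i _; rewrite cE embedE rvE.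
by apply/rowP => i; rewrite -cE rv0; apply: c0; exact: mem_nth.
Qed.

Lemma det_open_conv_edge a b x : a != b -> open_conv [fset a; b]%fset x -> det a b x = 0.
Proof. by move=> ab /(open_conv2P _ ab)[t _ ->]; rewrite det_affine det_l det_r; ring. Qed.

Lemma det_conv_edge a b x : a != b -> conv [fset a; b]%fset x -> det a b x = 0.
Proof. by move=> ab /(conv2P _ ab)[t _ ->]; rewrite det_affine det_l det_r; ring. Qed.

Lemma bary_edge a b c t : det a b c != 0 ->
  [/\ bary a b c ((1 - t) *: a + t *: b) = 1 - t,
      bary b c a ((1 - t) *: a + t *: b) = t
    & bary c a b ((1 - t) *: a + t *: b) = 0].
Proof.
move=> d; have s : (1 - t) + t + 0 = 1 by ring.
by have := bary_of_comb d s; rewrite scale0r addr0.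
Qed.

(** At a point of the open edge the barycentric coordinates of [a] and [b] are positive and stay so
    nearby; only the sign of the third, the side of the edge, remains to be checked. *)
Lemma near_edge_triangle a b c x : det a b c != 0 -> open_conv [fset a; b]%fset x ->
  \forall y \near x, 0 <= det a b y * det a b c -> conv [fset a; b; c]%fset y.
Proof.
move=> d; have [ab _ _] := det_neq d => /(open_conv2P _ ab)[t /andP[t0 t1] xE].
have [ba bb bc] := bary_edge t d; rewrite -xE in ba bb bc.
have na : \forall y \near x, 0 < bary a b c y.
  by apply: (cvgr_gt _ (@bary_continuous a b c x)); rewrite ba subr_gt0.
have nb : \forall y \near x, 0 < bary b c a y.
  by apply: (cvgr_gt _ (@bary_continuous b c a x)); rewrite bb.
near=> y => dy; apply/tri_convP => //; split.
- by apply: ltW; near: y.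
- by apply: ltW; near: y.
rewrite /bary (_ : det a b y / det a b c = (det a b y * det a b c) / det a b c ^+ 2).
  by rewrite divr_ge0 // sqr_ge0.
by rewrite expr2 invfM mulrA mulfK.
Unshelve. all: by end_near.
Qed.

Lemma near_open_triangle a b c x : det a b c != 0 -> open_conv [fset a; b; c]%fset x ->
  \forall y \near x, open_conv [fset a; b; c]%fset y.
Proof.
move=> d /(tri_open_convP _ d)[h1 h2 h3].
have n1 : \forall y \near x, 0 < bary a b c y.
  by apply: (cvgr_gt _ (@bary_continuous a b c x)).
have n2 : \forall y \near x, 0 < bary b c a y.
  by apply: (cvgr_gt _ (@bary_continuous b c a x)).
have n3 : \forall y \near x, 0 < bary c a b y.
  by apply: (cvgr_gt _ (@bary_continuous c a b x)).
by near=> y; apply/tri_open_convP => //; split; near: y.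
Unshelve. all: by end_near.
Qed.

(** The common point is obtained from the midpoint of [ab] by a small move towards [c]. *)
Lemma same_side_overlap a b c d : 0 < det a b c * det a b d ->
  exists p, [/\ conv [fset a; b; c]%fset p, conv [fset a; b; d]%fset p & det a b p != 0].
Proof.
move=> cd; have dc : det a b c != 0 by apply: contraTneq cd => ->; rewrite mul0r ltxx.
have dd : det a b d != 0 by apply: contraTneq cd => ->; rewrite mulr0 ltxx.
have [ab ac bc] := det_neq dc.
pose m := (1 - 2^-1) *: a + 2^-1 *: b.
have om : open_conv [fset a; b]%fset m by apply/open_conv2P => //; exists 2^-1 => //; lra.
have := near_edge_triangle dd om; move=> /nbhs_ballP[e /= e0 he].
have cseg : (fun t : R => (1 - t) *: m + t *: c) @ nbhs (0 : R) --> (1 - 0) *: m + (0 : R) *: c.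
  apply: cvgD; last exact: scalel_continuous.
  have h : (fun t : R => 1 - t) @ nbhs (0 : R) --> (1 - 0 : R) by apply: cvgB; [exact: cvg_cst|exact: cvg_id].
  exact: (cvg_comp _ _ h (@scalel_continuous _ _ m _)).
rewrite subr0 scale1r scale0r addr0 in cseg.
have : \forall t \near (0 : R), ball m e ((1 - t) *: m + t *: c).
  by apply: cseg; exact: nbhsx_ballx.
move=> /nbhs_ballP[r /= r0 hr].
pose t := Num.min (r / 2) (1 / 2).
have t0 : 0 < t by rewrite lt_min !divr_gt0.
have t1 : t <= 1 / 2 by rewrite ge_min lexx orbT.
have tr : t < r by apply: le_lt_trans (_ : r / 2 < r); [rewrite ge_min lexx|lra].
exists ((1 - t) *: m + t *: c); split.
- apply: conv_convex; [|by apply: conv_vertex; rewrite !inE eqxx orbT|exact: ltW|lra].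
  by apply: (conv_sub _ (open_conv_sub om)); apply/fsubsetP => y; rewrite !inE => ->.
- apply: he; last first.
    rewrite det_affine /m det_affine det_l det_r !mulr0 addr0 mulr0 add0r -mulrA.
    by rewrite mulr_ge0 // ltW.
  by apply: hr; rewrite /ball /= sub0r normrN gtr0_norm.
by rewrite det_affine /m det_affine det_l det_r !mulr0 addr0 mulr0 add0r mulf_neq0 // lt0r_neq0.
Qed.

End PlaneTriangles.

Lemma near_all_seq (T : topologicalType) (I : eqType) (s : seq I) (P : I -> T -> Prop) (x : T) :
  (forall i, i \in s -> \forall y \near x, P i y) ->
  \forall y \near x, forall i, i \in s -> P i y.
Proof.
elim: s => [|j s IH] h; first by near=> y.
have h1 := h j (mem_head _ _).
have h2 : \forall y \near x, forall i, i \in s -> P i y.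
  by apply: IH => i si; apply: h; rewrite inE si orbT.
near=> y => i; rewrite inE => /orP[/eqP->|]; first by near: y.
by move: i; near: y.
Unshelve. all: by end_near.
Qed.

(** * Local structure of a plane complex *)

Section ComplexGeometry.
Context {R : realType}.
Local Notation point := 'rV[R]_2.
Context (K : {fset {fset point}}) (hK : simplicial_complex K).
Implicit Types (A B : {fset point}) (a b c d x y : point).

Lemma simplex_neq0 A : A \in K -> A != fset0.
Proof. by case: hK => K0 _ _ _ AK; apply: contraNneq K0 => <-. Qed.

Lemma simplex_indep A : A \in K -> affinely_independent A.
Proof. by case: hK => _ h _ _; exact: h. Qed.

Lemma simplex_face A B : A \in K -> (B `<=` A)%fset -> B != fset0 -> B \in K.
Proof. by case: hK => _ _ h _; exact: h. Qed.

Lemma simplexI A B : A \in K -> B \in K -> conv A `&` conv B = conv (A `&` B)%fset.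
Proof. by case: hK => _ _ _ h; exact: h. Qed.

Lemma simplex_card A : A \in K -> [\/ #|` A| = 1, #|` A| = 2 | #|` A| = 3]%N.
Proof.
move=> AK; have := affinely_independent_card (simplex_indep AK).
have := simplex_neq0 AK; rewrite -cardfs_gt0.
by case: #|` A| => [|[|[|[|]]]] // _ _; [exact: Or31|exact: Or32|exact: Or33].
Qed.

Lemma in_triangles A : (A \in triangles K) = (A \in K) && (#|` A| == 3)%N.
Proof. by rewrite !inE. Qed.

Lemma in_edges A : (A \in edges K) = (A \in K) && (#|` A| == 2)%N.
Proof. by rewrite !inE. Qed.

Lemma in_vertices x : (x \in vertices K) = ([fset x]%fset \in K).
Proof.
rewrite !inE /= andb_idl // => xK; apply/bigfcupP.
by exists [fset x]%fset; rewrite ?xK // inE.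
Qed.

Lemma simplex_vertex A a : A \in K -> a \in A -> a \in vertices K.
Proof.
move=> AK aA; rewrite in_vertices; apply: (simplex_face AK); first by rewrite fsub1set.
by apply/fset0Pn; exists a; rewrite inE.
Qed.

Lemma triangle_det a b c : a != b -> a != c -> b != c -> [fset a; b; c]%fset \in K -> det a b c != 0.
Proof. by move=> ab ac bc /simplex_indep; exact: affinely_independent_det. Qed.

Lemma triangle_split A a : A \in triangles K -> a \in A ->
  exists b c, det a b c != 0 /\ A = [fset a; b; c]%fset.
Proof.
rewrite in_triangles => /andP[AK /eqP A3] aA.
have [b [c [ab ac bc AE]]] := fset3_split A3 aA.
by exists b, c; split=> //; apply: triangle_det => //; rewrite -AE.
Qed.

Lemma triangle_edge A a b : A \in triangles K -> a != b -> ([fset a; b] `<=` A)%fset ->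
  exists c, det a b c != 0 /\ A = [fset a; b; c]%fset.
Proof.
rewrite in_triangles => /andP[AK /eqP A3] ab sA.
have [c /andP[ac bc] AE] := fset3_edge A3 ab sA.
by exists c; split=> //; apply: triangle_det => //; rewrite -AE.
Qed.

Lemma triangle_in_K A : A \in triangles K -> A \in K.
Proof. by rewrite in_triangles => /andP[]. Qed.

Lemma triangle_faces A a b c : A \in triangles K -> A = [fset a; b; c]%fset -> det a b c != 0 ->
  [/\ [fset a; b]%fset \in edges K, [fset a; c]%fset \in edges K & [fset b; c]%fset \in edges K].
Proof.
move=> AT AE d; have [ab ac bc] := det_neq d.
have AK := triangle_in_K AT.
have sub u v : u \in A -> v \in A -> u != v -> [fset u; v]%fset \in edges K.
  move=> uA vA uv; rewrite in_edges cardfs2 uv eqxx andbT; apply: (simplex_face AK).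
    by apply/fsubsetP => w; rewrite !inE => /orP[] /eqP->.
  by apply/fset0Pn; exists u; rewrite !inE eqxx.
by split; apply: sub; rewrite // AE !inE eqxx ?orbT.
Qed.

Lemma edge_split A a : A \in edges K -> a \in A -> exists2 b, a != b & A = [fset a; b]%fset.
Proof. by rewrite in_edges => /andP[_ /eqP A2]; exact: fset2_split. Qed.

Lemma edge_split0 A : A \in edges K -> exists a b, a != b /\ A = [fset a; b]%fset.
Proof.
move=> AE; move: (AE); rewrite in_edges => /andP[_ /eqP A2].
have [a aA] : exists a, a \in A by apply/fset0Pn; rewrite -cardfs_gt0 A2.
by have [b ab ->] := edge_split AE aA; exists a, b.
Qed.

Lemma carrier_sub A B x : A \in K -> B \in K -> open_conv B x -> conv A x -> (B `<=` A)%fset.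
Proof.
move=> AK BK; apply: carrier_subset; first exact: simplex_indep.
by rewrite simplexI.
Qed.

Lemma carrier_exists A x : A \in K -> conv A x ->
  exists B, [/\ B \in K, (B `<=` A)%fset & open_conv B x].
Proof.
move=> AK /conv_carrier[B [BA B0 Bx]]; exists B; split=> //.
exact: simplex_face BA B0.
Qed.

Lemma conv_vertex_mem A a : A \in K -> a \in vertices K -> conv A a -> a \in A.
Proof.
move=> AK aV Aa; rewrite -fsub1set; apply: (carrier_sub AK _ _ Aa); first by rewrite -in_vertices.
exists (fun=> 1); split=> //; rewrite big_seq_fset1 ?scale1r //.
Qed.

Lemma support_closed : closed (support K).
Proof. by apply: closed_bigcup; [exact: finite_fset|move=> A _; exact: conv_closed]. Qed.

(** There are finitely many simplices and each is closed, so those that miss [x] miss a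
    neighbourhood of it. *)
Lemma local_simplices x : \forall y \near x, forall A, A \in K -> conv A y -> conv A x.
Proof.
apply: near_all_seq => A AK; have [Ax|Ax] := pselect (conv A x); first by near=> y.
have : nbhs x (~` conv A).
  by apply: open_nbhs_nbhs; split=> //; apply: closed_openC; exact: conv_closed.
by apply: filterS => y nA /nA.
Unshelve. all: by end_near.
Qed.

Lemma interior_faceP A : A \in K ->
  interior_face K A <-> exists2 x, conv A x & (support K)° x.
Proof.
move=> AK; split.
  move=> h; apply: contrapT => h'; apply: h => x Ax; split.
    by apply: subset_closure; exists A.
  by move=> ix; apply: h'; exists x.
by move=> [x Ax ix] h; have [_] := h x Ax.
Qed.

Lemma in_interior_edges A : (A \in interior_edges K) = (A \in edges K) && `[< interior_face K A >].
Proof. by rewrite !inE. Qed.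

Lemma interior_edge_edge A : A \in interior_edges K -> A \in edges K.
Proof. by rewrite in_interior_edges => /andP[]. Qed.

Lemma edge_in_K A : A \in edges K -> A \in K.
Proof. by rewrite in_edges => /andP[]. Qed.

(** On the same side the triangles would share a point off the line [ab], whereas in a complex they
    meet only in the hull of their common vertices. *)
Lemma opposite_sides a b c d : [fset a; b; c]%fset \in triangles K ->
  [fset a; b; d]%fset \in triangles K -> det a b c != 0 -> det a b d != 0 -> c != d ->
  det a b c * det a b d < 0.
Proof.
move=> cT dT dc dd cd; have [ab ac bc] := det_neq dc; have [_ ad bd] := det_neq dd.
rewrite ltNge le0r negb_or mulf_neq0 //=; apply/negP => h.
have [p [cp dp /eqP]] := same_side_overlap h; apply.
have : conv [fset a; b]%fset p.
  have : (conv [fset a; b; c]%fset `&` conv [fset a; b; d]%fset) p by split.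
  rewrite simplexI ?triangle_in_K //; apply: conv_sub.
  apply/fsubsetP => y; rewrite !inE => /andP[/orP[-> //|/eqP->]].
  by rewrite (eq_sym c a) (negbTE ac) (eq_sym c b) (negbTE bc) (negbTE cd).
exact: det_conv_edge.
Qed.

Lemma triangle_interior A x : A \in triangles K -> open_conv A x -> (support K)° x.
Proof.
move=> AT Ax; have AK := triangle_in_K AT.
have [a aA] := fset0Pn _ (simplex_neq0 AK).
have [b [c [d AE]]] := triangle_split AT aA.
move: Ax; rewrite AE => /(near_open_triangle d).
apply: filterS => y Ay; exists [fset a; b; c]%fset; first by rewrite /= -AE.
exact: open_conv_sub.
Qed.

Lemma near_two_triangles a b c d x : [fset a; b; c]%fset \in triangles K ->
  [fset a; b; d]%fset \in triangles K -> det a b c != 0 -> det a b d != 0 -> c != d ->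
  open_conv [fset a; b]%fset x ->
  \forall y \near x, conv [fset a; b; c]%fset y \/ conv [fset a; b; d]%fset y.
Proof.
move=> cT dT dc dd cd ox; have op := opposite_sides cT dT dc dd cd.
have nc := near_edge_triangle dc ox; have nd := near_edge_triangle dd ox.
near=> y; have [h|h] := leP 0 (det a b y * det a b c).
  by left; move: h; near: y.
right; have : 0 <= det a b y * det a b d; last by near: y.
move: h op; have [d0|d0] := ltrP 0 (det a b c).
  rewrite pmulr_llt0 // pmulr_rlt0 // => h1 h2.
  by rewrite mulr_le0 // ltW.
have {}d0 : det a b c < 0 by rewrite lt_neqAle dc.
by rewrite nmulr_llt0 // nmulr_rlt0 // => h1 h2; rewrite mulr_ge0 // ltW.
Unshelve. all: by end_near.
Qed.

Lemma mid_open_conv a b : a != b -> open_conv [fset a; b]%fset ((1 - 2^-1) *: a + 2^-1 *: b).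
Proof. by move=> ab; apply/open_conv2P => //; exists 2^-1 => //; lra. Qed.

Lemma two_triangles_interior A B a b : A \in triangles K -> B \in triangles K -> A != B ->
  a != b -> ([fset a; b] `<=` A)%fset -> ([fset a; b] `<=` B)%fset ->
  forall x, open_conv [fset a; b]%fset x -> (support K)° x.
Proof.
move=> AT BT AB ab sA sB x ox.
have [c [dc AE]] := triangle_edge AT ab sA; have [d [dd BE]] := triangle_edge BT ab sB.
have cd : c != d by apply: contraNneq AB => cd; rewrite AE BE cd.
rewrite AE in AT; rewrite BE in BT.
have := near_two_triangles AT BT dc dd cd ox.
apply: filterS => y [] h; [exists [fset a; b; c]%fset|exists [fset a; b; d]%fset] => //=;
  exact: triangle_in_K.
Qed.

Lemma two_triangles_interior_edge A B a b : A \in triangles K -> B \in triangles K -> A != B ->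
  a != b -> ([fset a; b] `<=` A)%fset -> ([fset a; b] `<=` B)%fset ->
  [fset a; b]%fset \in interior_edges K.
Proof.
move=> AT BT AB ab sA sB; have om := mid_open_conv ab.
have EK : [fset a; b]%fset \in edges K.
  have [c [dc AE]] := triangle_edge AT ab sA.
  by have [] := triangle_faces AT AE dc.
rewrite in_interior_edges EK; apply/asboolP/(interior_faceP (edge_in_K EK)).
exists ((1 - 2^-1) *: a + 2^-1 *: b); first exact: open_conv_sub.
exact: two_triangles_interior AT BT AB ab sA sB _ om.
Qed.

(** The point of the edge interior to the support may be an endpoint; the interior is open, so a
    slight move towards the midpoint repairs this. *)
Lemma interior_edge_open a b : a != b -> [fset a; b]%fset \in interior_edges K ->
  exists2 x, open_conv [fset a; b]%fset x & (support K)° x.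
Proof.
move=> ab; rewrite in_interior_edges => /andP[EK /asboolP/(interior_faceP (edge_in_K EK))[x]].
move=> /(conv2P _ ab)[t /andP[t0 t1] xE] ix.
pose m := (1 - 2^-1) *: a + 2^-1 *: b.
have cseg : (fun u : R => (1 - u) *: x + u *: m) @ nbhs (0 : R) --> (1 - 0) *: x + (0 : R) *: m.
  apply: cvgD; last exact: scalel_continuous.
  have h : (fun t : R => 1 - t) @ nbhs (0 : R) --> (1 - 0 : R) by apply: cvgB; [exact: cvg_cst|exact: cvg_id].
  exact: (cvg_comp _ _ h (@scalel_continuous _ _ x _)).
rewrite subr0 scale1r scale0r addr0 in cseg.
have : \forall u \near (0 : R), (support K)° ((1 - u) *: x + u *: m).
  apply: cseg; apply: open_nbhs_nbhs; split=> //; exact: open_interior.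
move=> /nbhs_ballP[e /= e0 he]; pose u := Num.min (e / 2) (1 / 2).
have u0 : 0 < u by rewrite lt_min !divr_gt0.
have u1 : u <= 1 / 2 by rewrite ge_min lexx orbT.
have ue : u < e by apply: le_lt_trans (_ : e / 2 < e); [rewrite ge_min lexx|lra].
exists ((1 - u) *: x + u *: m); last first.
  by apply: he; rewrite /ball /= sub0r normrN gtr0_norm.
apply/open_conv2P => //; exists ((1 - u) * t + u / 2).
  apply/andP; split.
    by apply: ltr_wpDl; [apply: mulr_ge0 => //; lra|rewrite divr_gt0].
  have : (1 - u) * t <= (1 - u) * 1 by apply: ler_wpM2l => //; lra.
  lra.
by rewrite xE /m; apply: row2P; rewrite !rvE; field.
Qed.

(** A small step off the edge, to the side given by [e], stays in the support. The simplex reached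
    passes through [x], so it contains the edge, and having a point off the line it is a triangle on
    that side. *)
Lemma interior_edge_triangle a b (e : R) : a != b -> [fset a; b]%fset \in interior_edges K ->
  e != 0 -> exists c, [/\ [fset a; b; c]%fset \in triangles K, det a b c != 0 & 0 < e * det a b c].
Proof.
move=> ab EI e0; have [x ox ix] := interior_edge_open ab EI.
have EK := edge_in_K (interior_edge_edge EI).
(* [n] is [b - a] turned by a right angle and scaled by [e] over its squared length, so that a step
   by [u *: n] changes [det a b] by [u * e]. *)
have [n [n0 n1]] : exists n : point, det a b (a + n) = e /\ True.
  pose q := (b 0 i0 - a 0 i0) ^+ 2 + (b 0 i1 - a 0 i1) ^+ 2.
  have q0 : q != 0.
    apply/eqP => q0; move/eqP: ab; apply; move/eqP: q0.
    rewrite paddr_eq0 ?sqr_ge0 // !sqrf_eq0 => /andP[/eqP h0 /eqP h1].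
    by apply: row2P; apply/eqP; rewrite -subr_eq0 -opprB oppr_eq0 ?h0 ?h1.
  exists (\row_i (if i == i0 then - (e / q * (b 0 i1 - a 0 i1)) else e / q * (b 0 i0 - a 0 i0))).
  split=> //; rewrite /det !rvE !mxE /= -[RHS](mulfVK q0) /q; ring.
have cseg : (fun u : R => u *: n + x) @ nbhs (0 : R) --> (0 : R) *: n + x.
  by apply: cvgD; [exact: scalel_continuous|exact: cvg_cst].
rewrite scale0r add0r in cseg.
have hx : nbhs x [set y | support K y /\ (forall A, A \in K -> conv A y -> conv A x)].
  by apply: filterI; [exact: ix|exact: local_simplices].
have := cseg _ hx.
move=> /nbhs_ballP[r /= r0 hr].
have [] := hr (r / 2); first by rewrite /ball /= sub0r normrN gtr0_norm ?divr_gt0 //; lra.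
set y := _ + x => -[A /= AK Ay] loc.
have Ax := loc A AK Ay; have sA := carrier_sub AK EK ox Ax.
have dy : det a b y = r / 2 * e.
  have h0 := det_open_conv_edge ab ox; rewrite /y -n0; move: h0; rewrite /det !rvE => h0.
  by rewrite -[RHS]addr0 -h0; ring.
have dy0 : 0 < e * det a b y.
  by rewrite dy mulrCA mulr_gt0 ?divr_gt0 // lt0r mulf_neq0 //= -expr2 sqr_ge0.
have A3 : A \in triangles K.
  rewrite in_triangles AK; case: (simplex_card AK) => [A1|A2|->//].
    by have := fsubset_leq_card sA; rewrite cardfs2 ab A1.
  have AE : A = [fset a; b]%fset.
    by apply/esym/eqP; rewrite eqEfcard sA A2 cardfs2 ab.
  move: Ay dy0; rewrite AE => /(det_conv_edge ab)->.
  by rewrite mulr0 ltxx.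
have [c [dc AE]] := triangle_edge A3 ab sA.
exists c; rewrite -AE; split=> //.
move: Ay; rewrite AE => /(tri_convP _ dc)[_ _]; rewrite /bary => h.
have h' : 0 <= det a b y * det a b c.
  have -> : det a b y * det a b c = (det a b y / det a b c) * det a b c ^+ 2.
    by rewrite expr2 mulrA divfK.
  by rewrite mulr_ge0 // sqr_ge0.
have yN0 : det a b y != 0 by apply: contraTneq dy0 => ->; rewrite mulr0 ltxx.
have h'' : 0 < det a b y * det a b c by rewrite lt0r mulf_neq0.
have := mulr_gt0 dy0 h''.
have -> : e * det a b y * (det a b y * det a b c) = (e * det a b c) * det a b y ^+ 2 by ring.
by rewrite pmulr_lgt0 // lt0r sqrf_eq0 yN0 sqr_ge0.
Qed.

(** A third triangle on the edge would lie opposite to both of the others, which are themselves on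
    different sides. *)
Lemma interior_edge_pair a b : a != b -> [fset a; b]%fset \in interior_edges K ->
  exists c d, [/\ [fset a; b; c]%fset \in triangles K, [fset a; b; d]%fset \in triangles K,
    0 < det a b c, det a b d < 0 &
    forall A, A \in triangles K -> ([fset a; b] `<=` A)%fset ->
      A = [fset a; b; c]%fset \/ A = [fset a; b; d]%fset].
Proof.
move=> ab EI.
have [c [cT dc]] := interior_edge_triangle ab EI (oner_neq0 _); rewrite mul1r => c0.
have N1 : (-1 : R) != 0 by rewrite oppr_eq0 oner_eq0.
have [d [dT dd]] := interior_edge_triangle ab EI N1; rewrite mulN1r oppr_gt0 => d0.
exists c, d; split=> // A AT sA.
have [x [dx AE]] := triangle_edge AT ab sA; rewrite AE in AT.
have [xc|xc] := eqVneq x c; first by left; rewrite AE xc.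
have [xd|xd] := eqVneq x d; first by right; rewrite AE xd.
have := opposite_sides AT cT dx dc xc; have := opposite_sides AT dT dx dd xd.
by rewrite nmulr_llt0 // pmulr_llt0 // => h1 h2; have := lt_trans h1 h2; rewrite ltxx.
Qed.

Lemma in_interior_vertices x : (x \in interior_vertices K) =
  (x \in vertices K) && `[< (support K)° x >].
Proof.
have -> : (x \in interior_vertices K) =
    (x \in vertices K) && `[< interior_face K [fset x]%fset >] by rewrite !inE.
case xV: (x \in vertices K) => //=; apply/asboolP/asboolP.
  move=> /interior_faceP[|y]; first by rewrite -in_vertices.
  by move=> [l [_]]; rewrite !big_seq_fset1 => -> ->; rewrite scale1r.
move=> ix; apply/interior_faceP; first by rewrite -in_vertices.
by exists x => //; apply: conv_vertex; rewrite inE.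
Qed.

Lemma interior_vertex_edge A x : x \in interior_vertices K -> A \in edges K -> x \in A ->
  A \in interior_edges K.
Proof.
rewrite in_interior_vertices => /andP[_ /asboolP ix] AE xA; rewrite in_interior_edges AE.
apply/asboolP/interior_faceP; first exact: edge_in_K.
by exists x => //; exact: conv_vertex.
Qed.

End ComplexGeometry.

Lemma set_type_nbhsP (T : topologicalType) (A : set T) (x : A) (P : set A) :
  nbhs x P <-> exists2 V, nbhs (val x) V & forall y : A, V (val y) -> P y.
Proof.
split.
  case=> _ /= [] [W oW <- /= Wx sWU]; exists W.
    by apply: open_nbhs_nbhs; split.
  by move=> y Wy; apply: sWU.
move=> [V Vx VP]; apply: filterS VP _.
exact: (@initial_continuous A T set_val x).
Qed.

Lemma connected_of_pairs (T : topologicalType) (A : set T) :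
  (forall x y, A x -> A y -> exists B, [/\ B `<=` A, connected B, B x & B y]) -> connected A.
Proof.
move=> h; have [->|/set0P[x Ax]] := eqVneq A set0; first exact: connected0.
have /choice[B hB] : forall y, exists B, A y -> [/\ B `<=` A, connected B, B x & B y].
  by move=> y; have [Ay|nAy] := pselect (A y); [have [B ?] := h x y Ax Ay; exists B|exists set0].
have -> : A = \bigcup_(y in A) B y.
  apply/seteqP; split=> y; first by move=> Ay; exists y => //; have [] := hB y Ay.
  by move=> [z Az Bzy]; have [sB _ _ _] := hB z Az; exact: sB.
apply: bigcup_connected; first by exists x => y Ay; have [] := hB y Ay.
by move=> y Ay; have [] := hB y Ay.
Qed.

(** * Topology of the disk *)

Section Punctured.
Context {R : realType}.
Local Notation point := 'rV[R]_2.
Implicit Types (C : set point) (a b x y p q : point).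

Definition convex_set C := forall x y t, C x -> C y -> 0 <= t -> t <= 1 -> C ((1 - t) *: x + t *: y).

Lemma ball_convex p e : convex_set (ball p e).
Proof.
move=> x y t; rewrite -ball_normE /= => xe ye t0 t1.
have -> : p - ((1 - t) *: x + t *: y) = (1 - t) *: (p - x) + t *: (p - y).
  by apply: row2P; rewrite !rvE; ring.
apply: le_lt_trans (ler_normD _ _) _; rewrite !normrZ (ger0_norm t0) ger0_norm ?subr_ge0 //.
have [->|tN] := eqVneq t 1; first by rewrite subrr mul0r add0r mul1r.
have t1' : t < 1 by rewrite lt_neqAle tN.
have -> : e = (1 - t) * e + t * e by ring.
by apply: ltr_leD; [rewrite ltr_pM2l // subr_gt0|rewrite ler_wpM2l // ltW].
Qed.

Lemma convexI C D : convex_set C -> convex_set D -> convex_set (C `&` D).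
Proof. by move=> hC hD x y t [Cx Dx] [Cy Dy] t0 t1; split; [exact: hC|exact: hD]. Qed.

Lemma segment_cvg a b (t0 : R) :
  (fun t : R => (1 - t) *: a + t *: b) @ nbhs t0 --> (1 - t0) *: a + t0 *: b.
Proof.
apply: cvgD; last exact: scalel_continuous.
have h : (fun t : R => 1 - t) @ nbhs t0 --> 1 - t0 by apply: cvgB; [exact: cvg_cst|exact: cvg_id].
exact: (cvg_comp _ _ h (@scalel_continuous _ _ a _)).
Qed.

Definition seg a b : set point := [set x | exists2 t, 0 <= t <= 1 & x = (1 - t) *: a + t *: b].

Lemma seg_connected a b : connected (seg a b).
Proof.
have -> : seg a b = (fun t : R => (1 - t) *: a + t *: b) @` `[0, 1]%classic.
  by apply/seteqP; split=> x /= [t]; rewrite ?in_itv /= => t01 h; exists t => //; rewrite in_itv.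
apply: connected_continuous_connected; first exact: segment_connected.
by apply: continuous_subspaceT => t; exact: segment_cvg.
Qed.

Lemma segl a b : seg a b a. Proof. by exists 0; rewrite ?lexx ?ler01 // subr0 scale1r scale0r addr0. Qed.
Lemma segr a b : seg a b b. Proof. by exists 1; rewrite ?lexx ?ler01 // subrr scale1r scale0r add0r. Qed.

Lemma convex_connected C : convex_set C -> connected C.
Proof.
move=> hC; apply: connected_of_pairs => x y Cx Cy; exists (seg x y); split.
- by move=> _ [t /andP[t0 t1] ->]; exact: hC.
- exact: seg_connected.
- exact: segl.
- exact: segr.
Qed.

Definition det_poly a b : mpoly 2 R :=
  (b 0 i0 - a 0 i0) *: (Xv i1 - mpolyC 2 (a 0 i1)) - (b 0 i1 - a 0 i1) *: (Xv i0 - mpolyC 2 (a 0 i0)).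

Lemma peval_det_poly a b x : peval (det_poly a b) x = det a b x.
Proof. by rewrite !(pevalB, pevalZ, pevalX, pevalC). Qed.

Lemma det_poly_neq0 a b : a != b -> det_poly a b != 0.
Proof.
move=> ab; apply: contraNneq ab => h.
pose x : point := \row_i (if i == i0 then a 0 i0 - (b 0 i1 - a 0 i1) else a 0 i1 + (b 0 i0 - a 0 i0)).
have : det a b x = 0 by rewrite -peval_det_poly h -(mpolyC0 2) pevalC.
rewrite /det !mxE /= => e.
have {}e : (b 0 i0 - a 0 i0) ^+ 2 + (b 0 i1 - a 0 i1) ^+ 2 = 0 by rewrite -[RHS]e; ring.
move/eqP: e; rewrite paddr_eq0 ?sqr_ge0 // !sqrf_eq0 !subr_eq0 => /andP[/eqP h0 /eqP h1].
by apply/eqP; apply: row2P.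
Qed.

(** Otherwise [P * Q] vanishes near [q], hence identically, and one of the factors is zero. *)
Lemma nbhs_off_lines q C (P Q : mpoly 2 R) : nbhs q C -> P != 0 -> Q != 0 ->
  exists2 c, C c & (peval P c != 0) && (peval Q c != 0).
Proof.
move=> Cq P0 Q0; apply: contrapT => h.
have : P * Q = 0.
  apply: (@peval_eq0_near _ _ _ q) => v.
  have cv : (fun t : R => t *: v + q) @ nbhs (0 : R) --> (0 : R) *: v + q.
    by apply: cvgD; [exact: scalel_continuous|exact: cvg_cst].
  rewrite scale0r add0r in cv; have /nbhs_ballP[e /= e0 he] := cv _ Cq.
  exists (e / 2); first by rewrite divr_gt0.
  move=> t t0 te; apply/eqP; rewrite pevalM; apply/negPn/negP; rewrite mulf_eq0 negb_or => hn.
  apply: h; exists (q + t *: v) => //; rewrite addrC; apply: he.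
  by rewrite /ball /= sub0r normrN gtr0_norm //; lra.
by move/eqP; rewrite mulf_eq0 (negbTE P0) (negbTE Q0).
Qed.

(** Two points are joined by way of a point [c] off their lines through [p], so that neither segment
    to [c] meets [p]. The neighbourhood of [q] is where [c] is found. *)
Lemma convex_punctured_connected C p q : convex_set C -> nbhs q C -> connected (C `\` [set p]).
Proof.
move=> hC Cq; apply: connected_of_pairs => x y [Cx xp] [Cy yp].
have px : p != x by apply/eqP => e; apply: xp; rewrite e.
have py : p != y by apply/eqP => e; apply: yp; rewrite e.
have [c Cc] := nbhs_off_lines Cq (det_poly_neq0 px) (det_poly_neq0 py).
rewrite !peval_det_poly => /andP[hx hy].
have sub z : C z -> det p z c != 0 -> seg z c `<=` C `\` [set p].
  move=> Cz dz _ [t /andP[t0 t1] ->]; split; first exact: hC.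
  move=> /= e; have e0 : (1 - t) * det p z z + t * det p z c = 0.
    by rewrite -det_affine e det_l.
  rewrite det_r mulr0 add0r in e0; move/eqP: e0; rewrite mulf_eq0 (negbTE dz) orbF => /eqP tz.
  by move: dz; rewrite -e tz subr0 scale1r scale0r addr0 /det !subrr !mul0r subrr eqxx.
exists (seg x c `|` seg y c); split.
- by move=> z [] h; [exact: (sub x)|exact: (sub y)].
- apply: connectedU; [|exact: seg_connected|exact: seg_connected].
  by exists c; split; exact: segr.
- by left; exact: segl.
- by right; exact: segl.
Qed.

Lemma disk_convex : convex_set (@unit_disk R).
Proof.
move=> x y t; rewrite /unit_disk /= !big2 /= => hx hy t0 t1; rewrite !rvE.
have key (u v : R) : ((1 - t) * u + t * v) ^+ 2 <= (1 - t) * u ^+ 2 + t * v ^+ 2.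
  rewrite -subr_ge0.
  have -> : (1 - t) * u ^+ 2 + t * v ^+ 2 - ((1 - t) * u + t * v) ^+ 2 = t * (1 - t) * (u - v) ^+ 2 by ring.
  by apply: mulr_ge0; [apply: mulr_ge0 => //; rewrite subr_ge0|exact: sqr_ge0].
apply: le_trans (lerD (key _ _) (key _ _)) _.
have h1 : (1 - t) * (x 0 i0 ^+ 2 + x 0 i1 ^+ 2) <= (1 - t) * 1 by apply: ler_wpM2l => //; rewrite subr_ge0.
have h2 : t * (y 0 i0 ^+ 2 + y 0 i1 ^+ 2) <= t * 1 by exact: ler_wpM2l.
lra.
Qed.

Lemma disk_scale x t : @unit_disk R x -> 0 <= t -> t <= 1 -> @unit_disk R (t *: x).
Proof.
move=> Dx t0 t1; have D0 : @unit_disk R 0 by rewrite /unit_disk /= big2 /= !rv0 expr0n /= addr0 ler01.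
by have := disk_convex D0 Dx t0 t1; rewrite scaler0 add0r.
Qed.

Lemma disk_nbhs x t : @unit_disk R x -> 0 <= t -> t < 1 -> nbhs (t *: x) (@unit_disk R).
Proof.
move=> Dx t0 t1.
pose N : mpoly 2 R := Xv i0 ^+ 2 + Xv i1 ^+ 2.
have NE y : peval N y = y 0 i0 ^+ 2 + y 0 i1 ^+ 2 by rewrite pevalD !pevalXn !pevalX.
have lt1 : peval N (t *: x) < 1.
  rewrite NE !rvE; move: Dx; rewrite /unit_disk /= big2 /= => Dx.
  have -> : (t * x 0 i0) ^+ 2 + (t * x 0 i1) ^+ 2 = t ^+ 2 * (x 0 i0 ^+ 2 + x 0 i1 ^+ 2) by ring.
  apply: le_lt_trans (_ : t ^+ 2 * 1 < 1); first by apply: ler_wpM2l => //; exact: sqr_ge0.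
  by rewrite mulr1 expr_lt1.
have : \forall y \near (t *: x), peval N y < 1 by apply: (cvgr_lt _ (@peval_continuous _ _ N (t *: x))).
by apply: filterS => y; rewrite NE /unit_disk /= big2 => /ltW.
Qed.

Lemma disk_compact : compact (@unit_disk R).
Proof.
pose Q : set point := [set v | forall i, `[-1, 1]%classic (v ord0 i)].
pose N : mpoly 2 R := Xv i0 ^+ 2 + Xv i1 ^+ 2.
have NE y : peval N y = y 0 i0 ^+ 2 + y 0 i1 ^+ 2 by rewrite pevalD !pevalXn !pevalX.
have DE : @unit_disk R = Q `&` (peval N @^-1` [set z | z <= 1]).
  apply/seteqP; split=> x; rewrite /unit_disk /= big2 /= NE; last by move=> [].
  move=> h; split=> // i; rewrite /= in_itv /= -ler_norml.
  rewrite -(@ler_pXn2r _ 2) ?nnegrE // expr1n real_normK ?num_real //.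
  move: i; apply: ord2P; have := sqr_ge0 (x 0 i0); have := sqr_ge0 (x 0 i1); lra.
rewrite DE; apply: compact_closedI.
  exact: (@rV_compact R 2 (fun=> `[(-1)%R, 1%R]%classic) (fun=> @segment_compact R (-1) 1)).
by apply: closed_comp; [move=> v _; exact: peval_continuous|exact: closed_le].
Qed.

End Punctured.

Section DiskTopology.
Context {R : realType}.
Local Notation point := 'rV[R]_2.
Local Notation disk := (@unit_disk R).
Context (K : {fset {fset point}}) (hK : simplicial_complex K) (hdisk : disk_complex K).
Local Notation X := (support K).
Implicit Types (A B : {fset point}) (a b c d x y z : point) (V : set point).

(* The homeomorphism and its inverse, extended arbitrarily to maps of the
   plane. *)
Definition disk_chart (F G : point -> point) :=
  [/\ (forall z, disk z -> X (G z)), (forall x, X x -> disk (F x)),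
      (forall z, disk z -> F (G z) = z) & (forall x, X x -> G (F x) = x)] /\
  (forall z V, disk z -> nbhs (G z) V -> \forall z' \near z, disk z' -> V (G z')) /\
  (forall x V, X x -> nbhs (F x) V -> \forall x' \near x, X x' -> V (F x')).

Lemma ext_fun (A B : set point) (f : A -> B) : exists F : point -> point,
  forall x (Ax : A x), F x = val (f (exist _ x (mem_set Ax))).
Proof.
exists (fun x => if pselect (A x) is left Ax then val (f (exist _ x (mem_set Ax))) else 0).
move=> x Ax; case: pselect => // Ax'; congr (val (f _)); exact: val_inj.
Qed.

Lemma ext_fun_near (A B : set point) (f : A -> B) (F : point -> point) :
  (forall x (Ax : A x), F x = val (f (exist _ x (mem_set Ax)))) -> continuous f ->
  forall x V, A x -> nbhs (F x) V -> \forall x' \near x, A x' -> V (F x').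
Proof.
move=> FE cf x V Ax; rewrite (FE x Ax) => nV.
have : nbhs (f (exist _ x (mem_set Ax))) [set y : B | V (val y)].
  by apply/set_type_nbhsP; exists V.
move=> /(cf _)/set_type_nbhsP[W /= Wx WP]; apply: filterS Wx => x' Wx' Ax'.
rewrite (FE x' Ax'); exact: WP.
Qed.

Lemma disk_chart_exists : exists F G, disk_chart F G.
Proof.
have [f [g [cf cg fK gK]]] := hdisk.
have [F FE] := ext_fun f; have [G GE] := ext_fun g.
exists F, G; split; last by split=> [z V|x V]; [exact: ext_fun_near GE cg z V|exact: ext_fun_near FE cf x V].
split.
- by move=> z Dz; rewrite (GE z Dz); exact: set_valP.
- by move=> x Xx; rewrite (FE x Xx); exact: set_valP.
- move=> z Dz; have XG : X (G z) by rewrite (GE z Dz); exact: set_valP.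
  rewrite (FE _ XG) -[RHS]/(val (exist (fun z => z \in disk) z (mem_set Dz))).
  rewrite -[in RHS](gK (exist (fun z => z \in disk) z (mem_set Dz))).
  by congr (val (f _)); apply: val_inj; rewrite /= (GE z Dz).
- move=> x Xx; have DF : disk (F x) by rewrite (FE x Xx); exact: set_valP.
  rewrite (GE _ DF) -[RHS]/(val (exist (fun z => z \in X) x (mem_set Xx))).
  rewrite -[in RHS](fK (exist (fun z => z \in X) x (mem_set Xx))).
  by congr (val (g _)); apply: val_inj; rewrite /= (FE x Xx).
Qed.

Lemma chart_connected F G (C : set point) : disk_chart F G -> C `<=` disk -> connected C ->
  connected (G @` C).
Proof.
move=> [_ [hG _]] CD cC; apply: connected_continuous_connected => //.
apply/subspace_continuousP => z Cz V nV.
have := hG z V (CD z Cz) nV; rewrite /within /=.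
by apply: filterS => z' h Cz'; apply: h; exact: CD.
Qed.

Lemma support_connected : connected X.
Proof.
have [F [G FG]] := disk_chart_exists; have [[GX FD GK FK] _] := FG.
have -> : X = G @` disk.
  apply/seteqP; split=> x; first by move=> Xx; exists (F x); rewrite ?FK //; exact: FD.
  by move=> [z Dz <-]; exact: GX.
by apply: chart_connected FG _ _ => //; apply: convex_connected; exact: disk_convex.
Qed.

(** In the disk a small ball around the image of [x] cuts out a convex set with interior points,
    which stays connected without a point; the chart carries this over, also from points of the unit
    circle. *)
Lemma locally_punctured_connected x V : X x -> nbhs x V ->
  exists W : set point, [/\ W `<=` V `&` X, (\forall y \near x, X y -> W y),
    connected (W `\` [set x]) & closure (W `\` [set x]) x].
Proof.
move=> Xx nV; have [F [G FG]] := disk_chart_exists; have [[GX FD GK FK] [hG hF]] := FG.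
pose y := F x; have Dy : disk y by exact: FD.
have Gy : G y = x by exact: FK.
have : nbhs (G y) V by rewrite Gy.
move=> /(hG y V Dy)/nbhs_ballP[e /= e0 he].
pose C := ball y e `&` disk.
have cC : convex_set C by apply: convexI; [exact: ball_convex|exact: disk_convex].
(* [y] may lie on the unit circle; shrinking it slightly gives a point interior to both the ball and
   the disk. *)
have [q Cq] : exists q : point, nbhs q C.
  have cv : (fun t : R => t *: y) @ nbhs (1 : R) --> (1 : R) *: y by exact: scalel_continuous.
  rewrite scale1r in cv.
  have /nbhs_ballP[r /= r0 hr] := cv _ (nbhsx_ballx y e e0).
  pose u := Num.min (r / 2) (1 / 2).
  have u0 : 0 < u by rewrite lt_min !divr_gt0.
  have u1 : u <= 1 / 2 by rewrite ge_min lexx orbT.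
  have ur : u < r by apply: le_lt_trans (_ : r / 2 < r); [rewrite ge_min lexx|lra].
  exists ((1 - u) *: y); apply: filterI; last by apply: disk_nbhs => //; lra.
  apply: open_nbhs_nbhs; split; first exact: ball_open.
  by apply: hr; rewrite /ball /= opprB addrC subrK gtr0_norm.
have GWE : (G @` C) `\` [set x] = G @` (C `\` [set y]).
  apply/seteqP; split=> z.
    by move=> [[w Cw <-] wx]; exists w => //; split=> // wy; apply: wx; rewrite /= wy.
  move=> [w [Cw wy] <-]; split; first by exists w.
  by move=> /= wx; apply: wy; rewrite /= -(GK w) ?wx //; case: Cw.
exists (G @` C); split.
- by move=> _ [w [bw Dw] <-]; split; [exact: he|exact: GX].
- have := hF x _ Xx (nbhsx_ballx y e e0); apply: filterS => z h Xz.
  by exists (F z); [split; [exact: h|exact: FD]|exact: FK].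
- rewrite GWE; apply: chart_connected FG _ _; first by move=> w [[_ Dw] _].
  exact: convex_punctured_connected Cq.
- rewrite GWE => B nB; have : nbhs (G y) B by rewrite Gy.
  move=> /(hG y B Dy) nB'.
  have [p [Cp py]] : exists p, C p /\ p <> y.
    pose b : point := y + delta_mx 0 i0.
    have yb : y != b.
      by apply/eqP => /(congr1 (fun u : point => u 0 i0)); rewrite /= !rvE mxE /=; lra.
    have [p Cp /andP[hp _]] := nbhs_off_lines Cq (det_poly_neq0 yb) (det_poly_neq0 yb).
    exists p; split=> // py; move: hp; rewrite py peval_det_poly det_l eqxx //.
  have cs := @segment_cvg R y p 0; rewrite subr0 scale1r scale0r addr0 in cs.
  have /nbhs_ballP[r /= r0 hr] := cs _ nB'.
  pose u := Num.min (r / 2) (1 / 2).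
  have u0 : 0 < u by rewrite lt_min !divr_gt0.
  have u1 : u <= 1 / 2 by rewrite ge_min lexx orbT.
  have ur : u < r by apply: le_lt_trans (_ : r / 2 < r); [rewrite ge_min lexx|lra].
  have Cy : C y by split=> //; exact: ballxx.
  have Cu : C ((1 - u) *: y + u *: p) by apply: cC => //; lra.
  exists (G ((1 - u) *: y + u *: p)); split.
    exists ((1 - u) *: y + u *: p) => //; split=> //= e1; apply: py.
    have e2 : u *: (p - y) = 0.
      have -> : u *: (p - y) = ((1 - u) *: y + u *: p) - y by apply: row2P; rewrite !rvE; ring.
      by rewrite e1 subrr.
    by move/eqP: e2; rewrite scaler_eq0 (gt_eqF u0) /= subr_eq0 => /eqP.
  apply: (hr u); last by case: Cu.
  by rewrite /ball /= sub0r normrN gtr0_norm.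
Qed.

End DiskTopology.

(** * Combinatorial consequences of the disk hypothesis *)

Section DiskComplex.
Context {R : realType}.
Local Notation point := 'rV[R]_2.
Context (K : {fset {fset point}}) (hK : simplicial_complex K) (hdisk : disk_complex K).
Local Notation X := (support K).
Implicit Types (A B C : {fset point}) (a b c d x y z : point) (V : set point).

Lemma segment_near x p V : nbhs x V -> exists2 u : R, 0 < u <= 1 / 2 & V ((1 - u) *: x + u *: p).
Proof.
move=> nV; have cs := @segment_cvg R x p 0; rewrite subr0 scale1r scale0r addr0 in cs.
have /nbhs_ballP[r /= r0 hr] := cs _ nV.
pose u := Num.min (r / 2) (1 / 2).
have u0 : 0 < u by rewrite lt_min !divr_gt0.
have ur : u < r by apply: le_lt_trans (_ : r / 2 < r); [rewrite ge_min lexx|lra].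
exists u; first by rewrite u0 ge_min lexx orbT.
by apply: hr; rewrite /ball /= sub0r normrN gtr0_norm.
Qed.

Lemma segment_neq x p (u : R) : 0 < u -> p != x -> (1 - u) *: x + u *: p <> x.
Proof.
move=> u0 px e; move/eqP: px; apply.
have e2 : u *: (p - x) = 0.
  have -> : u *: (p - x) = ((1 - u) *: x + u *: p) - x by apply: row2P; rewrite !rvE; ring.
  by rewrite e subrr.
by move/eqP: e2; rewrite scaler_eq0 (gt_eqF u0) /= subr_eq0 => /eqP.
Qed.

Lemma simplex_closure A x p (E : set point) : A \in K -> conv A x -> conv A p -> p != x ->
  conv A `<=` E -> closure ((X `&` E) `\` [set x]) x.
Proof.
move=> AK Ax Ap px AE V nV; have [u /andP[u0 u1] Vu] := segment_near p nV.
have Au : conv A ((1 - u) *: x + u *: p) by apply: conv_convex => //; lra.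
exists ((1 - u) *: x + u *: p); split=> //; split; last exact: segment_neq.
by split; [exists A|exact: AE].
Qed.

(** Closed sets that cover the support near [x] and meet there at most in [x] would disconnect a
    punctured neighbourhood of [x] if both accumulated at [x]. *)
Lemma no_local_separation x V (E1 E2 : set point) : X x -> nbhs x V -> closed E1 -> closed E2 ->
  (forall y, V y -> X y -> E1 y \/ E2 y) ->
  (forall y, V y -> X y -> E1 y -> E2 y -> y = x) ->
  closure ((X `&` E1) `\` [set x]) x -> closure ((X `&` E2) `\` [set x]) x -> False.
Proof.
move=> Xx nV cE1 cE2 cov dis cl1 cl2.
have [W [sW nW cW _]] := locally_punctured_connected hdisk Xx nV.
have meet E : closure ((X `&` E) `\` [set x]) x -> exists y, [/\ E y, W y & y <> x].
  by move=> cl; have [y [[[Xy Ey] yx] Wy]] := cl _ nW; exists y; split=> //; exact: Wy.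
have [y1 [E1y W1 y1x]] := meet _ cl1; have [y2 [E2y W2 y2x]] := meet _ cl2.
have eq : (W `\` [set x]) `&` E1 = W `\` [set x].
  apply: cW.
  - by exists y1.
  - exists (~` E2); first exact: closed_openC.
    apply/seteqP; split=> y [[Wy yx] Ey]; split=> //.
      by have [Vy Xy] := sW _ Wy; move=> E2y'; apply: yx; exact: dis Vy Xy Ey E2y'.
    by have [Vy Xy] := sW _ Wy; case: (cov y Vy Xy).
  - by exists E1.
have : ((W `\` [set x]) `&` E1) y2 by rewrite eq.
by move=> [_ E1y2]; apply: y2x; have [Vy Xy] := sW _ W2; exact: dis.
Qed.

(** Purity: a maximal vertex would be an isolated point of the support, and the midpoint of a
    maximal edge would separate it locally. *)
Lemma simplex_sub_triangle A : A \in K -> exists2 T, T \in triangles K & (A `<=` T)%fset.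
Proof.
move=> AK.
pose P n := `[< exists B, [/\ B \in K, (A `<=` B)%fset & #|` B| = n] >].
have P0 : exists n, P n by exists #|` A|; apply/asboolP; exists A.
have Pb n : P n -> (n <= 3)%N.
  by move=> /asboolP[B [BK _ <-]]; case: (simplex_card hK BK) => ->.
case: (ex_maxnP P0 Pb) => n /asboolP[B [BK AB Bn]] nmax.
have Bmax C : C \in K -> (B `<=` C)%fset -> C = B.
  move=> CK BC; apply/esym/eqP; rewrite eqEfcard BC Bn; apply: nmax.
  by apply/asboolP; exists C; split=> //; exact: fsubset_trans BC.
have nB x : open_conv B x -> \forall y \near x, X y -> conv B y.
  move=> Bx; apply: filterS (local_simplices K x) => y h [C /= CK Cy].
  by rewrite -(Bmax C CK) //; apply: (carrier_sub hK CK BK Bx); exact: h.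
exists B => //; rewrite in_triangles BK /=; case: (simplex_card hK BK) => [B1|B2|->//].
- move/eqP/cardfs1P: B1 => [b BE]; exfalso.
  have ob : open_conv B b.
    by rewrite BE; exists (fun=> 1); split=> //; rewrite big_seq_fset1 ?scale1r.
  have Xb : X b by exists B => //; exact: open_conv_sub.
  have [W [sW _ _ cl]] := locally_punctured_connected hdisk Xb (nB b ob).
  have [y [[Wy yb] _]] := cl setT filterT.
  have [h Xy] := sW y Wy; apply: yb; have := h Xy; rewrite BE => -[l [_]].
  by rewrite !big_seq_fset1 => -> ->; rewrite scale1r.
- exfalso; have BEd : B \in edges K by rewrite in_edges BK B2.
  have [a [b [ab BE]]] := edge_split0 BEd.
  pose m := (1 - 2^-1) *: a + 2^-1 *: b.
  have om : open_conv B m by rewrite BE; exact: mid_open_conv.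
  have Xm : X m by exists B => //; exact: open_conv_sub.
  (* [L] is the scalar product with [b - a], measured from the midpoint; its sign splits the edge
     into the halves on [E1] and [E2]. *)
  pose L : mpoly 2 R := (b 0 i0 - a 0 i0) *: (Xv i0 - mpolyC 2 (m 0 i0)) +
    (b 0 i1 - a 0 i1) *: (Xv i1 - mpolyC 2 (m 0 i1)).
  have LE y : peval L y = (b 0 i0 - a 0 i0) * (y 0 i0 - m 0 i0) + (b 0 i1 - a 0 i1) * (y 0 i1 - m 0 i1).
    by rewrite /L pevalD !(pevalB, pevalZ, pevalX, pevalC).
  pose q := (b 0 i0 - a 0 i0) ^+ 2 + (b 0 i1 - a 0 i1) ^+ 2.
  have q0 : 0 < q.
    rewrite lt0r addr_ge0 ?sqr_ge0 // andbT; apply: contraNneq ab => /eqP.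
    rewrite paddr_eq0 ?sqr_ge0 // !sqrf_eq0 !subr_eq0 => /andP[/eqP h0 /eqP h1].
    by apply/eqP; apply: row2P.
  have Ls t : peval L ((1 - t) *: a + t *: b) = (t - 2^-1) * q.
    by rewrite LE /m !rvE /q; field.
  pose E1 := peval L @^-1` [set z | z <= 0]; pose E2 := peval L @^-1` [set z | 0 <= z].
  have cl (E : set point) c : conv B c -> c != m ->
      (forall u, 0 <= u -> u <= 1 -> E ((1 - u) *: m + u *: c)) ->
      closure ((X `&` E) `\` [set m]) m.
    move=> Bc cm hE V nV; have [u /andP[u0 u1] Vu] := segment_near c nV.
    exists ((1 - u) *: m + u *: c); split=> //; split; last exact: segment_neq.
    split; last by apply: hE; lra.
    by exists B => //; apply: conv_convex; [exact: open_conv_sub|by []|lra|lra].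
  have neq c d : c != d -> c != (1 - 2^-1) *: c + 2^-1 *: d.
    move=> cd; apply: contraNneq cd => e; apply/eqP; apply: row2P;
      have := congr1 (fun u : point => u 0 i0) e; have := congr1 (fun u : point => u 0 i1) e;
      rewrite /= !rvE; lra.
  apply: (@no_local_separation m _ E1 E2 Xm (nB m om)).
  + by apply: closed_comp; [move=> v _; exact: peval_continuous|exact: closed_le].
  + by apply: closed_comp; [move=> v _; exact: peval_continuous|exact: closed_ge].
  + by move=> y _ _; rewrite /E1 /E2 /=; case: (leP (peval L y) 0) => h; [left|right; exact: ltW].
  + move=> y h Xy; have := h Xy; rewrite BE => /(conv2P _ ab)[t _ ->].
    rewrite /E1 /E2 /= Ls => h1 h2.
    have : (t - 2^-1) * q = 0 by apply/eqP; rewrite eq_le h1 h2.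
    by move/eqP; rewrite mulf_eq0 (gt_eqF q0) orbF subr_eq0 => /eqP->.
  + apply: (cl E1 a) => [||u hu0 hu1]; [|exact: neq|].
      by apply: conv_vertex; rewrite BE !inE eqxx.
    rewrite /E1 /= (_ : _ + _ = (1 - (1 - u) / 2) *: a + ((1 - u) / 2) *: b).
      by rewrite Ls pmulr_lle0 //; lra.
    by rewrite /m; apply: row2P; rewrite !rvE; field.
  + apply: (cl E2 b) => [||u hu0 hu1].
    * by apply: conv_vertex; rewrite BE !inE eqxx orbT.
    * rewrite /m (_ : _ + _ = (1 - 2^-1) *: b + 2^-1 *: a); first by apply: neq; rewrite eq_sym.
      by apply: row2P; rewrite !rvE; field.
    rewrite /E2 /= (_ : _ + _ = (1 - (1 + u) / 2) *: a + ((1 + u) / 2) *: b).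
      by rewrite Ls pmulr_lge0 //; lra.
    by rewrite /m; apply: row2P; rewrite !rvE; field.
Qed.

Lemma closed_simplices (P : {fset point} -> Prop) :
  closed [set y | exists A, [/\ A \in K, P A & conv A y]].
Proof.
rewrite (_ : [set y | _] = \bigcup_(A in [set A | A \in K /\ P A]) conv A); last first.
  apply/seteqP; split=> y; first by move=> [A [AK PA Ay]]; exists A.
  by move=> [A [AK PA] Ay]; exists A.
apply: closed_bigcup; last by move=> A _; exact: conv_closed.
by apply: sub_finite_set (finite_fset K) => A [].
Qed.

Lemma common_carrier A B y : A \in K -> B \in K -> conv A y -> conv B y ->
  exists2 c, c \in A & c \in B.
Proof.
move=> AK BK Ay By; have [C [CK CA Cy]] := carrier_exists hK AK Ay.
have /fsubsetP CB := carrier_sub hK BK CK Cy By; have /fset0Pn[c cC] := simplex_neq0 hK CK.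
by exists c; [exact: (fsubsetP CA)|exact: CB].
Qed.

(** The triangles at [g] with and without [P] form two closed sets covering the support near [g]. If
    they met outside [g], two triangles of different kinds would share an edge at [g], across which
    [P] propagates; so [g] would separate the support locally. *)
Lemma star_connected g (P : {fset point} -> Prop) A0 :
  A0 \in triangles K -> g \in A0 -> P A0 ->
  (forall A B b, A \in triangles K -> B \in triangles K -> A != B -> g != b ->
     ([fset g; b] `<=` A)%fset -> ([fset g; b] `<=` B)%fset ->
     [fset g; b]%fset \in interior_edges K -> P A -> P B) ->
  forall A, A \in triangles K -> g \in A -> P A.
Proof.
move=> A0T gA0 PA0 step A1 A1T gA1; apply: contrapT => PA1.
have gV : g \in vertices K by apply: simplex_vertex gA0 => //; exact: triangle_in_K.
have Xg : X g by exists A0; [exact: triangle_in_K|exact: conv_vertex].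
pose Q1 A := A \in triangles K /\ g \in A /\ P A.
pose Q2 A := A \in triangles K /\ g \in A /\ ~ P A.
have other A : A \in triangles K -> g \in A -> exists2 p, conv A p & p != g.
  move=> AT gA; have [b [c [d AE]]] := triangle_split hK AT gA; have [gb _ _] := det_neq d.
  by exists b; rewrite 1?eq_sym // AE; apply: conv_vertex; rewrite !inE eqxx orbT.
apply: (@no_local_separation g _ [set y | exists A, [/\ A \in K, Q1 A & conv A y]]
  [set y | exists A, [/\ A \in K, Q2 A & conv A y]] Xg (local_simplices K g)).
- exact: closed_simplices.
- exact: closed_simplices.
- move=> y loc [C /= CK Cy]; have [T TT CT] := simplex_sub_triangle CK.
  have TK := triangle_in_K TT; have Ty := conv_sub CT Cy.
  have gT : g \in T by apply: (conv_vertex_mem hK TK gV); exact: (loc T TK Ty).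
  by have [PT|PT] := pselect (P T); [left|right]; exists T.
- move=> y _ _ [A [AK [AT [gA PA]] Ay]] [B [BK [BT [gB PB]] By]].
  have [C [CK CA Cy]] := carrier_exists hK AK Ay.
  have CB := carrier_sub hK BK CK Cy By.
  have [h|/fsubsetPn[b bC]] := boolP (C `<=` [fset g])%fset.
    have : conv [fset g]%fset y by apply: conv_sub h _ _; exact: open_conv_sub.
    by move=> [l [_]]; rewrite !big_seq_fset1 => -> ->; rewrite scale1r.
  rewrite inE eq_sym => gb; exfalso; apply: (PB).
  have AB : A != B by apply/eqP => AB; apply: PB; rewrite -AB.
  have sA : ([fset g; b] `<=` A)%fset.
    by apply/fsubsetP => z; rewrite !inE => /orP[] /eqP-> //; exact: (fsubsetP CA).
  have sB : ([fset g; b] `<=` B)%fset.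
    by apply/fsubsetP => z; rewrite !inE => /orP[] /eqP-> //; exact: (fsubsetP CB).
  apply: (step A B b) => //.
  exact: two_triangles_interior_edge AT BT AB gb sA sB.
- have [p Ap pg] := other A0 A0T gA0.
  apply: (simplex_closure (triangle_in_K A0T) (conv_vertex gA0) Ap pg) => y A0y.
  by exists A0; split=> //; exact: triangle_in_K.
- have [p Ap pg] := other A1 A1T gA1.
  apply: (simplex_closure (triangle_in_K A1T) (conv_vertex gA1) Ap pg) => y A1y.
  by exists A1; split=> //; exact: triangle_in_K.
Qed.

(** Triangles with a common vertex agree on [P] by [star_connected], so the unions of the two kinds
    of triangles are disjoint closed sets, and the support is connected. *)
Lemma strongly_connected (P : {fset point} -> Prop) A0 :
  A0 \in triangles K -> P A0 ->
  (forall A B a b, A \in triangles K -> B \in triangles K -> A != B -> a != b ->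
     ([fset a; b] `<=` A)%fset -> ([fset a; b] `<=` B)%fset ->
     [fset a; b]%fset \in interior_edges K -> P A -> P B) ->
  forall A, A \in triangles K -> P A.
Proof.
move=> A0T PA0 step A1 A1T; apply: contrapT => PA1.
pose E1 := [set y | exists A, [/\ A \in K, (A \in triangles K /\ P A) & conv A y]].
pose E2 := [set y | exists A, [/\ A \in K, (A \in triangles K /\ ~ P A) & conv A y]].
have dis y : E1 y -> E2 y -> False.
  move=> [A [AK [AT PA] Ay]] [B [BK [BT PB] By]].
  have [c cA cB] := common_carrier AK BK Ay By; apply: PB.
  apply: (star_connected AT cA PA _ BT cB) => C D b CT DT CD cb sC sD EI PC.
  exact: (step C D c b).
have cov y : X y -> E1 y \/ E2 y.
  move=> [C /= CK Cy]; have [T TT CT] := simplex_sub_triangle CK.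
  have TK := triangle_in_K TT; have Ty := conv_sub CT Cy.
  by have [PT|PT] := pselect (P T); [left|right]; exists T.
have pt A : A \in triangles K -> exists2 y, X y & conv A y.
  move=> AT; have AK := triangle_in_K AT; have /fset0Pn[a aA] := simplex_neq0 hK AK.
  by exists a; [exists A => //|]; exact: conv_vertex.
have [y0 X0 y0A] := pt _ A0T; have [y1 X1 y1A] := pt _ A1T.
have E10 : E1 y0 by exists A0; split=> //; exact: triangle_in_K.
have E21 : E2 y1 by exists A1; split=> //; exact: triangle_in_K.
have : X `&` E1 = X.
  apply: (support_connected hdisk).
  - by exists y0.
  - exists (~` E2); first by apply: closed_openC; exact: closed_simplices.
    apply/seteqP; split=> y [Xy Ey]; split=> //; first by move=> h; exact: dis Ey h.
    by case: (cov y Xy).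
  - by exists E1 => //; exact: closed_simplices.
move=> eq; have : (X `&` E1) y1 by rewrite eq.
by move=> [_ h]; exact: dis h E21.
Qed.

Lemma support_neq0 : exists A, A \in triangles K.
Proof.
have [F [G [[GX _ _ _] _]]] := disk_chart_exists hdisk.
have D0 : @unit_disk R 0 by rewrite /unit_disk /= big2 /= !rv0 expr0n /= addr0 ler01.
have [A AK _] := GX 0 D0; have [T TT _] := simplex_sub_triangle AK; by exists T.
Qed.

(** Its contrapositive gives a boundary vertex a boundary edge. In a small disk punctured at [g],
    every point of the support lies in an open triangle or open interior edge at [g], so the support
    is open and closed there. *)
Lemma vertex_interior_of_edges g : g \in vertices K ->
  (forall b, g != b -> [fset g; b]%fset \in edges K -> [fset g; b]%fset \in interior_edges K) ->
  g \in interior_vertices K.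
Proof.
move=> gV hE; rewrite in_interior_vertices // gV; apply/asboolP.
have gK : [fset g]%fset \in K by rewrite -in_vertices.
have Xg : X g by exists [fset g]%fset => //; apply: conv_vertex; rewrite inE.
have /nbhs_ballP[e /= e0 he] := local_simplices K g.
pose D := ball g e `\` [set g].
have cD : connected D.
  apply: (@convex_punctured_connected _ _ g g); first exact: ball_convex.
  exact: nbhsx_ballx.
have int y : D y -> X y -> X° y.
  move=> [by_ yg] [A /= AK Ay]; have [C [CK CA Cy]] := carrier_exists hK AK Ay.
  have gC : g \in C by apply: (conv_vertex_mem hK CK gV); apply: (he y by_) => //; exact: open_conv_sub.
  case: (simplex_card hK CK) => [C1|C2|C3].
  - move/eqP/cardfs1P: C1 => [b CE]; exfalso; apply: yg.
    move: gC Cy; rewrite CE inE => /eqP<- [l [_ _]].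
    by rewrite !big_seq_fset1 => -> ->; rewrite scale1r.
  - have CEd : C \in edges K by rewrite in_edges CK C2.
    have [b gb CE] := edge_split CEd gC; rewrite CE in CEd Cy.
    have [c [d [cT dT c0 d0 _]]] := interior_edge_pair hK gb (hE b gb CEd).
    apply: (two_triangles_interior hK cT dT _ gb _ _ Cy).
    + apply/eqP => cd; have : d \in [fset g; b; c]%fset by rewrite cd !inE eqxx orbT.
      rewrite !inE => /orP[/orP[]|] /eqP dE; move: d0 c0; rewrite dE ?det_l ?det_r ?ltxx //.
      by move=> h1 h2; have := lt_trans h1 h2; rewrite ltxx.
    + by apply/fsubsetP => z; rewrite !inE => ->.
    + by apply/fsubsetP => z; rewrite !inE => ->.
  - by apply: (triangle_interior hK _ Cy); rewrite in_triangles CK C3.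
have [T TT gT] := simplex_sub_triangle gK.
have {}gT : g \in T by rewrite -fsub1set.
have [b [c [d TE]]] := triangle_split hK TT gT; have [gb _ _] := det_neq d.
have DX : D `&` X = D.
  apply: cD.
  - have bg : b != g by rewrite eq_sym.
    have [u /andP[u0 u1] Vu] := segment_near b (nbhsx_ballx g e e0).
    exists ((1 - u) *: g + u *: b); split; first by split=> //; exact: segment_neq.
    exists T; first exact: triangle_in_K.
    by apply: conv_convex; [exact: conv_vertex|apply: conv_vertex; rewrite TE !inE eqxx orbT|lra|lra].
  - exists X°; first exact: open_interior.
    apply/seteqP; split=> y [Dy Xy]; split=> //; first exact: int.
    exact: interior_subset.
  - by exists X => //; exact: support_closed.
apply/nbhs_ballP; exists e => // y gy.
have [->//|yg] := pselect (y = g).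
by have : D y by []; rewrite -DX => -[].
Qed.

(** A vertex maximizing [f] times the first coordinate is on the boundary: a point slightly further
    in that direction is no convex combination of vertices. *)
Lemma extreme_vertex (f : R) : f != 0 -> exists2 v, v \in vertices K &
  v \notin interior_vertices K /\ forall w, w \in vertices K -> f * w 0 i0 <= f * v 0 i0.
Proof.
move=> f0; have [T TT] := support_neq0.
have TK := triangle_in_K TT; have /fset0Pn[t tT] := simplex_neq0 hK TK.
have tV := simplex_vertex hK TK tT.
pose v := [arg max_(w > [` tV]%fset) f * (val w) 0 i0]%O.
have vmax w : w \in vertices K -> f * w 0 i0 <= f * (val v) 0 i0.
  move=> wV; rewrite /v; case: arg_maxP => //= u _ h.
  exact: (h [` wV]%fset isT).
exists (val v); first exact: valP.
split=> //; rewrite in_interior_vertices // (valP v) /=; apply/negP => /asboolP iv.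
have [u /andP[u0 u1] [A /= AK]] := segment_near (val v + f *: delta_mx 0 i0) iv.
move=> [l [l0 l1 E]].
have := congr1 (fun x : point => f * x 0 i0) E; rewrite /= summxE !rvE mxE /= mulr1 mulr_sumr => e.
have : f * ((1 - u) * (val v) 0 i0 + u * ((val v) 0 i0 + f)) <= f * (val v) 0 i0.
  rewrite e -[leRHS]mul1r -l1 mulr_suml big_seq [leRHS]big_seq; apply: ler_sum => a aA.
  by rewrite rvZ mulrCA; apply: ler_wpM2l => //; apply: vmax; exact: (simplex_vertex hK AK).
rewrite -subr_le0 (_ : _ - _ = u * f ^+ 2); last by ring.
by rewrite leNgt mulr_gt0 // lt0r sqrf_eq0 f0 sqr_ge0.
Qed.

(** Take a rightmost and a leftmost vertex. If they coincided, all vertices would have the same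
    abscissa and every triangle would be flat. *)
Lemma two_boundary_vertices : exists v w, [/\ v \in vertices K, w \in vertices K, v != w,
  v \notin interior_vertices K & w \notin interior_vertices K].
Proof.
have [v vV [vb vmax]] := extreme_vertex (oner_neq0 R).
have N1 : (-1 : R) != 0 by rewrite oppr_eq0 oner_eq0.
have [w wV [wb wmax]] := extreme_vertex N1.
exists v, w; split=> //; apply/eqP => vw.
have h x : x \in vertices K -> x 0 i0 = v 0 i0.
  by move=> xV; have := vmax x xV; have := wmax x xV; rewrite -vw; lra.
have [T TT] := support_neq0; have TK := triangle_in_K TT.
have /fset0Pn[t tT] := simplex_neq0 hK TK.
have [b [c [d TE]]] := triangle_split hK TT tT.
have vE x : x \in T -> x 0 i0 = v 0 i0 by move=> xT; apply: h; exact: (simplex_vertex hK TK).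
move/eqP: d; apply; rewrite /det (vE t) // (vE b) ?(vE c) ?TE ?inE ?eqxx ?orbT //.
ring.
Qed.

End DiskComplex.

(** * Exactness of the chain complex *)

Section Orientation.
Context {R : realType}.
Local Notation point := 'rV[R]_2.
Implicit Types (t A : {fset point}) (a b c g : point).

(* An edge is oriented by the enumeration of its vertices; [esgn t A] records
   on which side of [t] the triangle [A] lies and [eps g t] whether [t] starts
   at [g]. *)
Definition esgn t A : R :=
  \sum_(c <- (A `\` t)%fset) Num.sg (det (nth 0 (enum_fset t) 0) (nth 0 (enum_fset t) 1) c).

Definition eps g t : R := if g == nth 0 (enum_fset t) 0 then 1 else -1.

Lemma eps_sqr g t : eps g t * eps g t = 1.
Proof. by rewrite /eps; case: ifP; rewrite ?mulr1 ?mulrNN ?mulr1. Qed.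

Lemma eps_neq0 g t : eps g t != 0.
Proof. by rewrite /eps; case: ifP; rewrite ?oppr_eq0 oner_eq0. Qed.

Lemma fset2_enum g b : g != b ->
  enum_fset [fset g; b]%fset = [:: g; b] \/ enum_fset [fset g; b]%fset = [:: b; g].
Proof.
move=> gb; have := cardfs2 g b; rewrite gb; have := fset_uniq [fset g; b]%fset.
have : forall x, (x \in enum_fset [fset g; b]%fset) = (x == g) || (x == b).
  by move=> x; rewrite -in_fset2.
case: (enum_fset _) => [|u [|v [|//]]] //= h; rewrite inE andbT => uv _.
have := h u; have := h v; rewrite !inE !eqxx orbT /= => /esym hv /esym hu.
case/orP: hu => /eqP uE; case/orP: hv => /eqP vE; subst u v; rewrite ?eqxx // in uv.
- by left.
- by right.
Qed.

(** Starting the edge at its other end reverses the signs of [det] and [eps] alike, so the formula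
    holds for either end [g]. *)
Lemma esgnE g b c : det g b c != 0 ->
  esgn [fset g; b]%fset [fset g; b; c]%fset = eps g [fset g; b]%fset * Num.sg (det g b c).
Proof.
move=> d; have [gb gc bc] := det_neq d; rewrite /esgn /eps.
have -> : ([fset g; b; c] `\` [fset g; b] = [fset c])%fset.
  apply/fsetP => x; rewrite !inE; case: (eqVneq x g) => [->|_] /=; first by rewrite (negbTE gc).
  by case: (eqVneq x b) => [->|_] /=; rewrite ?(negbTE bc).
rewrite big_seq_fset1; case: (fset2_enum gb) => -> /=; first by rewrite eqxx mul1r.
by rewrite (negbTE gb) detC sgrN mulN1r.
Qed.

End Orientation.

Section Coboundary.
Context {R : realType}.
Local Notation point := 'rV[R]_2.
Context (K : {fset {fset point}}) (hK : simplicial_complex K).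
Implicit Types (t A : {fset point}) (a b c d g : point).

Lemma sum_edge_triangles (V : nmodType) (F : {fset point} -> V) a b c d :
  [fset a; b; c]%fset \in triangles K -> [fset a; b; d]%fset \in triangles K ->
  0 < det a b c -> det a b d < 0 ->
  (forall A, A \in triangles K -> ([fset a; b] `<=` A)%fset ->
      A = [fset a; b; c]%fset \/ A = [fset a; b; d]%fset) ->
  \sum_(A <- triangles K | ([fset a; b] `<=` A)%fset) F A = F [fset a; b; c]%fset + F [fset a; b; d]%fset.
Proof.
move=> cT dT c0 d0 h; rewrite big_fset_condE.
have sub x : ([fset a; b] `<=` [fset a; b; x])%fset by apply/fsubsetP => z; rewrite !inE => ->.
have cd : [fset a; b; c]%fset != [fset a; b; d]%fset.
  apply/eqP => cd; have : d \in [fset a; b; c]%fset by rewrite cd !inE eqxx orbT.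
  rewrite !inE => /orP[/orP[]|] /eqP dE; move: d0 c0; rewrite dE ?det_l ?det_r ?ltxx //.
  by move=> h1 h2; have := lt_trans h1 h2; rewrite ltxx.
rewrite -(sum_fset2 F cd); congr bigop; congr enum_fset; apply/fsetP => A.
rewrite !inE /=; apply/andP/orP; first by move=> [AT sA]; case: (h A _ sA) => [|->|->]; rewrite ?eqxx //; [rewrite inE /=|left|right].
by move=> [] /eqP->; rewrite sub; split=> //; [move: cT|move: dT]; rewrite !inE.
Qed.

Lemma coboundaryE (V : lmodType R) a b :
  a != b -> [fset a; b]%fset \in interior_edges K ->
  exists c d, [/\ [fset a; b; c]%fset \in triangles K, [fset a; b; d]%fset \in triangles K,
    0 < det a b c /\ det a b d < 0,
    (forall A, A \in triangles K -> ([fset a; b] `<=` A)%fset ->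
      A = [fset a; b; c]%fset \/ A = [fset a; b; d]%fset) &
    forall P : {fset point} -> V,
    \sum_(A <- triangles K | ([fset a; b] `<=` A)%fset) esgn [fset a; b]%fset A *: P A =
      eps a [fset a; b]%fset *: (P [fset a; b; c]%fset - P [fset a; b; d]%fset)].
Proof.
move=> ab EI; have [c [d [cT dT c0 d0 h]]] := interior_edge_pair hK ab EI.
exists c, d; split=> // Q; rewrite (sum_edge_triangles _ cT dT) //.
have -> : esgn [fset a; b]%fset [fset a; b; c]%fset = eps a [fset a; b]%fset :> R.
  by rewrite esgnE ?lt0r_neq0 // gtr0_sg // mulr1.
have -> : esgn [fset a; b]%fset [fset a; b; d]%fset = - eps a [fset a; b]%fset :> R.
  by rewrite esgnE ?ltr0_neq0 // ltr0_sg // mulrN1.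
by rewrite scaleNr scalerBr.
Qed.

Lemma edge_at t g b c : t \in edges K -> g \in t -> (t `<=` [fset g; b; c])%fset ->
  t = [fset g; b]%fset \/ t = [fset g; c]%fset.
Proof.
move=> tE gt sub; have [x gx tx] := edge_split tE gt.
have : x \in [fset g; b; c]%fset by apply: (fsubsetP sub); rewrite tx !inE eqxx orbT.
rewrite !inE eq_sym (negbTE gx) /= => /orP[] /eqP xE; rewrite tx xE; by [left|right].
Qed.

Lemma sum_vertex_edges (V : nmodType) (F : {fset point} -> V) g b c :
  g \in interior_vertices K -> [fset g; b; c]%fset \in triangles K -> det g b c != 0 ->
  \sum_(t <- interior_edges K | (g \in t) && (t `<=` [fset g; b; c])%fset) F t =
    F [fset g; b]%fset + F [fset g; c]%fset.
Proof.
move=> gI AT d; have [gb gc bc] := det_neq d.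
have [E1 E2 _] := triangle_faces hK AT erefl d.
have I1 : [fset g; b]%fset \in interior_edges K.
  by apply: (interior_vertex_edge gI E1); rewrite !inE eqxx.
have I2 : [fset g; c]%fset \in interior_edges K.
  by apply: (interior_vertex_edge gI E2); rewrite !inE eqxx.
have ne : [fset g; b]%fset != [fset g; c]%fset.
  apply/eqP => e; have : b \in [fset g; c]%fset by rewrite -e !inE eqxx orbT.
  by rewrite !inE eq_sym (negbTE gb) (negbTE bc).
rewrite big_fset_condE -(sum_fset2 F ne); congr bigop; congr enum_fset; apply/fsetP => t.
rewrite in_fset /= in_fset2; apply/andP/orP.
  move=> [tI /andP[gt sub]].
  by case: (edge_at (interior_edge_edge tI) gt sub) => ->; rewrite eqxx; [left|right].
move=> [] /eqP->; split; rewrite ?I1 ?I2 // !inE eqxx /=.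
  by apply/fsubsetP => z; rewrite !inE => ->.
by apply/fsubsetP => z; rewrite !inE => /orP[] ->; rewrite ?orbT.
Qed.

End Coboundary.

Lemma in_fset_cond (T : choiceType) (A : {fset T}) (P : pred T) x :
  (x \in [fset y in A | P y]%fset) = (x \in A) && P x.
Proof. by rewrite !inE. Qed.

Lemma fset_row (R : nmodType) (T : choiceType) (x0 : T) (A : {fset T}) (v : 'rV[R]_(#|` A|)) :
  exists f : T -> R, forall i : 'I_(#|` A|), f (nth x0 (enum_fset A) i) = v 0 i.
Proof.
exists (fun x => if insub (index x (enum_fset A)) is Some i then v 0 i else 0).
by move=> i; rewrite index_uniq ?fset_uniq // valK.
Qed.

Lemma sum_fset_nth (V : nmodType) (T : choiceType) (x0 : T) (A : {fset T}) (F : T -> V) :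
  \sum_(a <- A) F a = \sum_(i < #|` A|) F (nth x0 (enum_fset A) i).
Proof. by rewrite (big_nth x0) big_mkord. Qed.

Lemma leq_card_fset_inj (T : choiceType) (A B : {fset T}) (f : T -> T) :
  {in A &, injective f} -> (forall x, x \in A -> f x \in B) -> (#|` A| <= #|` B|)%N.
Proof.
move=> fi fAB; have <- : #|` [fset f x | x in A]%fset| = #|` A| by rewrite card_in_imfset.
by apply: fsubset_leq_card; apply/fsubsetP => _ /imfsetP[x xA ->]; exact: fAB.
Qed.

Section LocalExactness.
Context {R : realType}.
Local Notation point := 'rV[R]_2.
Context (K : {fset {fset point}}) (hK : simplicial_complex K) (hdisk : disk_complex K).
Implicit Types (t A B : {fset point}) (a b c d g : point).

(** [phi] sends an edge at [g] to its triangle on the side given by [e]. It is injective because the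
    two edges at [g] of a triangle have that triangle on opposite sides. *)
Lemma star_count g (e : R) : e != 0 -> exists phi : {fset point} -> {fset point},
  {in [fset t in interior_edges K | g \in t]%fset &, injective phi} /\
  forall t, t \in interior_edges K -> g \in t -> phi t \in triangles K /\
    exists b c, [/\ t = [fset g; b]%fset, phi t = [fset g; b; c]%fset & 0 < e * det g b c].
Proof.
move=> e0.
have /choice[phi hphi] : forall t, exists A, t \in interior_edges K -> g \in t ->
    A \in triangles K /\
    exists b c, [/\ t = [fset g; b]%fset, A = [fset g; b; c]%fset & 0 < e * det g b c].
  move=> t; have [/andP[tI gt]|] := boolP ((t \in interior_edges K) && (g \in t)); last first.
    by move=> /negP h; exists fset0 => tI gt; case: h; rewrite tI.
  have [b gb tE] := edge_split (interior_edge_edge tI) gt; rewrite tE in tI.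
  have [c [cT _ hc]] := interior_edge_triangle hK gb tI e0.
  by exists [fset g; b; c]%fset => _ _; split=> //; exists b, c.
exists phi; split=> // t t'; rewrite in_fset_cond => /andP[tI gt].
rewrite in_fset_cond => /andP[tI' gt'] E.
have [_ [b [c [tE pE d]]]] := hphi t tI gt.
have [_ [b' [c' [tE' pE' d']]]] := hphi t' tI' gt'.
have h : (t' `<=` [fset g; b; c])%fset.
  by rewrite -pE E pE' tE'; apply/fsubsetP => z; rewrite !inE => ->.
case: (edge_at (interior_edge_edge tI') gt' h) => [->//|t'c].
have d0 : det g b c != 0 by apply: contraTneq d => ->; rewrite mulr0 ltxx.
have d0' : det g b' c' != 0 by apply: contraTneq d' => ->; rewrite mulr0 ltxx.
have [gb gc bc] := det_neq d0; have [gb' gc' bc'] := det_neq d0'.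
have b'c : b' = c.
  have : b' \in t' by rewrite tE' !inE eqxx orbT.
  by rewrite t'c !inE eq_sym (negbTE gb') => /eqP.
have c'b : c' = b.
  have : c' \in [fset g; b; c]%fset by rewrite -pE E pE' !inE eqxx orbT.
  by rewrite !inE eq_sym (negbTE gc') /= -b'c [c' == b']eq_sym (negbTE bc') orbF => /eqP.
move: d d'; rewrite b'c c'b (_ : det g c b = - det g b c); last by rewrite /det; ring.
by rewrite mulrN oppr_gt0 => h1 h2; have := lt_trans h1 h2; rewrite ltxx.
Qed.

(** At a boundary vertex, [phi] for a suitable side misses the triangle on a boundary edge, which
    accounts for the extra 1. *)
Lemma star_card g : g \in vertices K ->
  (#|` [fset t in interior_edges K | g \in t]| + (g \notin interior_vertices K) <=
   #|` [fset A in triangles K | g \in A]|)%fset%N.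
Proof.
move=> gV; set L := [fset t in interior_edges K | g \in t]%fset.
set T := [fset A in triangles K | g \in A]%fset.
have [gI|gB] := boolP (g \in interior_vertices K).
  have [phi [phi_inj hphi]] := star_count g (oner_neq0 R).
  rewrite addn0; apply: (leq_card_fset_inj phi_inj) => t; rewrite in_fset_cond => /andP[tI gt].
  have [pT [b [c [_ pE _]]]] := hphi t tI gt.
  by rewrite in_fset_cond pT pE !inE eqxx.
have [b [gb bE bN]] : exists b, [/\ g != b, [fset g; b]%fset \in edges K &
    [fset g; b]%fset \notin interior_edges K].
  apply: contrapT => h; move/negP: gB; apply; apply: (vertex_interior_of_edges hK hdisk gV).
  by move=> b gb bE; apply/negPn/negP => bN; apply: h; exists b.
have [A AT sA] := simplex_sub_triangle hK hdisk (edge_in_K bE).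
have [c [d AE]] := triangle_edge hK AT gb sA.
(* With the sign of [det g b c], the triangle [A] would belong to the boundary edge [gb], so no
   interior edge is sent to it. *)
have [phi [phi_inj hphi]] := star_count g d.
have gA : g \in A by rewrite AE !inE eqxx.
have AinT : A \in T by rewrite in_fset_cond AT gA.
rewrite addn1 (cardfsD1 A T) AinT add1n ltnS.
apply: (leq_card_fset_inj phi_inj) => t; rewrite in_fset_cond => /andP[tI gt].
have [pT [b' [c' [tE pE d']]]] := hphi t tI gt.
have gp : g \in phi t by rewrite pE !inE eqxx.
rewrite in_fsetD1 in_fset_cond pT gp !andbT; apply/eqP => E.
have d0' : det g b' c' != 0 by apply: contraTneq d' => ->; rewrite mulr0 ltxx.
have [_ gc bc] := det_neq d; have [gb' gc' bc'] := det_neq d0'.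
have hb : b' \in [fset g; b; c]%fset by rewrite -AE -E pE !inE eqxx orbT.
move: hb; rewrite !inE eq_sym (negbTE gb') /= => /orP[] /eqP bb.
  by move: tI; rewrite tE bb (negbTE bN).
have hc : c' \in [fset g; b; c]%fset by rewrite -AE -E pE !inE eqxx orbT.
move: hc; rewrite !inE eq_sym (negbTE gc') /= -bb [c' == b']eq_sym (negbTE bc') orbF => /eqP cb.
move: d'; rewrite bb cb (_ : det g c b = - det g b c); last by rewrite /det; ring.
by rewrite mulrN oppr_gt0 ltNge -expr2 sqr_ge0.
Qed.

(* The star of [g] is connected through its edges, so the equations have rank at
   least the number of triangles minus one; there are no more equations than
   triangles, and at an interior vertex [eps g] is a relation between them. *)
Lemma local_exact g (q : {fset point} -> R) : g \in vertices K ->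
  (g \in interior_vertices K ->
     \sum_(t <- interior_edges K | g \in t) eps g t * q t = 0) ->
  exists P : {fset point} -> R, forall t, t \in interior_edges K -> g \in t ->
    \sum_(A <- triangles K | (t `<=` A)%fset) esgn t A * P A = q t.
Proof.
move=> gV hq.
pose L := [fset t in interior_edges K | g \in t]%fset.
pose T := [fset A in triangles K | g \in A]%fset.
pose l := #|` L|; pose n := #|` T|.
pose Lt (j : 'I_l) := nth fset0 (enum_fset L) j; pose Tt (i : 'I_n) := nth fset0 (enum_fset T) i.
have LtP j : Lt j \in interior_edges K /\ g \in Lt j.
  have h : Lt j \in L by exact: mem_nth.
  by move: h; rewrite in_fset_cond => /andP[].
have TtP i : Tt i \in triangles K /\ g \in Tt i.
  have h : Tt i \in T by exact: mem_nth.
  by move: h; rewrite in_fset_cond => /andP[].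
pose M : 'M[R]_(n, l) := \matrix_(i, j) (if (Lt j `<=` Tt i)%fset then esgn (Lt j) (Tt i) else 0).
have mulME (f : {fset point} -> R) (u : 'rV[R]_n) j : (forall i, f (Tt i) = u 0 i) ->
    (u *m M) 0 j = \sum_(A <- triangles K | (Lt j `<=` A)%fset) esgn (Lt j) A * f A.
  move=> fu; have [tI gt] := LtP j.
  transitivity (\sum_(A <- T) if (Lt j `<=` A)%fset then esgn (Lt j) A * f A else 0).
    rewrite mxE (sum_fset_nth fset0 T); apply: eq_bigr => i _.
    by rewrite [M _ _]mxE -fu -/(Tt i); case: ifP; rewrite ?mulr0 // mulrC.
  rewrite -big_mkcond /= big_fset_condE [RHS]big_fset_condE; congr bigop; congr enum_fset.
  apply/fsetP => A; rewrite !in_fset_cond -!andbA; do 2 congr (_ && _).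
  by case: (boolP (Lt j `<=` A)%fset) => [/fsubsetP/(_ g gt)->|]; rewrite ?andbF.
have kerM : (\rank (kermx M) <= 1)%N.
  apply: (leq_trans (mxrankS (_ : (kermx M <= (const_mx 1 : 'rV[R]_n))%MS))); last exact: rank_leq_row.
  apply/row_subP => k; set u := row k (kermx M).
  have uM : u *m M = 0 by apply/sub_kermxP; exact: row_sub.
  have [n0|n_gt0] := posnP n.
    have -> : u = 0 by apply/rowP => i; have := ltn_ord i; rewrite {2}n0.
    exact: sub0mx.
  have [f fu] := fset_row fset0 u.
  pose A0 := Tt (Ordinal n_gt0); have [A0T gA0] := TtP (Ordinal n_gt0).
  have fconst : forall A, A \in triangles K -> g \in A -> f A = f A0.
    apply: (star_connected hK hdisk A0T gA0 erefl) => A B b AT BT AB gb sA sB EI fA.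
    have tL : [fset g; b]%fset \in L by rewrite in_fset_cond EI !inE eqxx.
    have jl : (index [fset g; b]%fset (enum_fset L) < l)%N by rewrite index_mem.
    have tj : Lt (Ordinal jl) = [fset g; b]%fset by exact: nth_index.
    have := mulME f u (Ordinal jl) fu; rewrite uM mxE tj.
    have [c [d [cT dT _ hcd ->]]] := @coboundaryE _ _ hK R^o g b gb EI.
    move/esym/eqP; rewrite mulf_eq0 (negbTE (eps_neq0 _ _)) /= subr_eq0 => /eqP fcd.
    by rewrite -fA; case: (hcd A AT sA) => ->; case: (hcd B BT sB) => ->.
  apply/submxP; exists (const_mx (f A0)); apply/rowP => i; have [iT gi] := TtP i.
  rewrite [RHS]mxE big_ord1 [const_mx (f A0) _ _]mxE [const_mx 1 _ _]mxE mulr1 -fu.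
  exact: fconst.
have rankM : (n <= (\rank M).+1)%N by move: kerM; rewrite mxrank_ker; lia.
have cardln := star_card gV; rewrite -/L -/T -/l -/n in cardln.
pose u : 'rV[R]_l := \row_j q (Lt j).
have uM : (u <= M)%MS.
  have [gI|gB] := boolP (g \in interior_vertices K); last first.
    rewrite gB addn1 in cardln; apply: submx_full.
    by rewrite /row_full eqn_leq rank_leq_col; lia.
  rewrite gI addn0 in cardln.
  pose e : 'cV[R]_l := \col_j eps g (Lt j).
  have Me : M *m e = 0.
    apply/colP => i; rewrite mxE [RHS]mxE; have [AT gA] := TtP i.
    have [b [c [d AE]]] := triangle_split hK AT gA; rewrite AE in AT.
    transitivity (\sum_(t <- L) if (t `<=` Tt i)%fset then esgn t (Tt i) * eps g t else 0).
      rewrite (sum_fset_nth fset0 L); apply: eq_bigr => j _.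
      by rewrite !mxE -/(Lt j); case: ifP; rewrite ?mul0r.
    rewrite -big_mkcond big_fset_condE /=.
    transitivity (\sum_(t <- interior_edges K | (g \in t) && (t `<=` [fset g; b; c])%fset)
        esgn t [fset g; b; c]%fset * eps g t).
      rewrite [RHS]big_fset_condE AE; congr bigop; congr enum_fset.
      by apply/fsetP => t; rewrite !in_fset_cond -!andbA.
    rewrite (sum_vertex_edges hK _ gI AT d) esgnE //.
    have d' : det g c b != 0 by rewrite (_ : det g c b = - det g b c) ?oppr_eq0 // /det; ring.
    have -> : [fset g; b; c]%fset = [fset g; c; b]%fset by rewrite fsetUAC.
    rewrite esgnE // (_ : det g c b = - det g b c); last by rewrite /det; ring.
    rewrite sgrN; have := eps_sqr g [fset g; b]%fset; have := eps_sqr g [fset g; c]%fset.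
    by move=> e1 e2; rewrite mulrAC e2 mulrAC e1; ring.
  have ue : u *m e = 0.
    apply/rowP => k; rewrite mxE [RHS]mxE -[RHS](hq gI) big_fset_condE -/L (sum_fset_nth fset0 L).
    by apply: eq_bigr => j _; rewrite !mxE mulrC.
  have [l0|l_gt0] := posnP l.
    have -> : u = 0 by apply/rowP => i; have := ltn_ord i; rewrite {2}l0.
    exact: sub0mx.
  have e_rank : (0 < \rank e)%N.
    rewrite lt0n mxrank_eq0; apply/eqP => /colP/(_ (Ordinal l_gt0)); rewrite !mxE.
    exact/eqP/eps_neq0.
  have Mk : (M <= kermx e)%MS by apply/sub_kermxP.
  (* The rank of [M] is at least [n - 1], hence at least [l - 1], which bounds the dimension of the
     kernel of [e]; the inclusion [Mk] is therefore an equality. *)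
  have : (kermx e <= M)%MS.
    rewrite -(geq_leqif (mxrank_leqif_sup Mk)) mxrank_ker.
    lia.
  by apply: submx_trans; apply/sub_kermxP.
have [w wE] := submxP uM; have [P Pw] := fset_row fset0 w.
exists P => t tI gt.
have tL : t \in L by rewrite in_fset_cond tI gt.
have jl : (index t (enum_fset L) < l)%N by rewrite index_mem.
have tj : Lt (Ordinal jl) = t by exact: nth_index.
by have := mulME P w (Ordinal jl) Pw; rewrite tj => <-; rewrite -wE mxE tj.
Qed.

End LocalExactness.

Lemma connected_locally_constant (T : topologicalType) (Y : Type) (A : set T) (f : T -> Y) :
  connected A -> (forall x, A x -> \forall x' \near x, A x' -> f x' = f x) ->
  forall x y, A x -> A y -> f x = f y.
Proof.
move=> cA lc x y Ax Ay.
have : A `&` [set z | f z = f x] = A.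
  apply: cA.
  - by exists x.
  - exists (interior [set z | A z -> f z = f x]); first exact: open_interior.
    apply/seteqP; split=> z [Az h]; split=> //; last exact: (interior_subset h).
    by have := lc z Az; apply: filterS => z' h' /h' ->.
  - exists (~` interior [set z | A z -> f z <> f x]); first exact/open_closedC/open_interior.
    apply/seteqP; split=> z [Az h]; split=> //.
      by move=> h'; exact: (interior_subset h').
    apply: contrapT => fz; apply: h; have := lc z Az.
    by apply: filterS => z' h' Az'; rewrite h'.
by move=> e; have [_ /= ->] : (A `&` [set z | f z = f x]) y by rewrite e.
Qed.

(** * Cocycles on the disk *)

Section Monodromy.
Context {R : realType} (V : zmodType).
Local Notation point := 'rV[R]_2.
Local Notation disk := (@unit_disk R).

Lemma disk_norm x : disk x -> `|x| <= 1.
Proof.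
rewrite /unit_disk /= big2 /= => h; rewrite /Num.norm /= mx_normrE; apply: bigmax_le => // -[i j] _.
rewrite -(@ler_pXn2r _ 2) ?nnegrE // expr1n real_normK ?num_real // ord1.
by move: j; apply: ord2P => /=; have := sqr_ge0 (x 0 i0); have := sqr_ge0 (x 0 i1); lra.
Qed.

(* Sum the cocycle along a radius and compare two nearby radii rung by rung. *)
Lemma disk_cocycle (w : point -> point -> V) (e : R) : 0 < e ->
  (forall x, disk x -> w x x = 0) ->
  (forall x y z, disk x -> disk y -> disk z -> `|y - x| < e -> `|z - x| < e ->
     w x y + w y z = w x z) ->
  exists h : point -> V, forall x y, disk x -> disk y -> `|x - y| < e / 2 -> h x - h y = w x y.
Proof.
move=> e0 w0 wc.
have [n n0 ne] : exists2 n : nat, (0 < n)%N & n%:R^-1 < e / 2.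
  exists (Num.truncn (2 / e)).+1 => //.
  rewrite invf_plt ?posrE ?ltr0Sn //; last exact: divr_gt0.
  rewrite invf_div.
  exact: truncnS_gt.
have nr0 : 0 < n%:R :> R by rewrite ltr0n.
(* The radius to [x] is cut into [n] steps, each shorter than [e / 2] because points of the disk
   have norm at most 1. *)
pose pt x (k : nat) : point := (k%:R / n%:R) *: x.
pose hk x (m : nat) := \sum_(k < m) w (pt x k.+1) (pt x k).
have pt_disk x k : disk x -> (k <= n)%N -> disk (pt x k).
  move=> Dx kn; apply: disk_scale => //.
  by rewrite ler_pdivrMr // mul1r ler_nat.
have step x k : disk x -> `|pt x k - pt x k.+1| < e / 2.
  move=> Dx; have -> : pt x k - pt x k.+1 = (- n%:R^-1) *: x.
    by rewrite /pt -scalerBl -natr1; congr (_ *: _); field; exact: lt0r_neq0.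
  rewrite normrZ normrN gtr0_norm ?invr_gt0 //.
  apply: le_lt_trans ne; rewrite -[leRHS]mulr1.
  by apply: ler_wpM2l; [rewrite invr_ge0 ltW|exact: disk_norm].
have rung x y k : `|x - y| < e / 2 -> (k <= n)%N -> `|pt x k - pt y k| < e / 2.
  move=> xy kn; have kn0 : 0 <= k%:R / n%:R :> R by rewrite divr_ge0.
  rewrite /pt -scalerBr normrZ (ger0_norm kn0).
  apply: le_lt_trans xy; rewrite -[leRHS]mul1r ler_wpM2r //.
  by rewrite ler_pdivrMr // mul1r ler_nat.
exists (fun x => hk x n) => x y Dx Dy xy.
(* The cell with corners [pt x m], [pt x m.+1], [pt y m.+1], [pt y m] is cut into two triangles at
   [pt x m.+1]. The other corners are within [e] of that one because steps and rungs are both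
   shorter than [e / 2]. *)
have ladder m : (m <= n)%N -> hk x m - hk y m = w (pt x m) (pt y m).
  elim: m => [_|m IH mn].
    rewrite /hk !big_ord0 subrr /pt !mul0r !scale0r w0 //.
    by have := pt_disk x 0%N Dx (leq0n _); rewrite /pt mul0r scale0r.
  have mn' := ltnW mn.
  have dx0 := pt_disk x m Dx mn'; have dx1 := pt_disk x m.+1 Dx mn.
  have dy0 := pt_disk y m Dy mn'; have dy1 := pt_disk y m.+1 Dy mn.
  have ee : e / 2 < e by lra.
  have s1 : `|pt x m - pt x m.+1| < e by apply: lt_trans ee; exact: step.
  have s2 : `|pt y m.+1 - pt x m.+1| < e by apply: lt_trans ee; rewrite distrC; exact: rung.
  have s3 : `|pt y m - pt x m.+1| < e.
    have -> : pt y m - pt x m.+1 = (pt y m - pt x m) + (pt x m - pt x m.+1) by rewrite addrA subrK.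
    apply: le_lt_trans (ler_normD _ _) _.
    have h1 : `|pt y m - pt x m| < e / 2 by rewrite distrC; exact: rung.
    have := step x m Dx; lra.
  have c1 := wc _ _ _ dx1 dx0 dy0 s1 s3; have c2 := wc _ _ _ dx1 dy1 dy0 s2 s3.
  have hkS z : hk z m.+1 = hk z m + w (pt z m.+1) (pt z m) by rewrite /hk big_ord_recr.
  rewrite !hkS opprD addrACA (IH mn') addrCA addrA c1 -c2 addrK //.
have ptn z : pt z n = z by rewrite /pt divff ?scale1r // lt0r_neq0.
by rewrite ladder // !ptn.
Qed.

End Monodromy.

Section Exactness.
Context {R : realType}.
Local Notation point := 'rV[R]_2.
Local Notation disk := (@unit_disk R).
Context (K : {fset {fset point}}) (hK : simplicial_complex K) (hdisk : disk_complex K).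
Implicit Types (t A B C : {fset point}) (a b c d g : point).

Lemma three_carrier A B C y : A \in K -> B \in K -> C \in K -> conv A y -> conv B y -> conv C y ->
  exists g, [/\ g \in A, g \in B & g \in C].
Proof.
move=> AK BK CK Ay By Cy; have [D [DK DA Dy]] := carrier_exists hK AK Ay.
have /fsubsetP DB := carrier_sub hK BK DK Dy By.
have /fsubsetP DC := carrier_sub hK CK DK Dy Cy.
have /fset0Pn[g gD] := simplex_neq0 hK DK.
by exists g; split; [exact: (fsubsetP DA)|exact: DB|exact: DC].
Qed.

(* The jump of a local solution between two triangles does not depend on the
   common vertex at which it is taken, so the jumps form a cocycle on the disk;
   its primitive glues the local solutions. *)
Lemma exactness (q : {fset point} -> R) :
  (forall g, g \in interior_vertices K ->
     \sum_(t <- interior_edges K | g \in t) eps g t * q t = 0) ->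
  exists P : {fset point} -> R, forall t, t \in interior_edges K ->
    \sum_(A <- triangles K | (t `<=` A)%fset) esgn t A * P A = q t.
Proof.
move=> hq.
have /choice[P hP] : forall g, exists P : {fset point} -> R, g \in vertices K ->
    forall t, t \in interior_edges K -> g \in t ->
    \sum_(A <- triangles K | (t `<=` A)%fset) esgn t A * P A = q t.
  move=> g; have [gV|gV] := boolP (g \in vertices K); last by exists (fun=> 0).
  by have [P hP] := local_exact hK hdisk gV (hq g); exists P.
(* Distinct triangles sharing [g] and [g'] share that interior edge, and both local solutions
   satisfy its equation. *)
have indep A B g g' : A \in triangles K -> B \in triangles K -> g \in A -> g \in B ->
    g' \in A -> g' \in B -> P g A - P g B = P g' A - P g' B.
  move=> AT BT gA gB gA' gB'; have [->|AB] := eqVneq A B; first by rewrite !subrr.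
  have [->//|gg] := eqVneq g g'.
  have sA : ([fset g; g'] `<=` A)%fset by apply/fsubsetP => z; rewrite !inE => /orP[] /eqP->.
  have sB : ([fset g; g'] `<=` B)%fset by apply/fsubsetP => z; rewrite !inE => /orP[] /eqP->.
  have EI := two_triangles_interior_edge hK AT BT AB gg sA sB.
  have gV := simplex_vertex hK (triangle_in_K AT) gA.
  have gV' := simplex_vertex hK (triangle_in_K AT) gA'.
  have [c [d [cT dT _ hcd dE]]] := @coboundaryE _ _ hK R^o g g' gg EI.
  have h1 : \sum_(C <- triangles K | ([fset g; g'] `<=` C)%fset) esgn [fset g; g']%fset C * P g C
      = \sum_(C <- triangles K | ([fset g; g'] `<=` C)%fset) esgn [fset g; g']%fset C * P g' C.
    by rewrite !hP // !inE eqxx ?orbT.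
  have {h1} := h1; rewrite (dE (P g)) (dE (P g')) => /(mulfI (eps_neq0 _ _)) h1.
  case: (hcd A AT sA) AB => ->; case: (hcd B BT sB) => -> AB; rewrite ?eqxx // in AB.
  by rewrite -[LHS]opprB h1 opprB.
pose cc A B := P (nth 0 (enum_fset (A `&` B)%fset) 0) A - P (nth 0 (enum_fset (A `&` B)%fset) 0) B.
have ccE A B g : A \in triangles K -> B \in triangles K -> g \in A -> g \in B ->
    cc A B = P g A - P g B.
  move=> AT BT gA gB; have gI : g \in (A `&` B)%fset by rewrite inE gA gB.
  have : nth 0 (enum_fset (A `&` B)%fset) 0 \in (A `&` B)%fset.
    by apply: mem_nth; rewrite -/(#|` (A `&` B)%fset|) cardfs_gt0; apply/fset0Pn; exists g.
  by rewrite inE => /andP[hA hB]; exact: indep.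
have [F [G FG]] := disk_chart_exists hdisk; have [[GX FD GK FK] [hG hF]] := FG.
have /choice[T hT] : forall z, exists A, disk z -> A \in triangles K /\ conv A (G z).
  move=> z; have [Dz|nDz] := pselect (disk z); last by exists fset0.
  have [A AK Az] := GX z Dz; have [B BT AB] := simplex_sub_triangle hK hdisk AK.
  by exists B => _; split=> //; exact: conv_sub AB _ Az.
(* A Lebesgue number: by compactness there is one distance within which simplices met at three
   points all pass through one point, hence have a common vertex. *)
have [e e0 he] : exists2 e : R, 0 < e & forall x y z, disk x -> disk y -> disk z ->
    `|y - x| < e -> `|z - x| < e -> forall A B C, A \in K -> B \in K -> C \in K ->
    conv A (G x) -> conv B (G y) -> conv C (G z) -> exists g, [/\ g \in A, g \in B & g \in C].
  pose Q (e : R) (x : point) := forall y z, disk x -> disk y -> disk z ->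
    `|y - x| < e -> `|z - x| < e -> forall A B C, A \in K -> B \in K -> C \in K ->
    conv A (G x) -> conv B (G y) -> conv C (G z) -> exists g, [/\ g \in A, g \in B & g \in C].
  have : \forall e \near (0 : R)^'+, disk `<=` Q e.
    move/compact_near_coveringP: (@disk_compact R); apply => x0 Dx0.
    have := hG x0 _ Dx0 (local_simplices K (G x0)).
    move=> /nbhs_ballP[r /= r0 hr].
    exists (ball x0 (r / 2), [set e : R | e < r / 2]) => /=.
      split; first by apply: nbhsx_ballx; rewrite divr_gt0.
      by apply: nbhs_right_lt; rewrite divr_gt0.
    move=> [x e] /= [+ er] y z Dx Dy Dz yx zx A B C AK BK CK Ax By Cz.
    rewrite -ball_normE /= => xx.
    have near u : disk u -> `|u - x| < e -> forall A, A \in K -> conv A (G u) -> conv A (G x0).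
      move=> Du ux; apply: hr => //; rewrite -ball_normE /=.
      have -> : x0 - u = (x0 - x) + (x - u) by rewrite addrA subrK.
      apply: le_lt_trans (ler_normD _ _) _; rewrite distrC in ux; lra.
    have e0' : 0 < e by apply: le_lt_trans yx.
    apply: (@three_carrier A B C (G x0)) => //.
    - by apply: (near x); rewrite ?subrr ?normr0.
    - exact: (near y).
    - exact: (near z).
  move=> nQ; have [e [e0 eQ]] : exists e : R, 0 < e /\ disk `<=` Q e.
    by near (0 : R)^'+ => e; exists e; split; near: e => //; exact: nbhs_right_gt.
  by exists e => // x y z Dx; apply: (eQ x Dx).
have [h hE] : exists h : point -> R, forall x y, disk x -> disk y -> `|x - y| < e / 2 ->
    h x - h y = cc (T x) (T y).
  apply: (disk_cocycle e0) => [x Dx|x y z Dx Dy Dz yx zx].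
    have [xT _] := hT x Dx; have /fset0Pn[g gT] := simplex_neq0 hK (triangle_in_K xT).
    by rewrite (ccE _ _ g) // subrr.
  have [xT xc] := hT x Dx; have [yT yc] := hT y Dy; have [zT zc] := hT z Dz.
  have [g [gx gy gz]] := he x y z Dx Dy Dz yx zx _ _ _ (triangle_in_K xT) (triangle_in_K yT) (triangle_in_K zT) xc yc zc.
  by rewrite !(ccE _ _ g) // addrA subrK.
(* Along a triangle [A] the primitive [h] changes by the jumps between the selected triangles;
   adding the jump from [A] makes it locally constant, hence constant, on [A]. *)
pose B A x := h (F x) + cc A (T (F x)).
have Bconst A : A \in triangles K -> forall x y, conv A x -> conv A y -> B A x = B A y.
  move=> AT; apply: connected_locally_constant; first by apply: convex_connected => x y t; exact: conv_convex.
  have AK := triangle_in_K AT.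
  move=> x Ax; have Xx : support K x by exists A.
  have e2 : 0 < e / 2 by rewrite divr_gt0.
  have := hF x _ Xx (nbhsx_ballx (F x) (e / 2) e2).
  apply: filterS => x' hx' Ax'; have Xx' : support K x' by exists A.
  have := hx' Xx'; rewrite -ball_normE /= => d'.
  have Dx := FD x Xx; have Dx' := FD x' Xx'.
  have [xT xc] := hT _ Dx; have [xT' xc'] := hT _ Dx'.
  have s0 : `|F x - F x| < e by rewrite subrr normr0.
  have s1 : `|F x' - F x| < e by rewrite distrC; apply: lt_trans d' _; lra.
  have Ax1 : conv A (G (F x)) by rewrite FK.
  have [g [gA gx gx']] := he _ _ _ Dx Dx Dx' s0 s1 A _ _ AK (triangle_in_K xT) (triangle_in_K xT') Ax1 xc xc'.
  have := hE _ _ Dx Dx' d'; rewrite /B !(ccE _ _ g) //; lra.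
have /choice[p hp] : forall A, exists x, A \in triangles K -> conv A x.
  move=> A; have [AT|AT] := boolP (A \in triangles K); last by exists 0.
  have /fset0Pn[g gA] := simplex_neq0 hK (triangle_in_K AT).
  by exists g => _; exact: conv_vertex.
exists (fun A => B A (p A)) => t tI.
have [a [b [ab tE]]] := edge_split0 (interior_edge_edge tI); rewrite tE in tI *.
have [c [d [cT dT _ _ dE]]] := @coboundaryE _ _ hK R^o a b ab tI.
have ac : a \in [fset a; b; c]%fset by rewrite !inE eqxx.
have ad : a \in [fset a; b; d]%fset by rewrite !inE eqxx.
have aV := simplex_vertex hK (triangle_in_K cT) ac.
rewrite -(hP a aV _ tI) ?inE ?eqxx // (dE (fun A => B A (p A))) (dE (P a)); congr (_ * _).
(* Both values are taken at the vertex [a], where the jumps are computed from [P a] and [h]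
   cancels. *)
rewrite (Bconst _ cT _ a (hp _ cT)) ?(Bconst _ dT _ a (hp _ dT)); [|exact: conv_vertex..].
have Xa : support K a by exists [fset a; b; c]%fset; [exact: triangle_in_K|exact: conv_vertex].
have [aT Ta] := hT _ (FD a Xa); rewrite FK // in Ta.
have aT' := conv_vertex_mem hK (triangle_in_K aT) aV Ta.
by rewrite /B !(ccE _ _ a) //; lra.
Unshelve. all: by end_near.
Qed.

End Exactness.

(** * Vertex ideals in large degree *)

Section Surjectivity.
Context {R : realType}.
Local Notation S := (mpoly 3 R).
Local Notation point := 'rV[R]_2.
Context (K : {fset {fset point}}) (hK : simplicial_complex K) (hdisk : disk_complex K).
Context (r : {fset point} -> nat) (s : point -> nat) (ell : {fset point} -> S).
Context (hell : forall tau, tau \in edges K -> vanishing_linear_form tau (ell tau)).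
Local Notation J := (J_edge r s ell).
Local Notation IE := (interior_edges K).
Local Notation IV := (interior_vertices K).
Implicit Types (t A : {fset point}) (a b c g : point) (p q F : S).

Lemma hat_embed A a : a \in A -> hat A (embed a).
Proof.
move=> aA; apply: conv_vertex; rewrite in_fset1U; apply/orP; right.
by apply/imfsetP; exists a.
Qed.

Lemma ell_facts a b : a != b -> [fset a; b]%fset \in edges K ->
  [/\ ell [fset a; b]%fset != 0, ell [fset a; b]%fset \is hom 1,
    peval (ell [fset a; b]%fset) (embed a) = 0 & peval (ell [fset a; b]%fset) (embed b) = 0].
Proof.
move=> ab /hell[l0 l1 lv]; split=> //; apply: lv; apply: hat_embed; rewrite !inE eqxx ?orbT //.
Qed.

Lemma ell_lin t : t \in edges K -> ell t \is hom 1.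
Proof. by move=> /hell[]. Qed.

Lemma J_ideal t : t \in edges K -> is_ideal (J t).
Proof.
move=> tE; have [a [b [ab tab]]] := edge_split0 tE; rewrite tab in tE *.
by have [l0 l1 la lb] := ell_facts ab tE; exact: J_edge_ideal.
Qed.

Lemma J_pihomog t d p : t \in edges K -> J t p -> J t (pihomog (@mdeg 3) d p).
Proof.
move=> tE; have [a [b [ab tab]]] := edge_split0 tE; rewrite tab in tE *.
by have [l0 l1 la lb] := ell_facts ab tE; exact: J_edge_pihomog.
Qed.

Lemma J_fg t : t \in edges K -> exists L : 'I_3 -> S, (forall i, L i \is hom 1) /\
  forall D, exists d0, forall d p, (d0 <= d)%N -> J t p -> p \is hom d ->
    exists2 q : 'I_3 -> S, forall i, J t (q i) & p = \sum_i L i ^+ D * q i.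
Proof.
move=> tE; have [a [b [ab tab]]] := edge_split0 tE; rewrite tab in tE *.
by have [l0 l1 la lb] := ell_facts ab tE; exact: J_edge_fg.
Qed.

Lemma J_exp : exists k, forall t, t \in IE -> J t (ell t ^+ k).
Proof.
exists (\max_(t <- IE) r t + \max_(v <- vertices K) s v).+1 => t tI.
have tE := interior_edge_edge tI; have tK := edge_in_K tE.
have rk : (r t <= \max_(t <- IE) r t)%N by exact: leq_bigmax_seq.
have sk v : v \in t -> (s v <= \max_(v <- vertices K) s v)%N.
  by move=> vt; apply: leq_bigmax_seq => //; exact: simplex_vertex vt.
have [a [b [ab tab]]] := edge_split0 tE.
have [l0 l1 la lb] : [/\ ell t != 0, ell t \is hom 1,
    peval (ell t) (embed a) = 0 & peval (ell t) (embed b) = 0].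
  by rewrite tab; apply: ell_facts => //; rewrite -tab.
have sa := sk a; have sb := sk b; rewrite tab in l0 l1 la lb rk sa sb *.
apply: J_edge_exp => //; rewrite ltnS.
- exact: leq_trans rk (leq_addr _ _).
- by apply: leq_trans (sa _) (leq_addl _ _); rewrite !inE eqxx.
- by apply: leq_trans (sb _) (leq_addl _ _); rewrite !inE eqxx orbT.
Qed.

(** The image of the boundary map on the direct sum of all [J t]; values of [f] off the interior
    vertices are disregarded. *)
Definition in_image (f : point -> S) := exists q : {fset point} -> S,
  (forall t, t \in IE -> J t (q t)) /\
  forall g, g \in IV -> f g = \sum_(t <- IE | g \in t) eps g t *: q t.

Definition spike g p : point -> S := fun g' => if g' == g then p else 0.

Lemma in_image_ext f f' : (forall g, g \in IV -> f g = f' g) -> in_image f -> in_image f'.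
Proof. by move=> ff' [q [qJ qf]]; exists q; split=> // g gI; rewrite -ff' // qf. Qed.

Lemma in_image0 : in_image (fun=> 0).
Proof.
exists (fun=> 0); split=> [t tI|g _]; first by have [] := J_ideal (interior_edge_edge tI).
by rewrite big1 // => t _; rewrite scaler0.
Qed.

Lemma in_imageD f f' : in_image f -> in_image f' -> in_image (fun g => f g + f' g).
Proof.
move=> [q [qJ qf]] [q' [qJ' qf']]; exists (fun t => q t + q' t); split=> [t tI|g gI].
  by have [_ JD _] := J_ideal (interior_edge_edge tI); apply: JD; [exact: qJ|exact: qJ'].
by rewrite qf // qf' // -big_split; apply: eq_bigr => t _; rewrite scalerDr.
Qed.

Lemma in_imageM p f : in_image f -> in_image (fun g => p * f g).
Proof.
move=> [q [qJ qf]]; exists (fun t => p * q t); split=> [t tI|g gI].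
  by have [_ _ JM] := J_ideal (interior_edge_edge tI); apply: JM; exact: qJ.
by rewrite qf // mulr_sumr; apply: eq_bigr => t _; rewrite scalerAr.
Qed.

Lemma in_imageZ (k : R) f : in_image f -> in_image (fun g => k *: f g).
Proof.
move=> /(in_imageM (mpolyC 3 k)); apply: in_image_ext => g _; exact: mul_mpolyC.
Qed.

Lemma in_image_sum (I : eqType) (u : seq I) (f : I -> point -> S) :
  (forall i, i \in u -> in_image (f i)) -> in_image (fun g => \sum_(i <- u) f i g).
Proof.
elim: u => [|i u IH] h.
  by apply: in_image_ext in_image0 => g _; rewrite big_nil.
apply: in_image_ext (in_imageD (h i (mem_head _ _)) (IH _)) => [g _|j ju].
  by rewrite big_cons.
by apply: h; rewrite inE ju orbT.
Qed.

(** The image of an element [p] of [J t] is [p], up to sign, at both ends of [t], so a spike can be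
    moved from one end to the other. At a boundary end nothing is required, since its component is
    disregarded. *)
Lemma edge_transfer a b p : a != b -> [fset a; b]%fset \in IE -> J [fset a; b]%fset p ->
  (a \in IV -> in_image (spike a p)) -> (b \in IV -> in_image (spike b p)).
Proof.
move=> ab EI Jp ha bI; set t := [fset a; b]%fset in EI Jp *.
pose f g := if g \in t then eps g t *: p else 0.
have push : in_image f.
  exists (fun t' => if t' == t then p else 0); split=> [t' tI'|g gI].
    by case: eqP => [->//|_]; have [] := J_ideal (interior_edge_edge tI').
  rewrite big_mkcond (bigD1_seq t) ?fset_uniq //= eqxx big1 ?addr0 // => t' /negbTE->.
  by rewrite scaler0 if_same.
have bt : b \in t by rewrite !inE eqxx orbT.
have at_ : a \in t by rewrite !inE eqxx.
have ft g : g != a -> g != b -> f g = 0.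
  by move=> ga gb; rewrite /f !inE (negbTE ga) (negbTE gb).
have fa : f a = eps a t *: p by rewrite /f at_.
have fb : f b = eps b t *: p by rewrite /f bt.
have [aI|aI] := boolP (a \in IV).
  have := in_imageZ (eps b t) (in_imageD push (in_imageZ (- eps a t) (ha aI))).
  apply: in_image_ext => g gI; rewrite /spike.
  have [->|ga] := eqVneq g a.
    by rewrite (negbTE ab) fa scaleNr subrr scaler0.
  rewrite scaler0 addr0; have [->|gb] := eqVneq g b; first by rewrite fb scalerA eps_sqr scale1r.
  by rewrite ft // scaler0.
have := in_imageZ (eps b t) push; apply: in_image_ext => g gI; rewrite /spike.
have [->|gb] := eqVneq g b; first by rewrite fb scalerA eps_sqr scale1r.
rewrite ft ?scaler0 //; by apply: contraNneq aI => <-.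
Qed.

(** [F] kills the cokernel of the boundary map: the spikes of elements of [J t] at an end of [t]
    generate the direct sum of the vertex ideals. *)
Definition annihilates F := forall g t q, g \in IV -> t \in IE -> g \in t -> J t q ->
  in_image (spike g (F * q)).

Lemma annihilatesD F G : annihilates F -> annihilates G -> annihilates (F + G).
Proof.
move=> hF hG g t q gI tI gt Jq; have := in_imageD (hF g t q gI tI gt Jq) (hG g t q gI tI gt Jq).
by apply: in_image_ext => g' _; rewrite /spike; case: eqP => _; rewrite ?addr0 // mulrDl.
Qed.

Lemma annihilatesM p F : annihilates F -> annihilates (p * F).
Proof.
move=> hF g t q gI tI gt Jq; have := in_imageM p (hF g t q gI tI gt Jq).
by apply: in_image_ext => g' _; rewrite /spike; case: eqP => _; rewrite ?mulr0 // mulrA.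
Qed.

Lemma annihilates0 : annihilates 0.
Proof.
move=> g t q _ _ _ _; apply: in_image_ext in_image0 => g' _.
by rewrite /spike mul0r if_same.
Qed.

Lemma triangle_basis a b c : det a b c != 0 -> rows3 (embed a) (embed b) (embed c) \in unitmx.
Proof.
move=> d; apply: rows3_unit => x y z h.
have h0 := congr1 (fun u : 'rV[R]_3 => u 0 o0) h.
have h1 := congr1 (fun u : 'rV[R]_3 => u 0 o1) h.
have h2 := congr1 (fun u : 'rV[R]_3 => u 0 o2) h.
rewrite /= !rvE !embedE in h0 h1 h2.
have xE : x = - y - z by lra.
rewrite xE in h0 h1.
have z0 : z * det a b c = 0.
  have -> : z * det a b c = (b 0 i0 - a 0 i0) * ((- y - z) * a 0 i1 + y * b 0 i1 + z * c 0 i1) -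
    (b 0 i1 - a 0 i1) * ((- y - z) * a 0 i0 + y * b 0 i0 + z * c 0 i0) by rewrite /det; ring.
  by rewrite h0 h1 !mulr0 subrr.
have y0 : y * det a b c = 0.
  have -> : y * det a b c = (c 0 i1 - a 0 i1) * ((- y - z) * a 0 i0 + y * b 0 i0 + z * c 0 i0) -
    (c 0 i0 - a 0 i0) * ((- y - z) * a 0 i1 + y * b 0 i1 + z * c 0 i1) by rewrite /det; ring.
  by rewrite h0 h1 !mulr0 subrr.
move/eqP: z0; rewrite mulf_eq0 (negbTE d) orbF => /eqP z0.
move/eqP: y0; rewrite mulf_eq0 (negbTE d) orbF => /eqP y0.
by rewrite xE y0 z0; split; ring.
Qed.

Lemma triangle_decomp a b c (P : 'rV[R]_3) : det a b c != 0 ->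
  exists x y z, P = x *: embed a + y *: embed b + z *: embed c.
Proof.
move=> /triangle_basis u; exists ((P *m invmx (rows3 (embed a) (embed b) (embed c))) 0 o0),
  ((P *m invmx (rows3 (embed a) (embed b) (embed c))) 0 o1),
  ((P *m invmx (rows3 (embed a) (embed b) (embed c))) 0 o2).
by rewrite -mul_rows3 mulmxKV.
Qed.

Lemma ell_third a b c : det a b c != 0 -> [fset a; b]%fset \in edges K ->
  peval (ell [fset a; b]%fset) (embed c) != 0.
Proof.
move=> d tE; have [ab _ _] := det_neq d; have [l0 l1 la lb] := ell_facts ab tE.
apply: contraNneq l0 => lc; apply/eqP/peval_eq0 => P.
have [x [y [z ->]]] := triangle_decomp P d.
by rewrite !peval_linD // !peval_linZ // la lb lc !mulr0 !addr0.
Qed.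

Section CommonZero.
Context (P : 'rV[R]_3) (P0 : P != 0) (F : S).
Hypothesis FJ : forall t, t \in IE -> peval (ell t) P != 0 -> J t F.

(** [P] ranges over all nonzero vectors of space; at infinity, or over no vertex, it has no apex
    among the vertices. *)
Let apex a := exists k : R, P = k *: embed a.

Let apex_inj a b : apex a -> apex b -> a = b.
Proof.
move=> [c cE] [d dE]; have e := cE; rewrite dE in e.
have e2 := congr1 (fun u : 'rV[R]_3 => u 0 o2) e.
rewrite /= !rvE !embedE !mulr1 in e2; rewrite e2 in e.
have c0 : c != 0 by apply: contraNneq P0 => c0; rewrite cE c0 scale0r.
have {}e := scalerI c0 e.
apply: row2P; rewrite -?embed_o0 -?embed_o1 ?e //.
Qed.

Let null G a := a \in IV -> in_image (spike a G).

(** If the edge is on the boundary, so is its end [b], where [null] is vacuous. *)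
Let edge_null G a b : (forall t, t \in IE -> peval (ell t) P != 0 -> J t G) ->
  a != b -> [fset a; b]%fset \in edges K -> peval (ell [fset a; b]%fset) P != 0 ->
  null G a -> null G b.
Proof.
move=> GJ ab tE lP; have [tI|tI] := boolP ([fset a; b]%fset \in IE).
  by apply: edge_transfer => //; exact: GJ.
move=> _ bI; move/negP: tI; case; apply: (interior_vertex_edge bI tE).
by rewrite !inE eqxx orbT.
Qed.

(** The edge [ab] serves unless the plane over it contains [P]. Then, as neither end is the apex,
    [P] has nonzero components along both; the planes over [ac] and [cb] miss it, and the detour by
    [c] works. *)
Let triangle_null G A a b : (forall t, t \in IE -> peval (ell t) P != 0 -> J t G) ->
  A \in triangles K -> a \in A -> b \in A -> ~ apex a -> ~ apex b -> null G a -> null G b.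
Proof.
move=> GJ AT aA bA na nb; have [<-//|ab] := eqVneq a b.
have sA : ([fset a; b] `<=` A)%fset by apply/fsubsetP => z; rewrite !inE => /orP[] /eqP->.
have [c [d AE]] := triangle_edge hK AT ab sA.
have [_ ac bc] := det_neq d; have [Eab Eac Ebc] := triangle_faces hK AT AE d.
have [x [y [z PE]]] := triangle_decomp P d.
have [_ l1 la lb] := ell_facts ab Eab.
have [z0|z0] := eqVneq z 0; last first.
  apply: edge_null => //; rewrite PE !peval_linD // !peval_linZ // la lb !mulr0 !add0r.
  by rewrite mulf_neq0 // ell_third.
have x0 : x != 0.
  by apply/eqP => x0; apply: nb; exists y; rewrite PE x0 z0 !scale0r add0r addr0.
have y0 : y != 0.
  by apply/eqP => y0; apply: na; exists x; rewrite PE y0 z0 !scale0r !addr0.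
have [_ m1 ma mc] := ell_facts ac Eac; have [_ k1 kb kc] := ell_facts bc Ebc.
move=> ha; have cb : c != b by rewrite eq_sym.
have Ecb : [fset c; b]%fset \in edges K by rewrite fsetUC.
have hc : null G c.
  apply: edge_null ha => //; rewrite PE !peval_linD // !peval_linZ // ma mc !mulr0 add0r addr0.
  rewrite mulf_neq0 //; apply: ell_third => //.
  by rewrite (_ : det a c b = - det a b c) ?oppr_eq0 // /det; ring.
apply: edge_null hc => //; rewrite fsetUC PE !peval_linD // !peval_linZ // kb kc !mulr0 !addr0.
by rewrite mulf_neq0 //; apply: ell_third => //; rewrite det_cyc.
Qed.

(* Multiples of [F] can be moved along every edge whose line misses [P], and they
   vanish at a boundary vertex. At most one vertex, the apex, lies under [P], and
   there are two boundary vertices, so one of them is not the apex. *)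
Lemma common_zero_annihilates : annihilates F.
Proof.
move=> g t q gI tI gt Jq; pose G := F * q.
have GJ t' : t' \in IE -> peval (ell t') P != 0 -> J t' G.
  move=> tI' lP; have [_ _ JM] := J_ideal (interior_edge_edge tI').
  by rewrite /G mulrC; apply: JM; exact: FJ.
have [v [w [vV wV vw vB wB]]] := two_boundary_vertices hK hdisk.
have [u uV [uB nu]] : exists2 u, u \in vertices K & u \notin IV /\ ~ apex u.
  have [av|nv] := pselect (apex v); last by exists v.
  by exists w => //; split=> // aw; move/eqP: vw; apply; exact: apex_inj.
have uK : [fset u]%fset \in K by rewrite -in_vertices.
have [A0 A0T uA0] := simplex_sub_triangle hK hdisk uK; rewrite fsub1set in uA0.
have all : forall A, A \in triangles K -> forall b, b \in A -> ~ apex b -> null G b.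
  apply: (strongly_connected hK hdisk A0T) => [b bA nb|A B a b AT BT AB ab sA sB _ hA c cB nc].
    by apply: (triangle_null GJ A0T uA0 bA nu nb); rewrite /null (negbTE uB).
  have aA : a \in A by apply: (fsubsetP sA); rewrite !inE eqxx.
  have bA : b \in A by apply: (fsubsetP sA); rewrite !inE eqxx orbT.
  have aB : a \in B by apply: (fsubsetP sB); rewrite !inE eqxx.
  have bB : b \in B by apply: (fsubsetP sB); rewrite !inE eqxx orbT.
  have [na|na] := pselect (apex a); last by apply: (triangle_null GJ BT aB cB na nc); exact: hA.
  have nb : ~ apex b by move=> nb; move/eqP: ab; apply; exact: apex_inj.
  by apply: (triangle_null GJ BT bB cB nb nc); exact: hA.
have null_vertex b : b \in vertices K -> ~ apex b -> null G b.
  move=> bV; have bK : [fset b]%fset \in K by rewrite -in_vertices.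
  have [A AT bA] := simplex_sub_triangle hK hdisk bK; rewrite fsub1set in bA.
  exact: (all A AT b bA).
have tE := interior_edge_edge tI.
have gV : g \in vertices K by exact: simplex_vertex (edge_in_K tE) gt.
(* At the apex the plane over every edge contains [P]; but [t] itself carries [q], hence [G], and
   its other end is not the apex. *)
have [ag|ng] := pselect (apex g); last exact: null_vertex.
have [b gb tgb] := edge_split tE gt.
have bg : b != g by rewrite eq_sym.
have tbg : t = [fset b; g]%fset by rewrite tgb fsetUC.
have JG : J [fset b; g]%fset G.
  by rewrite -tbg; have [_ _ JM] := J_ideal tE; exact: JM.
apply: (edge_transfer bg _ JG) => //; first by rewrite -tbg.
apply: null_vertex.
  by apply: (simplex_vertex hK (edge_in_K tE)); rewrite tgb !inE eqxx orbT.
by move=> ab; move/eqP: gb; apply; exact: apex_inj.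
Qed.

End CommonZero.

(** The radical of the ideal of all multipliers that, times [F], annihilate the cokernel; a sum of
    two of its elements needs only a larger exponent. *)
Definition radical_annihilates F p := exists D, annihilates (p ^+ D * F).

Lemma radicalD F p q : radical_annihilates F p -> radical_annihilates F q ->
  radical_annihilates F (p + q).
Proof.
move=> [D hD] [D' hD']; exists (D + D')%N; rewrite exprDn mulr_suml.
elim/big_ind: _ => [||i _]; [exact: annihilates0|exact: annihilatesD|].
rewrite -mulr_natl -mulrA; apply: annihilatesM.
have [h|h] := leqP D' i.
  rewrite -(subnK h) exprD; set u := q ^+ D'; set v := q ^+ _; set w := p ^+ _.
  have -> : w * (v * u) * F = (w * v) * (u * F) by ring.
  exact: annihilatesM.
have h' : (D <= D + D' - i)%N by lia.
rewrite -(subnK h') exprD; set u := p ^+ D; set v := p ^+ _; set w := q ^+ _.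
have -> : v * u * w * F = (v * w) * (u * F) by ring.
exact: annihilatesM.
Qed.

Lemma radicalM F p q : radical_annihilates F p -> radical_annihilates F (q * p).
Proof. by move=> [D hD]; exists D; rewrite exprMn -mulrA; exact: annihilatesM. Qed.

(* Induction on the number of edges outside [T]. If their lines have a common
   zero, [common_zero_annihilates] applies; otherwise their forms span all linear
   forms, and each of them can be moved into [T]. *)
Lemma radical_annihilates_lin : forall l : S, l \is hom 1 -> radical_annihilates 1 l.
Proof.
have [k hk] := J_exp.
pose FT (T : {fset {fset point}}) : S := \prod_(t <- T) ell t ^+ k.
suff main : forall n (T : {fset {fset point}}), (T `<=` IE)%fset -> (#|` (IE `\` T)%fset| <= n)%N ->
    forall l : S, l \is hom 1 -> radical_annihilates (FT T) l.
  move=> l hl; have := main _ fset0 (fsub0set _) (leqnn _) l hl.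
  by rewrite /FT big_seq_fset0.
elim=> [|n IH] T TI Tn l hl.
  have TE : (IE `<=` T)%fset by rewrite -fsetD_eq0 -cardfs_eq0 -leqn0.
  (* With all interior edges in [T], the product [FT T] already lies in every [J t], so any nonzero
     point can serve. *)
  exists 0%N; rewrite expr0 mul1r; apply: (@common_zero_annihilates (embed 0)).
    by apply/eqP => /(congr1 (fun u : 'rV[R]_3 => u 0 o2)); rewrite /= embedE rv0 => /eqP; rewrite oner_eq0.
  move=> t tI _; have [_ _ JM] := J_ideal (interior_edge_edge tI).
  rewrite /FT (bigD1_seq t) ?fset_uniq ?(fsubsetP TE) //= mulrC; apply: JM; exact: hk.
pose C := (IE `\` T)%fset.
pose m := #|` C|; pose Ct (j : 'I_m) := nth fset0 (enum_fset C) j.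
have CtP j : Ct j \in IE /\ Ct j \notin T.
  have h : Ct j \in C by exact: mem_nth.
  by move: h; rewrite in_fsetD => /andP[].
(* The rows are the forms of the edges outside [T]: full column rank means that they span all linear
   forms, and otherwise they have a common nonzero zero. *)
pose M : 'M[R]_(m, 3) := \matrix_(j, i) mcoeff (mnm1 i) (ell (Ct j)).
have ellM j P : peval (ell (Ct j)) P^T = (M *m P) j 0.
  have [tI _] := CtP j; rewrite peval_lin ?(ell_lin (interior_edge_edge tI)) //.
  by rewrite mxE; apply: eq_bigr => i _; rewrite mxE [M _ _]mxE.
have [full|nfull] := boolP (row_full M).
  have rad_ell j : radical_annihilates (FT T) (ell (Ct j)).
    have [tI tT] := CtP j; pose T' := (Ct j |` T)%fset.
    have T'I : (T' `<=` IE)%fset by rewrite fsubUset fsub1set tI.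
    have T'n : (#|` (IE `\` T')%fset| <= n)%N.
      have -> : (IE `\` T' = (IE `\` T) `\ Ct j)%fset by rewrite /T' fsetDDl fsetUC.
      move: Tn; rewrite (cardfsD1 (Ct j)) in_fsetD tI tT add1n ltnS //.
    have [D hD] := IH T' T'I T'n _ (ell_lin (interior_edge_edge tI)).
    (* Moving the edge into [T] multiplies [FT T] by the [k]-th power of its form, which the
       exponent absorbs. *)
    exists (D + k)%N; move: hD.
    have -> : FT T' = ell (Ct j) ^+ k * FT T by rewrite /FT big_fsetU1.
    by rewrite mulrA -exprD.
  have [w wE] : exists w : 'rV[R]_m, (\row_i mcoeff (mnm1 i) l) = w *m M.
    by apply/submxP/submx_full.
  have -> : l = \sum_j mpolyC 3 (w 0 j) * ell (Ct j).
    apply: peval_inj => x; rewrite peval_lin // peval_sum.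
    under [RHS]eq_bigr => j _.
      have [tI _] := CtP j.
      rewrite pevalM pevalC (peval_lin x (ell_lin (interior_edge_edge tI))) mulr_sumr.
      over.
    rewrite exchange_big; apply: eq_bigr => i _ /=.
    have := congr1 (fun u : 'rV[R]_3 => u 0 i) wE; rewrite /= !mxE => ->.
    by rewrite mulr_suml; apply: eq_bigr => j _; rewrite [M _ _]mxE mulrA.
  elim/big_ind: _ => [||j _]; [|exact: radicalD|exact: radicalM].
  by exists 1%N; rewrite expr1 mul0r; exact: annihilates0.
exists 0%N; rewrite expr0 mul1r.
(* A nonzero column of the cokernel is killed by every row of [M]: it is the common zero. *)
have ck : cokermx M != 0.
  by rewrite -mxrank_eq0 mxrank_coker subn_eq0 -ltnNge ltn_neqAle nfull rank_leq_col.
have [j Pj] : exists j, col j (cokermx M) != 0.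
  apply: contrapT => h; move/eqP: ck; apply; apply/matrixP => i j; rewrite [RHS]mxE.
  have [e|e] := eqVneq (col j (cokermx M)) 0; last by case: h; exists j.
  by have := congr1 (fun u : 'cV[R]_3 => u i 0) e; rewrite !mxE.
apply: (@common_zero_annihilates (col j (cokermx M))^T).
  by apply: contraNneq Pj => h; rewrite -[col j _]trmxK h trmx0.
move=> t tI; have [tT _|tT] := boolP (t \in T).
  have [_ _ JM] := J_ideal (interior_edge_edge tI).
  rewrite /FT (bigD1_seq t) ?fset_uniq //= mulrC; apply: JM; exact: hk.
have tC : t \in C by rewrite in_fsetD tI tT.
have il : (index t (enum_fset C) < m)%N by rewrite index_mem.
have tE : Ct (Ordinal il) = t by exact: nth_index.
rewrite -tE ellM colE mulmxA mulmx_coker mul0mx mxE eqxx //.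
Qed.

(** A power of each of the three forms given by [J_fg] annihilates the cokernel, so in large degree
    elements of [J t] have their spikes in the image. The bound is the largest over the interior
    edges. *)
Lemma vertex_surjective : exists d0 : nat, forall d, (d0 <= d)%N -> forall p : point -> S,
  (forall g, g \in IV -> J_vertex K r s ell g (p g) /\ p g \is hom d) ->
  exists q : {fset point} -> S, (forall t, t \in IE -> J t (q t) /\ q t \is hom d) /\
    forall g, g \in IV -> p g = \sum_(t <- IE | g \in t) eps g t *: q t.
Proof.
have edge_d0 t : exists d0 : nat, t \in IE -> forall d p g, (d0 <= d)%N -> J t p -> p \is hom d ->
    g \in IV -> g \in t -> in_image (spike g p).
  have [tI|tI] := boolP (t \in IE); last by exists 0%N.
  have [L [L1 hL]] := J_fg (interior_edge_edge tI).
  have [D hD] : exists D, forall i, annihilates (L i ^+ D).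
    have /choice[Di hDi] : forall i, exists D, annihilates (L i ^+ D).
      by move=> i; have [D] := radical_annihilates_lin (L1 i); rewrite mulr1; exists D.
    exists (\max_i Di i)%N => i; rewrite -(subnK (leq_bigmax i)) exprD.
    exact: annihilatesM.
  have [d0 hd0] := hL D; exists d0 => _ d p g dd Jp hp gI gt.
  have [q qJ ->] := hd0 d p dd Jp hp.
  apply: in_image_ext (in_image_sum (fun i _ => hD i g t (q i) gI tI gt (qJ i))) => g' _.
  rewrite /spike; case: eqP => // _; exact: big1.
have /choice[d0 hd0] := edge_d0.
exists (\max_(t <- IE) d0 t)%N => d dd p hp.
have [q [qJ qE]] : in_image p.
  have : in_image (fun g => \sum_(v <- IV) spike v (p v) g).
    apply: in_image_sum => v vI; have [[q [qJ pE]] pd] := hp v vI.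
    have -> : p v = \sum_(t <- IE | v \in t) pihomog (@mdeg 3) d (q t).
      by rewrite -linear_sum /= -pE pihomog_dE.
    have : in_image (fun g => \sum_(t <- [fset t in IE | v \in t]%fset) spike v (pihomog (@mdeg 3) d (q t)) g).
      apply: in_image_sum => t; rewrite in_fset_cond => /andP[tI vt].
      apply: (hd0 t tI d _ v) => //.
      - by apply: leq_trans dd; exact: leq_bigmax_seq.
      - by apply: J_pihomog; [exact: interior_edge_edge|exact: qJ].
      - exact: pihomogP.
    apply: in_image_ext => g gI; rewrite /spike; case: eqP => // _; last by rewrite big1.
    by rewrite [RHS]big_fset_condE.
  apply: in_image_ext => g gI; rewrite (bigD1_seq g) ?fset_uniq //= /spike eqxx big1 ?addr0 //.
  by move=> v; rewrite eq_sym => /negbTE->.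
(* The preimage found need not be homogeneous; as [J t] is graded, its part of degree [d] can be
   taken. *)
exists (fun t => pihomog (@mdeg 3) d (q t)); split=> [t tI|g gI].
  split; last exact: pihomogP.
  by apply: J_pihomog; [exact: interior_edge_edge|exact: qJ].
have [_ pd] := hp g gI; rewrite -(pihomog_dE pd) (qE g gI) linear_sum.
by apply: eq_bigr => t _; rewrite linearZ.
Qed.

End Surjectivity.

(** * Splines as families of homogeneous polynomials *)

Section Splines.
Context {R : realType}.
Local Notation S := (mpoly 3 R).
Local Notation point := 'rV[R]_2.
Context (K : {fset {fset point}}) (hK : simplicial_complex K) (hdisk : disk_complex K).
Context (r : {fset point} -> nat) (s : point -> nat) (ell : {fset point} -> S).
Context (hell : forall tau, tau \in edges K -> vanishing_linear_form tau (ell tau)).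
Context (d : nat).
Local Notation J := (J_edge r s ell).
Local Notation X := (support K).
Implicit Types (t A B : {fset point}) (a b c x y g : point) (Q : {fset point} -> S).

Definition edge_cond Q := forall t A B, t \in interior_edges K -> A \in triangles K ->
  B \in triangles K -> (t `<=` A)%fset -> (t `<=` B)%fset -> J t (Q A - Q B).

Lemma ideal_gen_root (l p : S) k v : ideal_gen [set l ^+ k.+1] p -> peval l v = 0 -> peval p v = 0.
Proof.
move=> [n [u [h [hl ->]]]] lv; rewrite peval_sum big1 // => i _.
by rewrite pevalM (hl i) pevalXn lv expr0n mulr0.
Qed.

Lemma edge_cond_vertex Q g A B : edge_cond Q -> A \in triangles K -> B \in triangles K ->
  g \in A -> g \in B -> ideal_pow (vertex_ideal g) (s g).+1 (Q A - Q B).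
Proof.
move=> hQ AT BT gA gB; have [I0 ID _] : is_ideal (ideal_pow (vertex_ideal g : set S) (s g).+1) by exact: ideal_gen_ideal.
apply: (@star_connected _ K hK hdisk g (fun B => ideal_pow (vertex_ideal g) (s g).+1 (Q A - Q B)) A) => //.
  by rewrite subrr.
move=> C D b CT DT CD gb sC sD EI hC.
have [_ /(_ g)] := hQ _ C D EI CT DT sC sD; rewrite /= !inE eqxx => /(_ isT) hCD.
by have := ID _ _ hC hCD; rewrite addrA subrK.
Qed.

Lemma edge_cond_derivs Q g A B m : (forall A, A \in triangles K -> Q A \is hom d) ->
  edge_cond Q -> A \in triangles K -> B \in triangles K -> g \in A -> g \in B ->
  (mdeg m <= s g)%N ->
  peval (mderivm m (dehom (Q A))) g = peval (mderivm m (dehom (Q B))) g.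
Proof.
move=> Qd hQ AT BT gA gB ms.
have hd : Q A - Q B \is hom d by apply: rpredB; exact: Qd.
have := iffRL (vertex_smoothP (s g) g hd) (edge_cond_vertex hQ AT BT gA gB) m ms.
by rewrite dehomB mderivmB pevalB => /eqP; rewrite subr_eq0 => /eqP.
Qed.

(** A common point lies in the open part of a common face: at a vertex the derivative of order 0 is
    used, on an edge the vanishing of its form. *)
Lemma edge_cond_value Q x A B : (forall A, A \in triangles K -> Q A \is hom d) ->
  edge_cond Q -> A \in triangles K -> B \in triangles K -> conv A x -> conv B x ->
  peval (Q A) (embed x) = peval (Q B) (embed x).
Proof.
move=> Qd hQ AT BT Ax Bx; have AK := triangle_in_K AT; have BK := triangle_in_K BT.
have [C [CK CA Cx]] := carrier_exists hK AK Ax.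
have CB := carrier_sub hK BK CK Cx Bx.
case: (simplex_card hK CK) => [C1|C2|C3].
- move/eqP/cardfs1P: C1 => [g CE]; rewrite CE fsub1set in CA; rewrite CE fsub1set in CB.
  have xg : x = g.
    by move: Cx; rewrite CE => -[l [_ _]]; rewrite !big_seq_fset1 => -> ->; rewrite scale1r.
  have := edge_cond_derivs Qd hQ AT BT CA CB (_ : mdeg mnm0 <= s g)%N.
  by rewrite mdeg0 !mderivm0m !peval_dehom xg => /(_ isT).
- have CEd : C \in edges K by rewrite in_edges CK C2.
  have [a [b [ab CE]]] := edge_split0 CEd; rewrite CE in CA CB CEd Cx.
  have [->//|AB] := eqVneq A B.
  have EI := two_triangles_interior_edge hK AT BT AB ab CA CB.
  have [hl _] := hQ _ A B EI AT BT CA CB.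
  apply/eqP; rewrite -subr_eq0 -pevalB; apply/eqP; apply: ideal_gen_root hl _.
  have [_ l1 la lb] := ell_facts hell ab CEd.
  have [u _ ->] := iffLR (open_conv2P _ ab) Cx.
  have -> : embed ((1 - u) *: a + u *: b) = (1 - u) *: embed a + u *: embed b.
    by apply: row3P; rewrite !rvE !embedE ?rvE //; ring.
  by rewrite peval_linD // !peval_linZ // la lb !mulr0 addr0.
- have eqC D : D \in triangles K -> (C `<=` D)%fset -> C = D.
    by rewrite in_triangles => /andP[_ /eqP D3] CD; apply/eqP; rewrite eqEfcard CD C3 D3.
  by rewrite -(eqC A AT CA) -(eqC B BT CB).
Qed.

(** Both sides are affine in [x], vanish on the line [ab] and agree at [c]. *)
Lemma ell_det a b c x : det a b c != 0 -> [fset a; b]%fset \in edges K ->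
  peval (ell [fset a; b]%fset) (embed x) =
    peval (ell [fset a; b]%fset) (embed c) / det a b c * det a b x.
Proof.
move=> dt tE; have [ab _ _] := det_neq dt; have [_ l1 la lb] := ell_facts hell ab tE.
have -> : embed x = bary a b c x *: embed a + bary b c a x *: embed b + bary c a b x *: embed c.
  have e := bary_comb x dt; have e2 := bary_sum x dt; apply: row3P; rewrite !rvE !embedE ?mulr1 //.
  - by rewrite {1}e !rvE.
  - by rewrite {1}e !rvE.
rewrite !peval_linD // !peval_linZ // la lb !mulr0 !add0r /bary; ring.
Qed.

(** [T] selects a triangle through each point of the support; under [edge_cond] the value does not
    depend on the selection. *)
Definition spline_of (T : X -> {fset point}) Q : X -> R^o :=
  fun x : X => peval (Q (T x)) (embed (val x)).

Context (T : X -> {fset point}).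
Hypothesis hT : forall x : X, T x \in triangles K /\ conv (T x) (val x).

Lemma spline_of_value Q (x : X) A : (forall A, A \in triangles K -> Q A \is hom d) ->
  edge_cond Q -> A \in triangles K -> conv A (val x) ->
  spline_of T Q x = peval (dehom (Q A)) (val x).
Proof.
move=> Qd hQ AT Ax; have [xT xc] := hT x.
by rewrite peval_dehom; exact: edge_cond_value.
Qed.

Lemma spline_of_spline Q : (forall A, A \in triangles K -> Q A \is hom d) ->
  edge_cond Q -> spline_space r s d (spline_of T Q).
Proof.
move=> Qd hQ; split.
  move=> x V nV; apply/set_type_nbhsP.
  have nA A : A \in triangles K -> \forall y \near val x, conv A (val x) -> V (peval (dehom (Q A)) y).
    move=> AT; have [Ax|nAx] := pselect (conv A (val x)); last by near=> y.
    have : nbhs (peval (dehom (Q A)) (val x) : R^o) V by rewrite -(spline_of_value Qd hQ AT Ax).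
    move=> nAV; have nAy : nbhs (val x) [set y | V (peval (dehom (Q A)) y)] by exact: (@peval_continuous _ _ (dehom (Q A)) (val x) V nAV).
    by apply: filterS nAy => y Vy _; exact: Vy.
  exists [set y | (forall A, A \in triangles K -> conv A (val x) -> V (peval (dehom (Q A)) y)) /\
                  (forall A, A \in K -> conv A y -> conv A (val x))].
    apply: filterI; last exact: local_simplices.
    exact: (@near_all_seq _ _ (triangles K) (fun A y => conv A (val x) -> V (peval (dehom (Q A)) y)) _ nA).
  move=> y [h1 h2]; have [yT yc] := hT y.
  rewrite /= (spline_of_value Qd hQ yT yc); apply: h1 => //.
  by apply: h2 => //; exact: triangle_in_K.
exists (fun A => dehom (Q A)); split.
- by move=> A AT; split; [apply: msize_dehom; exact: Qd|move=> x Ax; exact: spline_of_value].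
- move=> t tI; have tE := interior_edge_edge tI.
  have [a [b [ab tab]]] := edge_split0 tE; rewrite tab in tI tE *.
  have [c [e [cT eT c0 e0 hce]]] := interior_edge_pair hK ab tI.
  have sub z : ([fset a; b] `<=` [fset a; b; z])%fset by apply/fsubsetP => w; rewrite !inE => ->.
  have [[n [u [h [hl hE]]]] _] := hQ _ _ _ tI cT eT (sub c) (sub e).
  (* On the plane the form of the edge is [k] times [det a b]. All generators [h i] being the same
     power of it, the two pieces differ by that power times [\sum_i u i], so [trunc_glue] extends
     both to the whole plane. *)
  pose k := peval (ell [fset a; b]%fset) (embed c) / det a b c.
  pose H := dehom (\sum_i u i).
  exists setT, (trunc_glue (dehom (Q [fset a; b; e]%fset)) (det_poly a b)
    (k ^+ (r [fset a; b]%fset).+1 *: H) (r [fset a; b]%fset).+1); split=> //.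
  + exact: openT.
  + exact: trunc_glue_class_C.
  move=> x [A /= [AT sA] Ax]; rewrite (spline_of_value Qd hQ AT Ax) /trunc_glue peval_det_poly.
  have dc : det a b c != 0 by rewrite gt_eqF.
  have de : det a b e != 0 by rewrite lt_eqF.
  have diff y : peval (dehom (Q [fset a; b; c]%fset)) y =
      peval (dehom (Q [fset a; b; e]%fset)) y +
      det a b y ^+ (r [fset a; b]%fset).+1 * peval (k ^+ (r [fset a; b]%fset).+1 *: H) y.
    apply/eqP; rewrite addrC -subr_eq -pevalB -dehomB hE peval_dehom; apply/eqP.
    rewrite pevalZ /H peval_dehom !peval_sum mulrA -exprMn mulr_sumr.
    apply: eq_bigr => i _; rewrite pevalM (hl i) pevalXn (ell_det y dc tE) -/k mulrC.
    by congr (_ ^+ _ * _); rewrite mulrC.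
  case: (hce A AT sA) => AE; rewrite AE in Ax *.
    have /(tri_convP _ dc)[_ _] := Ax; rewrite /bary pmulr_lge0 ?invr_gt0 // => h0.
    by rewrite max_l // diff.
  have /(tri_convP _ de)[_ _] := Ax; rewrite /bary nmulr_lge0 ?invr_lt0 // => h0.
  by rewrite max_r // expr0n mul0r addr0.
- move=> g gV A B AT gA BT gB m ms; exact: edge_cond_derivs.
Unshelve. all: by end_near.
Qed.

Lemma open_conv_segment a b c x p (u : R) : det a b c != 0 -> conv [fset a; b; c]%fset x ->
  open_conv [fset a; b; c]%fset p -> 0 < u -> u <= 1 ->
  open_conv [fset a; b; c]%fset ((1 - u) *: x + u *: p).
Proof.
move=> dt /(tri_convP _ dt) [x1 x2 x3] /(tri_open_convP _ dt) [p1 p2 p3] u0 u1.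
have aff a' b' c' : bary a' b' c' ((1 - u) *: x + u *: p) =
    (1 - u) * bary a' b' c' x + u * bary a' b' c' p.
  by rewrite /bary det_affine mulrDl !mulrA.
have u1' : 0 <= 1 - u by rewrite subr_ge0.
apply/(tri_open_convP _ dt); split; rewrite aff; apply: ltr_wpDl;
  solve [exact: mulr_ge0|exact: mulr_gt0].
Qed.

Lemma open_conv_center a b c : det a b c != 0 ->
  open_conv [fset a; b; c]%fset (3^-1 *: a + 3^-1 *: b + 3^-1 *: c).
Proof.
move=> dt; apply/(tri_open_convP _ dt).
have e : 3^-1 + 3^-1 + 3^-1 = 1 :> R by lra.
by have [-> -> ->] := bary_of_comb dt e; split; rewrite invr_gt0.
Qed.

Lemma triangle_open_closure A x : A \in triangles K -> conv A x -> closure (open_conv A) x.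
Proof.
move=> AT Ax V nV; have /fset0Pn[a aA] := simplex_neq0 hK (triangle_in_K AT).
have [b [c [dt AE]]] := triangle_split hK AT aA; rewrite AE in Ax *.
have [u /andP[u0 u1] Vu] := segment_near (3^-1 *: a + 3^-1 *: b + 3^-1 *: c) nV.
exists ((1 - u) *: x + u *: (3^-1 *: a + 3^-1 *: b + 3^-1 *: c)); split=> //.
by apply: open_conv_segment => //; [exact: open_conv_center|lra].
Qed.

Lemma triangle_open A : A \in triangles K -> open (open_conv A).
Proof.
move=> AT; have /fset0Pn[a aA] := simplex_neq0 hK (triangle_in_K AT).
have [b [c [dt AE]]] := triangle_split hK AT aA.
by rewrite openE AE => x /(near_open_triangle dt).
Qed.

(** Homogenizing the pieces inverts the construction. Along the open edge the derivatives of both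
    pieces are limits of those of the smooth extension, so they agree; [segment_principal] turns
    this into divisibility by a power of the edge form. *)
Lemma spline_is_spline_of (f : X -> R^o) : spline_space r s d f ->
  exists Q, [/\ forall A, A \in triangles K -> Q A \is hom d, edge_cond Q & f = spline_of T Q].
Proof.
move=> [cf [P [hP hC hV]]]; exists (fun A => homogenize d (P A)).
have Qd A : A \in triangles K -> homogenize d (P A) \is hom d.
  by move=> /hP[Pd _]; exact: homogenize_hom.
split=> //; last first.
  apply/funext => x; have [xT xc] := hT x; have [_ h] := hP _ xT.
  by rewrite (h x xc) /spline_of -peval_dehom homogenizeK.
move=> t A B tI AT BT tA tB; have tE := interior_edge_edge tI.
have hd : homogenize d (P A) - homogenize d (P B) \is hom d by apply: rpredB; exact: Qd.
have derivs k x : (forall m, (mdeg m <= k)%N -> peval (mderivm m (P A)) x = peval (mderivm m (P B)) x) ->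
    ideal_pow (vertex_ideal x) k.+1 (homogenize d (P A) - homogenize d (P B)).
  move=> h; apply/(vertex_smoothP k x hd) => m mk.
  by rewrite dehomB !homogenizeK mderivmB pevalB h // subrr.
split; last first.
  move=> g /= gt; apply: derivs => m ms.
  have gV : g \in vertices K by exact: simplex_vertex (edge_in_K tE) gt.
  by apply: (hV g gV) => //; [exact: (fsubsetP tA)|exact: (fsubsetP tB)].
have [U [F [oU AU CF fF]]] := hC t tI.
have [a [b [ab tab]]] := edge_split0 tE.
have [l0 l1 la lb] : [/\ ell t != 0, ell t \is hom 1,
    peval (ell t) (embed a) = 0 & peval (ell t) (embed b) = 0].
  by rewrite tab in tE *; exact: (ell_facts hell ab tE).
apply: (segment_principal ab l0 l1 la lb) => u u0 u1; apply: derivs => m mr.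
have ox : open_conv t ((1 - u) *: a + u *: b).
  by rewrite tab; apply/open_conv2P => //; exists u; rewrite ?u0.
have cx C : (t `<=` C)%fset -> conv C ((1 - u) *: a + u *: b).
  by move=> tC; apply: (conv_sub tC); exact: open_conv_sub.
have FE C : C \in triangles K -> (t `<=` C)%fset -> forall y, open_conv C y -> F y = peval (P C) y.
  move=> CT tC y oy; have Cy := open_conv_sub oy.
  have Xy : X y by exists C; [exact: triangle_in_K|].
  have := fF (exist _ y (mem_set Xy)) _; rewrite /= => <-; last by exists C.
  by have [_ h] := hP C CT; rewrite (h (exist _ y (mem_set Xy))).
apply: (class_C_agree CF (triangle_open AT) (triangle_open BT) (FE A AT tA) (FE B BT tB)) => //.
- by apply: AU; exists A => //; exact: cx.
- by apply: triangle_open_closure => //; exact: cx.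
- by apply: triangle_open_closure => //; exact: cx.
Qed.

(** On the open triangle [A] the selection [T] can only return [A], and a polynomial vanishing on a
    nonempty open set is zero. *)
Lemma spline_of_eq0 Q : (forall A, A \in triangles K -> Q A \is hom d) ->
  spline_of T Q = 0 -> forall A, A \in triangles K -> Q A = 0.
Proof.
move=> Qd Q0 A AT; apply: (dehom_inj (Qd A AT)); apply/eqP/negPn/negP => P0.
have /fset0Pn[a aA] := simplex_neq0 hK (triangle_in_K AT).
have [b [c [dt AE]]] := triangle_split hK AT aA.
have oc : open_conv A (3^-1 *: a + 3^-1 *: b + 3^-1 *: c) by rewrite AE; exact: open_conv_center.
have nA : nbhs (3^-1 *: a + 3^-1 *: b + 3^-1 *: c) (open_conv A).
  by apply: open_nbhs_nbhs; split=> //; exact: triangle_open.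
have [y oy /andP[/eqP + _]] := nbhs_off_lines nA P0 P0; apply.
have AK := triangle_in_K AT.
have Xy : X y by exists A => //; exact: open_conv_sub.
have [yT yc] := hT (exist _ y (mem_set Xy)).
have sub := carrier_sub hK (triangle_in_K yT) AK oy yc.
have TE : T (exist _ y (mem_set Xy)) = A.
  apply/esym/eqP; rewrite eqEfcard sub; move: AT yT; rewrite !in_triangles => /andP[_ /eqP->] /andP[_ /eqP->].
  by [].
rewrite peval_dehom.
by have := congr1 (fun f : X -> R^o => f (exist _ y (mem_set Xy))) Q0; rewrite /spline_of TE.
Qed.

End Splines.

(** * Scalar matrices acting on families of vectors *)

Section ScalarMatrixMaps.
Context {F : fieldType} {W : vectType F}.

Definition ffun_mx {I J : finType} (M : J -> I -> F) (P : {ffun I -> W}) : {ffun J -> W} :=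
  [ffun j => \sum_i M j i *: P i].

Lemma ffun_mx_is_linear (I J : finType) (M : J -> I -> F) : linear (ffun_mx M).
Proof.
move=> c P Q; apply/ffunP => j; rewrite !ffunE scaler_sumr -big_split.
by apply: eq_bigr => i _; rewrite !ffunE scalerDr !scalerA mulrC.
Qed.

HB.instance Definition _ (I J : finType) (M : J -> I -> F) :=
  GRing.isLinear.Build F {ffun I -> W} {ffun J -> W} *:%R (ffun_mx M) (ffun_mx_is_linear M).

(** In a basis of [W] the sequence is a sum of copies of the scalar one, and preimages are found
    coordinate by coordinate. *)
Lemma ffun_mx_exact (I J L : finType) (M : J -> I -> F) (N : L -> J -> F) :
  (forall l i, \sum_j N l j * M j i = 0) ->
  (forall q : J -> F, (forall l, \sum_j N l j * q j = 0) ->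
     exists P : I -> F, forall j, \sum_i M j i * P i = q j) ->
  limg (linfun (ffun_mx M)) = lker (linfun (ffun_mx N)).
Proof.
move=> NM ex; apply/vspaceP => q; rewrite memv_ker lfunE /=; apply/idP/eqP.
  move=> /memv_imgP[P _ ->]; rewrite lfunE /=; apply/ffunP => l; rewrite !ffunE.
  transitivity (\sum_i (\sum_j N l j * M j i) *: P i); last first.
    by rewrite big1 // => i _; rewrite NM scale0r.
  under [RHS]eq_bigr do rewrite scaler_suml.
  rewrite exchange_big; apply: eq_bigr => j _; rewrite ffunE scaler_sumr.
  by apply: eq_bigr => i _; rewrite scalerA.
move=> q0; pose b := vbasis {:W}.
have /choice[P hP] : forall k : 'I_(\dim {:W}), exists P : I -> F,
    forall j, \sum_i M j i * P i = coord b k (q j).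
  move=> k; apply: ex => l.
  transitivity (coord b k (ffun_mx N q l)); last by rewrite q0 ffunE linear0.
  by rewrite ffunE linear_sum; apply: eq_bigr => j _; rewrite linearZ.
apply/memv_imgP; exists [ffun i => \sum_k P k i *: b`_k]; first exact: memvf.
rewrite lfunE /=; apply/ffunP => j; rewrite ffunE {1}(coord_vbasis (memvf (q j))).
under [RHS]eq_bigr do rewrite ffunE scaler_sumr.
rewrite exchange_big; apply: eq_bigr => k _; rewrite -hP scaler_suml.
by apply: eq_bigr => i _; rewrite scalerA.
Qed.

End ScalarMatrixMaps.

Section FsetExtension.
Context {T : choiceType} {V : nmodType} (A : {fset T}).

(** Extension by 0: the vector spaces are indexed by finite types, while the sums run over finite
    sets. *)
Definition fext (f : A -> V) (x : T) : V := if insub x is Some u then f u else 0.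

Lemma fextE f (u : A) : fext f (val u) = f u.
Proof. by rewrite /fext valK. Qed.

End FsetExtension.

Lemma sum_fext (F : fieldType) (T : choiceType) (V : lmodType F) (A : {fset T})
    (P : pred T) (c : T -> F) (f : A -> V) :
  \sum_(u : A) (if P (val u) then c (val u) else 0) *: f u =
  \sum_(x <- A | P x) c x *: fext f x.
Proof.
rewrite big_seq_fsetE /= [RHS]big_mkcond; apply: eq_bigr => u _.
by rewrite fextE; case: ifP => // _; rewrite scale0r.
Qed.

(** * Assembly of the dimension formula *)

Section Assembly.
Context {R : realType}.
Local Notation S := (mpoly 3 R).
Local Notation point := 'rV[R]_2.
Context (K : {fset {fset point}}) (hK : simplicial_complex K) (hdisk : disk_complex K).
Context (r : {fset point} -> nat) (s : point -> nat) (ell : {fset point} -> S).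
Context (hell : forall tau, tau \in edges K -> vanishing_linear_form tau (ell tau)).
Context (d : nat).
Local Notation J := (J_edge r s ell).
Local Notation JV := (J_vertex K r s ell).
Local Notation W := (dhomog 3 R d).
Local Notation TT := (triangles K).
Local Notation EE := (interior_edges K).
Local Notation VV := (interior_vertices K).

Definition edge_triangle_mx (t : EE) (A : TT) : R :=
  if (val t `<=` val A)%fset then esgn (val t) (val A) else 0.

Definition vertex_edge_mx (g : VV) (t : EE) : R :=
  if val g \in val t then eps (val g) (val t) else 0.

(** A triangle at [g] has two edges at [g], and [det g c b = - det g b c] makes their contributions
    cancel. *)
Lemma vertex_edge_triangle_mx g A : \sum_t vertex_edge_mx g t * edge_triangle_mx t A = 0.
Proof.
transitivity (\sum_(t <- EE | (val g \in t) && (t `<=` val A)%fset) esgn t (val A) * eps (val g) t).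
  rewrite big_seq_fsetE /= [RHS]big_mkcond; apply: eq_bigr => t _.
  rewrite /vertex_edge_mx /edge_triangle_mx; case: ifP => _ /=; last by rewrite mul0r.
  by case: ifP => _; rewrite ?mulr0 // mulrC.
have [gA|gA] := boolP (val g \in val A); last first.
  rewrite big1 // => t /andP[gt /fsubsetP/(_ _ gt)]; by rewrite (negbTE gA).
have [b [c [dt AE]]] := triangle_split hK (valP A) gA; have := valP A; rewrite /= AE => AT.
rewrite (sum_vertex_edges hK _ (valP g) AT dt) esgnE //.
have e : det (val g) c b = - det (val g) b c by rewrite /det; ring.
have -> : [fset val g; b; c]%fset = [fset val g; c; b]%fset by rewrite fsetUAC.
rewrite esgnE ?e ?oppr_eq0 // sgrN mulrAC eps_sqr mulrAC eps_sqr; ring.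
Qed.

Local Notation D := (linfun (@ffun_mx R W _ _ edge_triangle_mx)).
Local Notation B := (linfun (@ffun_mx R W _ _ vertex_edge_mx)).

Lemma triangle_complex_exact : limg D = lker B.
Proof.
apply: ffun_mx_exact => [g A|q hq]; first exact: vertex_edge_triangle_mx.
have [g gV|P hP] := @exactness R K hK hdisk (fext (V := R^o) q).
  rewrite -[RHS](hq [` gV]%fset).
  exact/esym/(@sum_fext R _ R^o EE (fun t => g \in t) (eps g) q).
exists (fun A => P (val A)) => t; have := hP _ (valP t); rewrite fextE => <-.
rewrite big_seq_fsetE /= [RHS]big_mkcond; apply: eq_bigr => A _.
by rewrite /edge_triangle_mx; case: ifP => // _; rewrite mul0r.
Qed.

Lemma coboundary_fext (P : {ffun TT -> W}) t :
  D P t = \sum_(A <- TT | (val t `<=` A)%fset) esgn (val t) A *: fext P A.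
Proof. by rewrite lfunE /= ffunE; exact: (sum_fext (fun A => (val t `<=` A)%fset)). Qed.

Lemma boundary_fext (q : {ffun EE -> W}) g :
  B q g = \sum_(t <- EE | val g \in t) eps (val g) t *: fext q t.
Proof.
by rewrite lfunE /= ffunE; exact: (@sum_fext R _ W EE (fun t => val g \in t) (eps (val g)) q).
Qed.

(* The sum defining the coboundary at an interior edge reduces, up to sign, to
   the difference of the values on the two adjacent triangles. *)
Lemma coboundary_cond (I : {fset point} -> set W) (P : {ffun TT -> W}) :
  (forall t, t \in EE -> I t 0 /\ forall c w, I t w -> I t (c *: w)) ->
  (forall t : EE, I (val t) (D P t)) <->
  (forall t A A', t \in EE -> A \in TT -> A' \in TT -> (t `<=` A)%fset -> (t `<=` A')%fset ->
     I t (fext P A - fext P A')).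
Proof.
move=> hI; split=> [h t A A' tE AT AT' tA tA'|h t].
  have [I0 IZ] := hI t tE.
  have [a [b [ab tab]]] := edge_split0 (interior_edge_edge tE); rewrite tab in tE tA tA' I0 IZ *.
  have [c [e [cT eT _ hce /(_ (fext P)) sumE]]] := coboundaryE hK W ab tE.
  have := h [` tE]%fset; rewrite coboundary_fext /= sumE => /(IZ (eps a [fset a; b]%fset)).
  rewrite scalerA eps_sqr scale1r => Ice.
  have Iec : I [fset a; b]%fset (fext P [fset a; b; e]%fset - fext P [fset a; b; c]%fset).
    by rewrite -opprB -scaleN1r; exact: IZ.
  by case: (hce A AT tA) => ->; case: (hce A' AT' tA') => ->; rewrite ?subrr.
have tE := valP t; rewrite coboundary_fext /=.
have [I0 IZ] := hI _ tE; have := h (val t).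
have [a [b [ab tab]]] := edge_split0 (interior_edge_edge tE); rewrite /= tab in tE I0 IZ *.
have [c [e [cT eT _ hce /(_ (fext P)) ->]]] := coboundaryE hK W ab tE.
move=> h'; apply: IZ; apply: h' => //; by apply/fsubsetP => x; rewrite !inE => ->.
Qed.

(** Since the triangles are connected through interior edges, the kernel consists of constant
    families: a copy of the forms of degree [d] in three variables. *)
Lemma dim_constants : \dim (lker D) = 'C(d + 2, 2).
Proof.
pose c (w : W) : {ffun TT -> W} := [ffun=> w].
have c_lin : linear c by move=> k u v; apply/ffunP => A; rewrite !ffunE.
pose cL : {linear W -> {ffun TT -> W}} :=
  HB.pack c (GRing.isLinear.Build R W {ffun TT -> W} *:%R c c_lin).
have cE w : linfun cL w = c w by rewrite lfunE.
have [A0 A0T] := support_neq0 hK hdisk.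
have z0 (t : {fset point}) : t \in EE ->
    [set 0] (0 : W) /\ forall k (w : W), [set 0] w -> [set 0] (k *: w).
  by move=> _; split=> // k w /= ->; rewrite scaler0.
have -> : lker D = limg (linfun cL).
  apply/vspaceP => P; rewrite memv_ker; apply/eqP/memv_imgP => [P0|[w _ ->]].
    have hc (t : EE) : [set 0] (D P t) by rewrite P0 ffunE.
    have hP := iffLR (coboundary_cond P z0) hc.
    exists (fext P A0); [exact: memvf|rewrite cE; apply/ffunP => A; rewrite ffunE -fextE].
    apply: (@strongly_connected R K hK hdisk (fun A => fext P A = fext P A0) A0) (valP A) => //.
    move=> A1 A2 a b A1T A2T _ _ s1 s2 tE <-; apply/esym/eqP; rewrite -subr_eq0; apply/eqP.
    exact: hP tE A1T A2T s1 s2.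
  apply/ffunP => t; rewrite ffunE.
  apply: (iffRL (coboundary_cond (linfun cL w) z0)) => t' A A' _ AT AT' _ _ /=.
  rewrite (fextE (linfun cL w) [` AT]%fset) (fextE (linfun cL w) [` AT']%fset).
  by rewrite cE !ffunE subrr.
rewrite limg_dim_eq ?dimvf.
  by rewrite /dim /= -(bin_sub (leq_addl d 2)) addnK.
apply/eqP; rewrite -subv0; apply/subvP => w; rewrite memv_cap => /andP[_].
rewrite memv_ker cE memv0 => /eqP/ffunP/(_ [` A0T]%fset); rewrite !ffunE => ->; exact: eqxx.
Qed.

Lemma degree_part_vspace (I : set S) :
  I 0 -> (forall c u v, I u -> I v -> I (c *: u + v)) ->
  exists U : {vspace W}, (forall w, (w \in U) <-> I (val w)) /\
    has_dim (degree_part I d) (\dim U).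
Proof.
move=> I0 IL; have [||U UE] := @set_is_vspace _ W [set w | I (val w)].
- by have := linear0 (@mpoly_of_dhomog 3 R d); rewrite /= => ->.
- by move=> c u v Iu Iv; have := linearP (@mpoly_of_dhomog 3 R d) c u v; rewrite /= => ->; exact: IL.
exists U; split=> //.
apply: (@has_dim_image R W S (@mpoly_of_dhomog 3 R d) U) => [u _ u0|p].
  by apply: val_inj; rewrite /= u0.
split=> [[Ip hp]|[u uU ->]].
  by exists (DHomog hp) => //; apply/UE.
by split; [exact/UE|exact: (valP u)].
Qed.

Lemma J_vertex_linear g c p q : JV g p -> JV g q -> JV g (c *: p + q).
Proof.
move=> [u [hu ->]] [v [hv ->]]; exists (fun t => c *: u t + v t); split.
  move=> t tE gt; have JI := J_ideal r s hell (interior_edge_edge tE).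
  by have [_ ID _] := JI; apply: ID; [apply: is_idealZ => //; exact: hu|exact: hv].
by rewrite scaler_sumr -big_split.
Qed.

Lemma J_vertex0 g : JV g 0.
Proof.
exists (fun=> 0); split; last by rewrite big1.
by move=> t tE _; have [] := J_ideal r s hell (interior_edge_edge tE).
Qed.

(** The hypothesis carries everything that requires [d] to be large; the rest holds in every
    degree. *)
Lemma dimension_count :
  (forall p : point -> S, (forall g, g \in VV -> JV g (p g) /\ p g \is hom d) ->
   exists q : {fset point} -> S, (forall t, t \in EE -> J t (q t) /\ q t \is hom d) /\
    forall g, g \in VV -> p g = \sum_(t <- EE | g \in t) eps g t *: q t) ->
  exists (dimS : nat) (dimJ1 : {fset point} -> nat) (dimJ0 : point -> nat),
    [/\ has_dim (spline_space (K := K) r s d) dimS,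
        forall t, t \in EE -> has_dim (degree_part (J t) d) (dimJ1 t),
        forall g, g \in VV -> has_dim (degree_part (JV g) d) (dimJ0 g)
      & (dimS + \sum_(g <- VV) dimJ0 g = 'C(d + 2, 2) + \sum_(t <- EE) dimJ1 t)%N].
Proof.
move=> surj.
have /choice[UE hUE] t : exists U : {vspace W}, t \in EE ->
    (forall w, (w \in U) <-> J t (val w)) /\ has_dim (degree_part (J t) d) (\dim U).
  have [tE|_] := boolP (t \in EE); last by exists 0%VS.
  have JI := J_ideal r s hell (interior_edge_edge tE); have [J0 JD _] := JI.
  have [//|c u v Ju Jv|U hU] := @degree_part_vspace (J t); last by exists U.
  by apply: JD => //; exact: is_idealZ.
have /choice[UV hUV] g : exists U : {vspace W},
    (forall w, (w \in U) <-> JV g (val w)) /\ has_dim (degree_part (JV g) d) (\dim U).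
  by apply: degree_part_vspace; [exact: J_vertex0|move=> *; exact: J_vertex_linear].
have [JE [JEE dimJE]] := vspace_ffun (fun t : EE => UE (val t)).
have [JW [JWE dimJW]] := vspace_ffun (fun g : VV => UV (val g)).
(* One inclusion only inserts signs into the definition of [J_vertex]; the other is the hypothesis
   [surj]. *)
have imB : (B @: JE = JW)%VS.
  apply/vspaceP => p; apply/memv_imgP/idP => [[q qE ->]|pW].
    rewrite JWE; apply/forallP => g; apply/(proj1 (hUV _)).
    exists (fun t => eps (val g) t *: val (fext q t)); split.
      move=> t tE _; apply: is_idealZ; first exact: (J_ideal r s hell (interior_edge_edge tE)).
      rewrite (fextE q [` tE]%fset); apply/(proj1 (hUE _ tE)).
      by move: qE; rewrite JEE => /forallP.
    by rewrite boundary_fext linear_sum.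
  have [|q [qJ qp]] := surj (fun g => val (fext p g)).
    move=> g gV; rewrite (fextE p [` gV]%fset); split; last exact: valP.
    by apply/(proj1 (hUV _)); move: pW; rewrite JWE => /forallP/(_ [` gV]%fset).
  exists [ffun t => DHomog (proj2 (qJ _ (valP t)))].
    rewrite JEE; apply/forallP => t; rewrite ffunE.
    by apply/(proj1 (hUE _ (valP t))); exact: (proj1 (qJ _ (valP t))).
  apply/ffunP => g; rewrite boundary_fext; apply: val_inj.
  have := qp _ (valP g); rewrite fextE => ->; rewrite linear_sum.
  rewrite big_seq_cond [RHS]big_seq_cond; apply: eq_bigr => t /andP[tE _].
  by rewrite linearZ (fextE _ [` tE]%fset) ffunE.
have /choice[T hT] (x : support K) : exists A, A \in TT /\ conv A (val x).
  have [A AK Ax] := set_mem (valP x); have [A' A'T sA] := simplex_sub_triangle hK hdisk AK.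
  by exists A'; split=> //; exact: conv_sub Ax.
have phiL := linearP (@mpoly_of_dhomog 3 R d).
have phi0 : val (0 : W) = 0 by exact: (linear0 (@mpoly_of_dhomog 3 R d)).
have phiB (u v : W) : val (u - v) = val u - val v by exact: (linearB (@mpoly_of_dhomog 3 R d)).
have phiZ c (w : W) : val (c *: w) = c *: val w by exact: (linearZ_LR (@mpoly_of_dhomog 3 R d)).
pose QQ (P : {ffun TT -> W}) A : S := val (fext P A).
have Qhom P A : A \in TT -> QQ P A \is hom d by move=> _; exact: valP.
have condE P : P \in (D @^-1: JE)%VS <-> edge_cond K r s ell (QQ P).
  have z t : t \in EE -> J t (val (0 : W)) /\ forall c (w : W), J t (val w) -> J t (val (c *: w)).
    move=> tE; have JI := J_ideal r s hell (interior_edge_edge tE); split.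
      by rewrite phi0; have [] := JI.
    by move=> c w Jw; rewrite phiZ; exact: is_idealZ.
  have [cD Dc] := @coboundary_cond (fun t w => J t (val w)) P z.
  rewrite -memv_preim JEE; split=> [/forallP h|h].
    move=> t A A' tE AT AT' tA tA'; rewrite /QQ -phiB; apply: cD => // t'.
    by apply/(proj1 (hUE _ (valP t'))); exact: h.
  apply/forallP => t; apply/(proj1 (hUE _ (valP t))); apply: Dc => t' A A' tE AT AT' tA tA'.
  by rewrite phiB; exact: h.
have QQ_lin c P P' A : QQ (c *: P + P') A = c *: QQ P A + QQ P' A.
  rewrite /QQ /fext; case: insub => [u|]; first by rewrite !ffunE; exact: phiL.
  by rewrite phi0 scaler0 addr0.
pose phi (P : {ffun TT -> W}) : support K -> R^o := spline_of T (QQ P).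
have phi_lin : linear phi.
  move=> c P P'; apply/funext => x; rewrite /phi /spline_of QQ_lin pevalD pevalZ //.
pose phiH : {linear {ffun TT -> W} -> (support K -> R^o)} :=
  HB.pack phi (GRing.isLinear.Build R {ffun TT -> W} (support K -> R^o) *:%R phi phi_lin).
have dimS : has_dim (spline_space (K := K) r s d) (\dim (D @^-1: JE)%VS).
  apply: (@has_dim_image R _ _ phiH) => [P _ P0|f].
    apply/ffunP => A; rewrite ffunE -fextE; apply: val_inj; rewrite phi0.
    exact: (spline_of_eq0 hK hT (Qhom P) P0 (valP A)).
  split=> [hf|[P PU ->]]; last first.
    by apply: (spline_of_spline hK hdisk hell hT (Qhom P)); exact/condE.
  have [Q [Qd Qc ->]] := spline_is_spline_of hK hell hT hf.
  pose P := [ffun A : TT => DHomog (Qd _ (valP A))].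
  have QE A : A \in TT -> QQ P A = Q A by move=> AT; rewrite /QQ (fextE P [` AT]%fset) ffunE.
  exists P.
    by apply/condE => t A A' tE AT AT' tA tA'; rewrite !QE //; exact: Qc.
  by apply/funext => x; rewrite /= /phi /spline_of QE //; have [] := hT x.
exists (\dim (D @^-1: JE)%VS), (fun t => \dim (UE t)), (fun g => \dim (UV g)); split=> //.
- by move=> t tE; exact: (proj2 (hUE t tE)).
- by move=> g _; exact: (proj2 (hUV g)).
have := dim_preim_exact JE triangle_complex_exact.
by rewrite imB dimJW dimJE dim_constants !big_seq_fsetE.
Qed.

End Assembly.

Theorem theorem5p2 (R : realType) (K : {fset {fset 'rV[R]_2}})
    (hK : simplicial_complex K) (hdisk : disk_complex K)
    (r : {fset 'rV[R]_2} -> nat) (s : 'rV[R]_2 -> nat)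
    (ell : {fset 'rV[R]_2} -> mpoly.mpoly 3 R)
    (hell : forall tau, tau \in edges K ->
       vanishing_linear_form tau (ell tau)) :
  exists d0 : nat, forall d : nat, (d0 <= d)%N ->
    exists (dimS : nat) (dimJ1 : {fset 'rV[R]_2} -> nat)
           (dimJ0 : 'rV[R]_2 -> nat),
      [/\ has_dim (spline_space (K := K) r s d) dimS,
          forall tau, tau \in interior_edges K ->
            has_dim (degree_part (J_edge r s ell tau) d) (dimJ1 tau),
          forall gamma, gamma \in interior_vertices K ->
            has_dim (degree_part (J_vertex K r s ell gamma) d) (dimJ0 gamma)
        & (dimS%:Z = 'C(d + 2, 2)%:Z
             + \sum_(tau <- interior_edges K) (dimJ1 tau)%:Z
             - \sum_(gamma <- interior_vertices K) (dimJ0 gamma)%:Z)%R].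
Proof.
have [d0 surj] := vertex_surjective hK hdisk r s hell.
exists d0 => d /surj/(dimension_count hK hdisk hell)[dimS [dimJ1 [dimJ0 [hS h1 h0 e]]]].
exists dimS, dimJ1, dimJ0; split=> //.
by apply/eqP; rewrite eq_sym subr_eq -!(big_morph Posz PoszD (erefl _)) -!PoszD e.
Qed.
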